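(* (a) A linear order is CSB of a limit type iff it is isomorphic to a finite sum of linear orders from $\mathcal L\cup\mathcal L^*\cup\mathcal Z\cup\mathcal Z^*$. (b) Let $\mathbb X_i$, $i\in I$, be CSB linear orders of a limit type with pairwise disjoint non-empty domains. Then $\bigcup_{i\in I}\mathbb X_i$ is a reversible poset iff there is no infinite $J\subseteq I$ such that $\mathbb X_i\cong\mathbb X_j$ for all $i,j\in J$.
   Context: Linear orders and posets are regarded as binary structures $\langle X,<\rangle$; the union of disjoint ones is $\langle\bigcup X_i,\bigcup<_i\rangle$. A structure is reversible iff every bijective homomorphism from it to itself is an automorphism. A linear order is scattered iff $\mathbb Q$ does not embed into it. A linear order $\mathbb L$ is CSB iff every linear order $\mathbb L'$ bi-embeddable with $\mathbb L$ (each embeds into the other) is isomorphic to $\mathbb L$. Sums $\sum_{s\in S}\mathbb L_s$ are ordered (lexicographic) sums over a linear order $S$; finite sums $\mathbb L_1+\dots+\mathbb L_n$ place $\mathbb L_1$ first. A scattered linear order $\mathbb L$ is of a limit type iff $\mathbb L$ is bi-embeddable with some $\sum_{s\in S}\mathbb L_s$ where $S$ is scattered and each $\mathbb L_s$ is isomorphic to $\omega$ or to $\omega^*$ ($\omega$ with reversed order); a general linear order is of a limit type only if it is scattered. $\mathcal L$ is the class of well orders isomorphic to limit ordinals; $\mathcal Z$ is the class of linear orders isomorphic to $\omega^\theta\omega^*+\omega^\delta$ for ordinals $1\le\theta<\delta$, where $\omega^\theta\omega^*$ denotes the sum over $\omega^*$ of copies of the ordinal $\omega^\theta$ (ordinal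 exponentiation); $\mathcal L^*$ and $\mathcal Z^*$ are the classes of reverses of members of $\mathcal L$ and $\mathcal Z$. *)

(* Defs.v *)
From Stdlib Require Import RelationClasses Relation_Operators.
From mathcomp Require Import all_boot all_order all_algebra.
From mathcomp Require Import all_classical.

Set Implicit Arguments.
Unset Strict Implicit.
Unset Printing Implicit Defensive.

Record binstr : Type := BinStr { dom :> Type; prec : dom -> dom -> Prop }.
Arguments prec {b} x y.

Definition hom (X Y : binstr) (f : X -> Y) : Prop :=
  forall x y, prec x y -> prec (f x) (f y).

Definition strong_hom (X Y : binstr) (f : X -> Y) : Prop :=
  forall x y, prec x y <-> prec (f x) (f y).

Definition embeds (X Y : binstr) : Prop :=
  exists f : X -> Y, injective f /\ strong_hom f.

Definition iso (X Y : binstr) : Prop :=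
  exists f : X -> Y, bijective f /\ strong_hom f.

Definition biembeddable (X Y : binstr) : Prop := embeds X Y /\ embeds Y X.

Definition reversible (X : binstr) : Prop :=
  forall f : X -> X, bijective f -> hom f -> strong_hom f.

Definition poset (X : binstr) : Prop := StrictOrder (@prec X).

Definition linear (X : binstr) : Prop :=
  poset X /\ forall x y : X, prec x y \/ x = y \/ prec y x.

(* Ordinals are represented by well orders, considered up to [iso]. *)
Definition wellorder (X : binstr) : Prop :=
  linear X /\ well_founded (@prec X).

Definition rev_str (X : binstr) : binstr := BinStr (fun x y : X => prec y x).

Definition omega : binstr := BinStr (fun m n : nat => (m < n)%N).

Definition omega_star : binstr := rev_str omega.

Definition rationals : binstr := BinStr (fun p q : rat => (p < q)%R).

Definition ord_str (n : nat) : binstr := BinStr (fun i j : 'I_n => (i < j)%N).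

Definition below (X : binstr) (d : X) : binstr :=
  BinStr (fun x y : {x : X | prec x d} => prec (proj1_sig x) (proj1_sig y)).

Definition osum (S : binstr) (L : S -> binstr) : binstr :=
  @BinStr {s : S & L s}
    (lexprod S (fun s => L s) (@prec S) (fun s => @prec (L s))).

Definition oadd (X Y : binstr) : binstr :=
  @BinStr (X + Y)%type (le_AsB X Y (@prec X) (@prec Y)).

(* Indices label summands, so the domains are disjoint by construction; with
   the empty relation on the indices, [lexprod] relates only pairs of elements
   of the same summand. *)
Definition dunion (I : Type) (X : I -> binstr) : binstr :=
  @BinStr {i : I & X i}
    (lexprod I (fun i => X i) (fun _ _ => False) (fun i => @prec (X i))).

(* Ordinal power omega^T of a well order T: finitely supported functions
   T -> omega, compared at the largest argument where they differ.  The
   function f stands for the Cantor normal form in which omega^t has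
   coefficient f t. *)
Definition omega_pow (T : binstr) : binstr :=
  @BinStr {f : T -> nat | finite_set [set t | f t <> 0%N]}
    (fun f g => exists t : T,
       (proj1_sig f t < proj1_sig g t)%N /\
       forall s : T, prec t s -> proj1_sig f s = proj1_sig g s).

Definition scattered (X : binstr) : Prop :=
  linear X /\ ~ embeds rationals X.

Definition CSB (X : binstr) : Prop :=
  linear X /\
  forall Y : binstr, linear Y -> biembeddable X Y -> iso X Y.

Definition limit_type (X : binstr) : Prop :=
  scattered X /\
  exists (S : binstr) (L : S -> binstr),
    [/\ scattered S,
        forall s, iso (L s) omega \/ iso (L s) omega_star
      & biembeddable X (osum L)].

(* Zero does not count as a limit ordinal. *)
Definition class_L (X : binstr) : Prop :=
  [/\ wellorder X, inhabited X & forall x : X, exists y : X, prec x y].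

Definition ord_lt (X Y : binstr) : Prop := exists d : Y, iso X (below d).

Definition class_Z (X : binstr) : Prop :=
  exists theta delta : binstr,
    [/\ wellorder theta, wellorder delta, inhabited theta, ord_lt theta delta
      & iso X (oadd (osum (fun _ : omega_star => omega_pow theta))
                    (omega_pow delta))].

Definition star (C : binstr -> Prop) (X : binstr) : Prop :=
  exists Y : binstr, C Y /\ iso X (rev_str Y).

Definition summand (X : binstr) : Prop :=
  class_L X \/ star class_L X \/ class_Z X \/ star class_Z X.

(* The empty sum (n = 0) is allowed: it gives the empty linear order, which is
   CSB and of a limit type (take S empty). *)
Definition finite_sum_of (C : binstr -> Prop) (X : binstr) : Prop :=
  exists (n : nat) (L : ord_str n -> binstr),
    (forall i, C (L i)) /\ iso X (osum L).

(* Main.v *)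
(* An order X that is CSB of a limit type is a sum of copies of omega and its reverse
   over a scattered index order S, and no point can be inserted in it so as to have no
   immediate neighbour.  The orders all of whose final segments are well founded are
   well-quasi-ordered; if some final segment of S were not a finite sum of pieces of one
   color that are well founded upwards (omega) or downwards (its reverse), then in
   a tail of X that embeds in all of its tails one could insert omega + 1 + omega^* without
   leaving the bi-embeddability class.  So X is a finite sum of such pieces.  In a
   piece V that is not well ordered, let the additively indecomposable well orders that
   embed in all its initial segments have a largest element A: then V is A omega^* + B
   plus a well order with B > A, since otherwise V would absorb a point inserted after it.
   If there is no largest one, take A_0 < A_1 < ... cofinal: V can be exchanged for a sum
   over omega^* of the A_(2n) or of the A_(2n+1), with non-isomorphic results.
   Conversely, in a shortest representation as a sum of indecomposable blocks no
   two neighbours embed in either of them, so self-embeddings respect the blocks, and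
   a bi-embeddable order is cut into blocks bi-embeddable with the given ones.

   A union with infinitely many isomorphic components is not reversible because each
   component splits into two copies of itself (even and odd elements of each omega).  In the
   other direction a bijective endomorphism acts on the components; if two are merged,
   there is an infinite backward orbit, along which the components form
   a descending chain for embeddability; it stabilizes, and CSB turns this into
   infinitely many isomorphic components. *)

From Stdlib Require List.
From mathcomp Require Import all_boot all_order all_algebra all_classical.
Require Import Defs.

Set Implicit Arguments.
Unset Strict Implicit.
Unset Printing Implicit Defensive.

(** When all final segments of V are well founded, the coinitial end of V is governed by the well
    orders that recur arbitrarily low in it: an end cut into intervals [u(n+1), u n) can be copied
    greedily into any end in which these intervals recur. From this come the well-quasi-order
    (compare the recurrent well orders and what remains above the end), the comparison with A
    omega^* and the exchange of an end for a sum over omega^*. The obstacle is that bi-embeddability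
    does not determine such an end up to isomorphism. If a largest recurrent A exists, the ambiguity
    is absorbed by a larger B that follows. If not, multiplicities betray the exchange: in a sum of
    the A_(2n) the order A_(2n) fits just once into suitable intervals, while each A_(2n+1) contains
    it twice. Insertions are detected because each point of a sum of copies of omega and omega^* has
    an immediate neighbour. Room for omega + 1 + omega^* is found in intervals that are
    monochromatic in neither color: failure for omega produces a copy of omega^*, and conversely. *)

(* Between linear orders the strictly increasing maps are exactly the embeddings. *)
Definition emb (A B : binstr) : Prop := exists f : A -> B, hom f.

Definition sub (X : binstr) (P : X -> Prop) : binstr :=
  BinStr (fun x y : {x : X | P x} => prec (sval x) (sval y)).

Lemma emb_refl A : emb A A.
Proof. by exists id. Qed.

Lemma emb_trans B A C : emb A B -> emb B C -> emb A C.
Proof. by move=> [f hf] [g hg]; exists (g \o f) => x y /hf /hg. Qed.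

Lemma emb_subP A (X : binstr) (P : X -> Prop) :
  emb A (sub P) <-> exists f : A -> X, (forall a, P (f a)) /\ hom f.
Proof.
split=> [[f hf]|[f [Pf hf]]].
  by exists (fun a => sval (f a)); split=> [a|x y /hf//]; case: (f a).
by exists (fun a => exist _ (f a) (Pf a)).
Qed.

Lemma emb_sub (X : binstr) (P : X -> Prop) : emb (sub P) X.
Proof. by exists sval. Qed.

Lemma emb_subS (X : binstr) (P Q : X -> Prop) :
  (forall x, P x -> Q x) -> emb (sub P) (sub Q).
Proof. by move=> PQ; apply/emb_subP; exists sval; split=> [[x Px]|//]; apply: PQ. Qed.

(** * Linear orders, embeddings and isomorphisms *)

Section Linear.
Variables (X : binstr) (hX : linear X).

Lemma lirr (x : X) : ~ prec x x.
Proof. by case: hX => [[h _] _]; apply: h. Qed.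

Lemma ltr (y x z : X) : prec x y -> prec y z -> prec x z.
Proof. by case: hX => [[_ h] _]; apply: h. Qed.

Lemma ltot (x y : X) : prec x y \/ x = y \/ prec y x.
Proof. by case: hX. Qed.

Lemma lasym (x y : X) : prec x y -> ~ prec y x.
Proof. by move=> xy yx; apply: (@lirr x); apply: ltr yx. Qed.

Lemma lle (x y : X) : ~ prec y x -> prec x y \/ x = y.
Proof. by move=> h; case: (ltot x y) => [|[]]; auto. Qed.

Lemma lelt (y x z : X) : ~ prec y x -> prec y z -> prec x z.
Proof. by move=> /lle[|->//]; apply: ltr. Qed.

Lemma ltle (y x z : X) : prec x y -> ~ prec z y -> prec x z.
Proof. by move=> xy /lle[|<-//]; apply: ltr. Qed.

Lemma lele (y x z : X) : ~ prec y x -> ~ prec z y -> ~ prec z x.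
Proof. by move=> h1 h2 h3; apply: h2; apply: ltle h3 h1. Qed.

Lemma lltP (x y : X) : prec x y \/ ~ prec x y.
Proof. exact: EM. Qed.

Lemma linear_sub (P : X -> Prop) : linear (sub P).
Proof.
split; first by split=> [x /lirr//|x y z]; apply: ltr.
move=> [x Px] [y Py] /=; case: (ltot x y) => [|[e|]]; auto.
by right; left; apply: eq_exist.
Qed.

End Linear.

Lemma linear_rev X : linear X -> linear (rev_str X).
Proof.
move=> hX; split; first by split=> [x /(lirr hX)//|x y z] /= h1 h2; apply: (ltr hX) h2 h1.
by move=> x y; case: (ltot hX x y) => [|[]]; rewrite /=; auto.
Qed.

Lemma rev_strK X : rev_str (rev_str X) = X.
Proof. by case: X. Qed.

Lemma hom_inj (A B : binstr) (f : A -> B) : linear A -> linear B -> hom f -> injective f.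
Proof.
move=> hA hB hf x y e; case: (ltot hA x y) => [|[//|]] /hf; rewrite e => /(lirr hB)//.
Qed.

Lemma hom_strong (A B : binstr) (f : A -> B) : linear A -> linear B -> hom f -> strong_hom f.
Proof.
move=> hA hB hf x y; split=> [/hf//|h].
case: (ltot hA x y) => [//|[e|/hf h']]; first by rewrite e in h; case: (lirr hB h).
by case: (lasym hB h h').
Qed.

Lemma emb_embeds A B : linear A -> linear B -> emb A B -> embeds A B.
Proof. by move=> hA hB [f hf]; exists f; split; [apply: hom_inj|apply: hom_strong]. Qed.

Lemma embeds_emb A B : embeds A B -> emb A B.
Proof. by move=> [f [_ hf]]; exists f => x y /hf. Qed.

Lemma iso_surj (A B : binstr) (f : A -> B) : linear A -> linear B -> hom f ->
  (forall b, exists a, f a = b) -> iso A B.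
Proof.
move=> hA hB hf sf; exists f; split; last exact: hom_strong.
pose g b := sval (cid (sf b)).
have fg b : f (g b) = b by rewrite /g; case: cid.
by exists g => // x; apply: (hom_inj hA hB hf).
Qed.

Lemma iso_refl A : iso A A.
Proof. by exists id; split=> //; exists id. Qed.

Lemma iso_sym A B : iso A B -> iso B A.
Proof.
move=> [f [[g fg gf] hf]]; exists g; split; first by exists f.
by move=> x y; rewrite -{1}(gf x) -{1}(gf y); split=> /hf.
Qed.

Lemma iso_trans B A C : iso A B -> iso B C -> iso A C.
Proof.
move=> [f [bf hf]] [g [bg hg]]; exists (g \o f); split; first exact: bij_comp.
by move=> x y; rewrite hf hg.
Qed.

Lemma iso_emb A B : iso A B -> emb A B.
Proof. by move=> [f [_ hf]]; exists f => x y /hf. Qed.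

Lemma iso_emb' A B : iso A B -> emb B A.
Proof. by move=> /iso_sym /iso_emb. Qed.

Lemma linear_emb (A B : binstr) (f : A -> B) : injective f -> strong_hom f -> linear B -> linear A.
Proof.
move=> jf hf hB; split.
  split=> [x /hf /(lirr hB)//|x y z /hf h1 /hf h2]; apply/hf; exact: ltr h1 h2.
by move=> x y; case: (ltot hB (f x) (f y)) => [/hf|[/jf|/hf]]; auto.
Qed.

Lemma linear_iso A B : iso A B -> linear B -> linear A.
Proof. by move=> [f [bf hf]]; apply: linear_emb hf; apply: bij_inj. Qed.

Lemma emb_rev A B : emb A B -> emb (rev_str A) (rev_str B).
Proof. by move=> [f hf]; exists f => x y /hf. Qed.

Lemma iso_rev A B : iso A B -> iso (rev_str A) (rev_str B).
Proof. by move=> [f [bf hf]]; exists f; split=> // x y; apply: hf. Qed.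

Definition equi A B := emb A B /\ emb B A.

Lemma biemb_equi A B : biembeddable A B -> equi A B.
Proof. by move=> [/embeds_emb h /embeds_emb]. Qed.

Lemma equi_biemb A B : linear A -> linear B -> equi A B -> biembeddable A B.
Proof. by move=> hA hB [h1 h2]; split; apply: emb_embeds. Qed.

Lemma CSB_iso X Y : CSB X -> linear Y -> emb X Y -> emb Y X -> iso X Y.
Proof. by move=> [hX h] hY h1 h2; apply: h => //; apply: equi_biemb. Qed.

(** * Well orders *)

Definition wf (X : binstr) : Prop := forall P : X -> Prop,
  (exists x, P x) -> exists x, P x /\ forall y, P y -> ~ prec y x.

Lemma wf_well_founded X : wf X -> well_founded (@prec X).
Proof.
move=> wX x; apply: contrapT => nx; have [y [ny my]] := wX _ (ex_intro (fun x => ~ Acc prec x) x nx).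
by apply: ny; constructor=> z zy; apply: contrapT => /my.
Qed.

Lemma well_founded_wf X : well_founded (@prec X) -> wf X.
Proof.
move=> wX P [x Px]; apply: contrapT => h.
elim/(well_founded_ind wX): x Px => x IH Px; apply: h; exists x; split=> // y Py yx.
exact: IH yx Py.
Qed.

Definition wo X := linear X /\ wf X.

Lemma woE X : wellorder X <-> wo X.
Proof.
split=> -[lX h]; split; first exact lX.
- exact: well_founded_wf h.
- exact lX.
- exact: wf_well_founded h.
Qed.

Lemma wf_emb A B : emb A B -> wf B -> wf A.
Proof.
move=> [f hf] wB P [x Px].
have [y [[z [Pz <-]] my]] := wB (fun b => exists a, P a /\ f a = b) (ex_intro _ _ (ex_intro _ _ (conj Px erefl))).
by exists z; split=> // t Pt /hf; apply: my; exists t.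
Qed.

Lemma wo_emb A B : linear A -> emb A B -> wf B -> wo A.
Proof. by move=> hA h wB; split=> //; apply: wf_emb h wB. Qed.

Lemma wo_sub (X : binstr) (P : X -> Prop) : wo X -> wo (sub P).
Proof. by move=> [lX wX]; split; [apply: linear_sub|apply: wf_emb (emb_sub _) wX]. Qed.

Lemma wo_iso A B : iso A B -> wo B -> wo A.
Proof. by move=> h [lB wB]; split; [apply: linear_iso lB|apply: wf_emb wB; apply: iso_emb]. Qed.

Lemma wo_hom_ge (X : binstr) (f : X -> X) : wo X -> hom f -> forall x, ~ prec (f x) x.
Proof.
move=> [lX wX] hf x h; have [y [hy my]] := wX _ (ex_intro (fun x => prec (f x) x) x h).
by apply: (my (f y)) => //; apply: hf.
Qed.

Lemma wo_nemb_below (X : binstr) (a : X) : wo X -> ~ emb X (below a).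
Proof.
move=> wX /(@emb_subP X X) [f [fa hf]].
exact: (wo_hom_ge wX hf (fa a)).
Qed.

Section Trichotomy.
Variables (A B : binstr) (wA : wo A) (wB : wo B).

Let ub (a : A) (F : forall x, prec x a -> B) (b : B) : Prop := forall x (h : prec x a), prec (F x h) b.

(** Transfinite recursion: each [a] goes to the least element of [B] strictly above all earlier
    values. Where no such element exists the value is the default [b0], hence the premise on [a]. *)
Lemma least_bound (b0 : B) : exists F : A -> B, forall a,
  (exists b, forall x, prec x a -> prec (F x) b) ->
  (forall x, prec x a -> prec (F x) (F a)) /\
  forall b, (forall x, prec x a -> prec (F x) b) -> ~ prec b (F a).
Proof.
case: wA => lA fA; case: wB => lB fB.
pose G (a : A) (F : forall x, prec x a -> B) : B :=
  match pselect (exists b, ub F b) with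
  | left h => sval (cid (fB _ h)) | right _ => b0 end.
pose F := Fix (wf_well_founded fA) (fun _ => B) G.
exists F => a [b hb].
have -> : F a = G a (fun x _ => F x).
  rewrite /F Fix_eq // => x f g e; congr G.
  by apply: functional_extensionality_dep => y; apply: functional_extensionality_dep.
rewrite /G; case: pselect => [h|[]]; last by exists b.
case: cid => c [h1 h2] /=; split=> // d hd; apply: h2 => x; exact: hd.
Qed.

Lemma wo_trichotomy : iso A B \/ (exists b : B, iso A (below b)) \/ (exists a : A, iso B (below a)).
Proof.
case: (wA) => lA fA; case: (wB) => lB fB.
(* The recursion takes a default value from [B], so an empty [B] is treated apart. *)
case: (pselect (exists b0 : B, True)) => [[b0 _]|nB]; last first.
  case: (pselect (exists a0 : A, True)) => [/fA [a [_ ma]]|nA].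
    right; right; exists a; have f : B -> below a by move=> b; case: nB; exists b.
    apply: (@iso_surj _ _ f) => //.
    - exact: linear_sub.
    - by move=> x; case: nB; exists x.
    - by move=> [x hx]; case: (ma x).
  left; have f : A -> B by move=> a; case: nA; exists a.
  apply: (@iso_surj _ _ f) => //; by [move=> x; case: nA; exists x|move=> x; case: nB; exists x].
have [F hF] := least_bound b0.
pose good a := exists b, forall x, prec x a -> prec (F x) b.
(* The image of [F] is downward closed. So the first point of [B] that it misses, or the first [a]
   at which the recursion fails, delimits the required initial segment. *)
have dn : forall a, good a -> forall y, prec y (F a) -> exists x, prec x a /\ F x = y.
  elim/(well_founded_ind (wf_well_founded fA)) => a IH ga y ya.
  have [h1 h2] := hF _ ga.
  have /existsNP[x /not_implyP[xa nxy]] : ~ (forall x, prec x a -> prec (F x) y) by move=> /h2.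
  case: (lle lB nxy) => [yx|->]; last by exists x.
  have gx : good x by exists (F x) => t tx; apply: (hF x _).1 => //; exists (F a) => s sx; apply: h1; apply: ltr lA _ _ _ sx xa.
  have [t [tx <-]] := IH _ xa gx _ yx.
  by exists t; split=> //; apply: ltr lA _ _ _ tx xa.
case: (pselect (forall a, good a)) => [ga|].
  have mF : hom F by move=> x y xy; apply: (hF _ (ga y)).1.
  case: (pselect (forall b, exists a, F a = b)) => [sF|/existsNP[b hb]].
    by left; apply: (@iso_surj _ _ F).
  right; left.
  have [b1 [h1 h2]] := fB _ (ex_intro (fun b => ~ exists a, F a = b) b hb).
  have Fb a : prec (F a) b1.
    case: (ltot lB (F a) b1) => [//|[e|/(dn _ (ga a))[x [_ e]]]]; first by case: h1; exists a.
    by case: h1; exists x.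
  exists b1; apply: (@iso_surj A (below b1) (fun a => exist _ (F a) (Fb a))) => //.
    exact: linear_sub.
  move=> [b' hb']; have [a ea] : exists a, F a = b' by apply: contrapT => /h2; apply.
  by exists a; apply: eq_exist.
move=> /existsNP[a ha]; right; right.
have [a1 [h1 h2]] := fA _ (ex_intro (fun a => ~ good a) a ha).
have g1 x : prec x a1 -> good x by move=> xa; apply: contrapT => /h2; apply.
exists a1; apply: iso_sym; apply: (@iso_surj (below a1) B (fun x => F (sval x))) => //.
- exact: linear_sub.
- by move=> [x hx] [y hy] /= xy; apply: (hF _ (g1 _ hy)).1.
- move=> b; have /existsNP[x /not_implyP[xa nxb]] : ~ (forall x, prec x a1 -> prec (F x) b).
    by move=> h; apply: h1; exists b.
  case: (lle lB nxb) => [/(dn _ (g1 _ xa))[y [yx e]]|->].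
    have ya : prec y a1 by apply: ltr lA _ _ _ yx xa.
    by exists (exist _ y ya).
  by exists (exist _ x xa).
Qed.

Lemma wo_lt : ~ emb A B -> exists a : A, iso B (below a).
Proof.
move=> h; case: wo_trichotomy => [/iso_emb //|[[b /iso_emb hb]|//]].
by case: h; apply: emb_trans hb (emb_sub _).
Qed.

Lemma wo_total : emb A B \/ emb B A.
Proof.
case: (pselect (emb A B)) => [|/wo_lt[a /iso_emb h]]; first by left.
by right; apply: emb_trans h (emb_sub _).
Qed.

Lemma wo_antisym : emb A B -> emb B A -> iso A B.
Proof.
move=> AB BA; case: wo_trichotomy => [//|[[b /iso_emb hb]|[a /iso_emb ha]]].
- by case: (wo_nemb_below wB (emb_trans BA hb)).
- by case: (wo_nemb_below wA (emb_trans AB ha)).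
Qed.

End Trichotomy.

Lemma emb_below_le (X : binstr) (a b : X) : linear X -> ~ prec b a -> emb (below a) (below b).
Proof. by move=> lX ab; apply: emb_subS => x xa; apply: ltle ab. Qed.

(** If [A i0] is not itself least, some members are initial segments [below a] of it; the one with
    the least such [a] embeds in all others. *)
Lemma wo_least (I : Type) (A : I -> binstr) : (exists i : I, True) -> (forall i, wo (A i)) ->
  exists i, forall k, emb (A i) (A k).
Proof.
move=> [i0 _] wA; apply: contrapT => /forallNP h.
have /existsNP[j /(wo_lt (wA i0) (wA j))[a0 ha0]] := h i0.
have [a [[i ia] ma]] := (wA i0).2 _ (ex_intro (fun a => exists i, iso (A i) (below a)) a0 (ex_intro (fun i => iso (A i) (below a0)) _ ha0)).
have /existsNP[k nk] := h i; apply: nk.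
case: (pselect (emb (A i0) (A k))) => [|/(wo_lt (wA i0) (wA k))[b kb]].
  by apply: emb_trans; apply: emb_trans (iso_emb ia) (emb_sub _).
apply: emb_trans (iso_emb ia) _; apply: emb_trans (iso_emb' kb).
by apply: emb_below_le; [case: (wA i0)|apply: ma; exists k].
Qed.

(** * Sums *)

Lemma oaddP (X Y : binstr) (p q : oadd X Y) : prec p q <->
  match p, q with
  | inl a, inl b => prec a b | inl _, inr _ => True
  | inr _, inl _ => False | inr a, inr b => prec a b
  end.
Proof.
split=> [h|]; first by case: h.
by case: p => a; case: q => b // h; constructor.
Qed.

Lemma linear_oadd X Y : linear X -> linear Y -> linear (oadd X Y).
Proof.
move=> hX hY; split.
  split=> [[x|x] /oaddP|[x|x] [y|y] [z|z] /oaddP // h1 /oaddP // h2]; try exact: lirr;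
  apply/oaddP => //; [exact: (ltr hX h1 h2)|exact: (ltr hY h1 h2)].
move=> [x|x] [y|y].
- case: (ltot hX x y) => [h|[->|h]]; [left|right; left|right; right] => //; exact/oaddP.
- by left; apply/oaddP.
- by right; right; apply/oaddP.
- case: (ltot hY x y) => [h|[->|h]]; [left|right; left|right; right] => //; exact/oaddP.
Qed.

Lemma emb_oadd A A' B B' : emb A A' -> emb B B' -> emb (oadd A B) (oadd A' B').
Proof.
move=> [f hf] [g hg].
exists (fun p : oadd A B => match p with inl a => inl (f a) | inr b => inr (g b) end : oadd A' B').
by move=> [x|x] [y|y] /oaddP h; apply/oaddP => //; [apply: hf|apply: hg].
Qed.

Lemma iso_oadd A A' B B' : iso A A' -> iso B B' -> iso (oadd A B) (oadd A' B').
Proof.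
move=> [f [[f' f1 f2] hf]] [g [[g' g1 g2] hg]].
exists (fun p : oadd A B => match p with inl a => inl (f a) | inr b => inr (g b) end : oadd A' B').
split; last by move=> [x|x] [y|y]; split=> /oaddP h; apply/oaddP => //; do ?[exact/hf|exact/hg].
exists (fun p : oadd A' B' => match p with inl a => inl (f' a) | inr b => inr (g' b) end : oadd A B).
  by move=> [x|x]; rewrite ?f1 ?g1.
by move=> [x|x]; rewrite ?f2 ?g2.
Qed.

Lemma emb_inl A B : emb A (oadd A B).
Proof. by exists inl => x y h; apply/oaddP. Qed.

Lemma emb_inr A B : emb B (oadd A B).
Proof. by exists inr => x y h; apply/oaddP. Qed.

Lemma oaddA A B C : iso (oadd A (oadd B C)) (oadd (oadd A B) C).
Proof.
exists (fun p : oadd A (oadd B C) => match p with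
  inl a => inl (inl a) | inr (inl b) => inl (inr b) | inr (inr c) => inr c end : oadd (oadd A B) C).
split.
  exists (fun p : oadd (oadd A B) C => match p with
    inl (inl a) => inl a | inl (inr b) => inr (inl b) | inr c => inr (inr c) end : oadd A (oadd B C)).
    by move=> [?|[?|?]].
  by move=> [[?|?]|?].
by move=> [x|[x|x]] [y|[y|y]]; split=> /oaddP h; apply/oaddP => //; do ?apply/oaddP => //; move/oaddP: h.
Qed.

Definition emptyo : binstr := BinStr (fun x y : void => False).

Lemma linear_emptyo : linear emptyo.
Proof. by split; [split=> [[]|[]]|case]. Qed.

Lemma oadd0o A : iso (oadd emptyo A) A.
Proof.
exists (fun p : oadd emptyo A => match p with inl a => match a with end | inr a => a end); split.
  by exists inr => [[[]|]|].
by move=> [[]|x] [[]|y]; split=> [/oaddP|h] //; apply/oaddP.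
Qed.

Lemma oaddo0 A : iso (oadd A emptyo) A.
Proof.
exists (fun p : oadd A emptyo => match p with inr a => match a with end | inl a => a end); split.
  by exists inl => [[|[]]|].
by move=> [x|[]] [y|[]]; split=> [/oaddP|h] //; apply/oaddP.
Qed.

Lemma iso_empty (A B : binstr) : (A -> False) -> (B -> False) -> iso A B.
Proof.
move=> nA nB; exists (fun a => False_rect _ (nA a)).
split; last by move=> x; case: (nA x).
by exists (fun b => False_rect _ (nB b)) => x; [case: (nA x)|case: (nB x)].
Qed.

Lemma rev_oadd A B : iso (rev_str (oadd A B)) (oadd (rev_str B) (rev_str A)).
Proof.
exists (fun p : rev_str (oadd A B) => match p with inl a => inr a | inr b => inl b end : oadd (rev_str B) (rev_str A)).
split; first by exists (fun p : oadd (rev_str B) (rev_str A) => match p with inl a => inr a | inr b => inl b end : rev_str (oadd A B)) => [[]|[]].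
by move=> [x|x] [y|y]; split=> h; [have /oaddP h' := h : @prec (oadd A B) _ _; apply/oaddP|
  have /oaddP h' := h; apply/(@oaddP A B)|have /oaddP h' := h : @prec (oadd A B) _ _; apply/oaddP|
  have /oaddP h' := h; apply/(@oaddP A B)|have /oaddP h' := h : @prec (oadd A B) _ _; apply/oaddP|
  have /oaddP h' := h; apply/(@oaddP A B)|have /oaddP h' := h : @prec (oadd A B) _ _; apply/oaddP|
  have /oaddP h' := h; apply/(@oaddP A B)].
Qed.

Lemma emb_oadd_into (A B X : binstr) (P Q : X -> Prop) :
  emb A (sub P) -> emb B (sub Q) -> (forall x y, P x -> Q y -> prec x y) -> emb (oadd A B) X.
Proof.
move=> /emb_subP[f [Pf hf]] /emb_subP[g [Qg hg]] PQ.
exists (fun p : oadd A B => match p with inl a => f a | inr b => g b end).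
by move=> [x|x] [y|y] /oaddP h //; [apply: hf|apply: PQ|apply: hg].
Qed.

Lemma emb_oadd_sub (A B X : binstr) (P Q R : X -> Prop) :
  emb A (sub P) -> emb B (sub Q) -> (forall x y, P x -> Q y -> prec x y) ->
  (forall x, P x -> R x) -> (forall x, Q x -> R x) -> emb (oadd A B) (sub R).
Proof.
move=> /emb_subP[f [Pf hf]] /emb_subP[g [Qg hg]] PQ PR QR; apply/emb_subP.
exists (fun p : oadd A B => match p with inl a => f a | inr b => g b end); split.
  by move=> [a|a]; auto.
by move=> [x|x] [y|y] /oaddP h //; [apply: hf|apply: PQ|apply: hg].
Qed.

Lemma iso_sub_cut (X : binstr) (P Q R : X -> Prop) : linear X ->
  (forall x, R x <-> P x \/ Q x) -> (forall x y, P x -> Q y -> prec x y) ->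
  iso (sub R) (oadd (sub P) (sub Q)).
Proof.
move=> hX hR PQ; apply: iso_sym.
pose f (p : oadd (sub P) (sub Q)) : sub R := match p with
  | inl a => exist R (sval a) (proj2 (hR _) (or_introl (proj2_sig a)))
  | inr a => exist R (sval a) (proj2 (hR _) (or_intror (proj2_sig a))) end.
apply: (@iso_surj _ _ f).
- by apply: linear_oadd; apply: linear_sub.
- exact: linear_sub.
- move=> [[x Px]|[x Px]] [[y Py]|[y Py]] /oaddP //= _; exact: PQ.
- move=> [x Rx]; case: (proj1 (hR x) Rx) => h.
    by exists (inl (exist _ x h)); apply: eq_exist.
  by exists (inr (exist _ x h)); apply: eq_exist.
Qed.

Lemma iso_subT (X : binstr) (P : X -> Prop) : (forall x, P x) -> iso X (sub P).
Proof.
move=> hP; exists (fun x => exist P x (hP x) : sub P); split=> //.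
exists sval; first by move=> x.
by move=> [x Px]; apply: eq_exist.
Qed.

Lemma iso_sub_eq (X : binstr) (P Q : X -> Prop) : (forall x, P x <-> Q x) -> iso (sub P) (sub Q).
Proof.
move=> h; have -> : P = Q by apply/funext => x; apply/propext.
exact: iso_refl.
Qed.

Lemma iso_cut (X : binstr) (P : X -> Prop) : linear X ->
  (forall x y, P y -> prec x y -> P x) -> iso X (oadd (sub P) (sub (fun x => ~ P x))).
Proof.
move=> hX hP; apply: (iso_trans (@iso_subT X (fun x => P x \/ ~ P x) (fun x => EM _))).
apply: iso_sub_cut => // x y Px nPy; case: (ltot hX x y) => [//|[e|yx]]; first by rewrite e in Px.
by case: nPy; apply: hP yx.
Qed.

Lemma emb_image (A X : binstr) (P : X -> Prop) (f : A -> X) (Q : A -> Prop) :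
  hom f -> (forall a, Q a -> P (f a)) -> emb (sub Q) (sub P).
Proof.
move=> hf QP; apply/emb_subP; exists (fun a => f (sval a)); split=> [[a Qa]|x y /hf//].
exact: QP.
Qed.

(** Proof irrelevance identifies the equation between the indices with [erefl]. *)
Lemma existT_inj (S : Type) (L : S -> Type) s (a b : L s) : existT L s a = existT L s b -> a = b.
Proof.
move=> e; have := projT2_eq e; set e1 := projT1_eq e.
by rewrite (Prop_irrelevance e1 erefl).
Qed.

Lemma osumP (S : binstr) (L : S -> binstr) s t (a : L s) (b : L t) :
  @prec (osum L) (existT _ s a) (existT _ t b) <->
  prec s t \/ exists e : s = t, prec (eq_rect s (fun s => dom (L s)) a t e) b.
Proof.
split=> [h|[h|[e]]]; last by subst t; right.
  move: h; move E1 : (existT _ s a) => p; move E2 : (existT _ t b) => q h.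
  case: h E1 E2 => [s1 s2 a1 a2 h E1 E2|s1 a1 a2 h E1 E2].
    by left; have /= -> := projT1_eq E1; have /= -> := projT1_eq E2.
  have /= e1 := projT1_eq E1; have /= e2 := projT1_eq E2; subst s t.
  by right; exists erefl; rewrite /= (existT_inj E1) (existT_inj E2).
by left.
Qed.

Lemma osum_same (S : binstr) (L : S -> binstr) s (a b : L s) : linear S ->
  @prec (osum L) (existT _ s a) (existT _ s b) <-> prec a b.
Proof.
move=> hS; rewrite osumP; split=> [[/(lirr hS)//|[e]]|h]; last by right; exists erefl.
by rewrite (Prop_irrelevance e erefl).
Qed.

Lemma osum_ne (S : binstr) (L : S -> binstr) s t (a : L s) (b : L t) : s <> t ->
  @prec (osum L) (existT _ s a) (existT _ t b) <-> prec s t.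
Proof. by move=> ne; rewrite osumP; split=> [[//|[e]]|]; auto. Qed.

Lemma osum_le (S : binstr) (L : S -> binstr) (p q : osum L) : prec p q ->
  prec (projT1 p) (projT1 q) \/ projT1 p = projT1 q.
Proof. by case: p q => [s a] [t b] /osumP[|[e _]]; auto. Qed.

Lemma linear_osum (S : binstr) (L : S -> binstr) : linear S -> (forall s, linear (L s)) -> linear (osum L).
Proof.
move=> hS hL; split.
  split=> [[s a] /(osum_same _ _ hS) /(lirr (hL s))//|[s a] [t b] [u c] h1 h2].
  case: (pselect (s = t)) => [e|ne].
    subst t; case: (pselect (s = u)) => [e|ne].
      by subst u; apply/(osum_same _ _ hS); apply: (ltr (hL s)) (proj1 (osum_same _ _ hS) h1) (proj1 (osum_same _ _ hS) h2).
    by apply/osumP; left; move/(osum_ne _ _ ne): h2.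
  move/(osum_ne _ _ ne): h1 => h1; apply/osumP; left; case: (osum_le h2) => /= [h|<- //].
  exact: (ltr hS) h1 h.
move=> [s a] [t b]; case: (ltot hS s t) => [h|[e|h]].
- by left; apply/osumP; left.
- subst t; case: (ltot (hL s) a b) => [h|[->|h]]; [left|right; left|right; right] => //; exact/(osum_same _ _ hS).
- by right; right; apply/osumP; left.
Qed.

Lemma emb_osum_into (S : binstr) (L : S -> binstr) (X : binstr) (Z : S -> X -> Prop) : linear S ->
  (forall s, emb (L s) (sub (Z s))) ->
  (forall s t x y, prec s t -> Z s x -> Z t y -> prec x y) -> emb (osum L) X.
Proof.
move=> hS h hZ.
have h' s : exists f : L s -> X, (forall a, Z s (f a)) /\ hom f by apply/emb_subP.
pose f s := sval (cid (h' s)).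
have fZ s a : Z s (f s a) by rewrite /f; case: cid => ? [].
have fh s : hom (f s) by rewrite /f; case: cid => ? [].
exists (fun p : osum L => f (projT1 p) (projT2 p)) => -[s a] [t b] h1.
case: (osum_le h1) => /= [st|e]; first exact: (hZ _ _ _ _ st (fZ _ _) (fZ _ _)).
by subst t; apply: fh; apply: (proj1 (osum_same _ _ hS) h1).
Qed.

Lemma iso_osum_idx (S S' : binstr) (L : S -> binstr) (L' : S' -> binstr) (phi : S -> S') :
  linear S -> linear S' -> hom phi -> (forall s', exists s, phi s = s') ->
  (forall s, iso (L s) (L' (phi s))) -> iso (osum L) (osum L').
Proof.
move=> hS hS' hp sp h.
pose f s := sval (cid (h s)).
have [fb fs] : (forall s, bijective (f s)) /\ forall s, strong_hom (f s).
  by split=> s; rewrite /f; case: cid => ? [].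
have ip := hom_inj hS hS' hp; have fp := hom_strong hS hS' hp.
exists (fun p : osum L => existT _ (phi (projT1 p)) (f _ (projT2 p)) : osum L'); split; last first.
  move=> [s a] [t b] /=; case: (pselect (s = t)) => [e|ne].
    subst t; apply: iff_trans (osum_same _ _ hS) _.
    by apply: iff_trans _ (iff_sym (osum_same _ _ hS')); apply: fs.
  apply: iff_trans (osum_ne _ _ ne) _.
  by apply: iff_trans _ (iff_sym (osum_ne _ _ _)); [apply: fp|move=> /ip].
have sur p : exists q : osum L, existT _ (phi (projT1 q)) (f _ (projT2 q)) = p :> osum L'.
  case: p => s' b; have [s e] := sp s'; subst s'; have [g _ gf] := fb s.
  by exists (existT _ s (g b)); rewrite /= gf.
exists (fun p => sval (cid (sur p))) => [[s a]|p]; case: cid => // -[t b] /= e.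
have /ip e1 := projT1_eq e; subst t; congr existT.
exact: (bij_inj (fb s) (existT_inj e)).
Qed.

Lemma iso_osum (S : binstr) (L L' : S -> binstr) : linear S ->
  (forall s, iso (L s) (L' s)) -> iso (osum L) (osum L').
Proof. by move=> hS h; apply: (@iso_osum_idx _ _ _ _ id) => // s; exists s. Qed.

Lemma rev_osum (S : binstr) (L : S -> binstr) : linear S ->
  iso (rev_str (osum L)) (@osum (rev_str S) (fun s => rev_str (L s))).
Proof.
move=> hS; exists (fun p => p); split; first by exists id.
move=> [s a] [t b] /=; case: (pselect (s = t)) => [e|ne].
  subst t; apply: iff_trans (osum_same b a hS) _.
  exact: (iff_sym (@osum_same (rev_str S) (fun s => rev_str (L s)) s a b (linear_rev hS))).
apply: iff_trans (osum_ne b a (nesym ne)) _.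
exact: (iff_sym (@osum_ne (rev_str S) (fun s => rev_str (L s)) s t a b ne)).
Qed.

Lemma iso_fibers (X S : binstr) (pi : X -> S) : linear X -> linear S ->
  (forall x y, prec x y -> ~ prec (pi y) (pi x)) ->
  iso X (osum (fun s => sub (fun x => pi x = s))).
Proof.
move=> hX hS mono.
pose L s := sub (fun x : X => pi x = s).
apply: (@iso_surj X (osum L) (fun x => existT _ (pi x) (exist (fun y => pi y = pi x) x erefl : L (pi x)))) => //.
- by apply: linear_osum => // s; apply: linear_sub.
- move=> x y xy; case: (ltot hS (pi x) (pi y)) => [h|[e|/(mono _ _ xy)//]].
    by apply/osumP; left.
  have key s t (a : L s) (b : L t) : s = t -> prec (sval a) (sval b) ->
      @prec (osum L) (existT _ s a) (existT _ t b).
    by move=> est h; subst t; apply/osumP; right; exists erefl.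
  exact: key.
- by move=> [s [x e]]; exists x; case: _ / e.
Qed.

(** Lists make it easy to split, merge and reverse finite sums; [finite_sum_of_lsum] translates to
    and from sums over [ord_str n]. *)
Definition lsum : seq binstr -> binstr := foldr oadd emptyo.

Lemma linear_lsum l : (forall V, List.In V l -> linear V) -> linear (lsum l).
Proof.
elim: l => [|V l IH] h; first exact: linear_emptyo.
by apply: linear_oadd; [apply: h; left|apply: IH => W hW; apply: h; right].
Qed.

Lemma lsum_cat l1 l2 : iso (lsum (l1 ++ l2)) (oadd (lsum l1) (lsum l2)).
Proof.
elim: l1 => [|V l IH] /=; first exact/iso_sym/oadd0o.
apply: iso_trans (oaddA _ _ _); apply: iso_oadd IH; exact: iso_refl.
Qed.

Lemma lsum1 V : iso (lsum [:: V]) V.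
Proof. exact: oaddo0. Qed.

Lemma rev_lsum l : iso (rev_str (lsum l)) (lsum (rev (map rev_str l))).
Proof.
elim: l => [|V l IH] /=; first by apply: iso_empty => -[].
apply: iso_trans (rev_oadd _ _) _; rewrite rev_cons -cats1.
apply: iso_trans (iso_oadd IH (iso_sym (lsum1 _))) _.
exact/iso_sym/lsum_cat.
Qed.

Lemma lsum_fibers (X : binstr) (pi : X -> nat) j m : linear X ->
  (forall x y, prec x y -> (pi x <= pi y)%N) ->
  iso (sub (fun x => (j <= pi x < j + m)%N)) (lsum [seq sub (fun x : X => pi x = k) | k <- iota j m]).
Proof.
move=> hX mono; elim: m j => [|m IH] j /=.
  apply: iso_empty; last by case.
  by move=> [x /=]; rewrite addn0; case: leqP => //= h1; rewrite ltnNge h1.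
apply: iso_trans (iso_oadd (iso_refl _) (IH j.+1)).
apply: iso_sub_cut => // [x|x y h /andP[h1 h2]].
  rewrite addSnnS; split=> [/andP[]|[->|/andP[h ->]]].
  - by rewrite leq_eqVlt => /orP[/eqP->|->] => [|->]; auto.
  - by rewrite leqnn /= addnS ltnS leq_addr.
  - by rewrite ltnW.
case: (ltot hX x y) => [//|[e|/mono]]; first by rewrite -e h ltnn in h1.
by rewrite h leqNgt h1.
Qed.

Lemma linear_nat : linear omega.
Proof.
split; first by split=> [x h|x y z] /=; [rewrite /= ltnn in h|apply: ltn_trans].
by move=> x y /=; case: ltngtP; auto.
Qed.

Lemma linear_ord n : linear (ord_str n).
Proof.
split; first by split=> [x h|x y z] /=; [rewrite /= ltnn in h|apply: ltn_trans].
move=> x y /=; case: (ltngtP x y) => h; auto.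
by right; left; apply: val_inj.
Qed.

Lemma osum_ord_lsum n (L : ord_str n -> binstr) :
  iso (osum L) (lsum [seq L i | i <- enum 'I_n]).
Proof.
elim: n L => [|n IH] L.
  rewrite (size0nil (_ : size (enum 'I_0) = 0)) ?size_enum_ord //.
  by apply: iso_empty; [move=> [[]]|case].
rewrite enum_ordSl /= -map_comp.
apply: iso_trans (iso_oadd (iso_refl _) (IH (fun i => L (lift ord0 i)))).
pose f (p : oadd (L ord0) (@osum (ord_str n) (fun i => L (lift ord0 i)))) : osum L :=
  match p with inl a => existT _ ord0 a | inr q => existT _ (lift ord0 (projT1 q)) (projT2 q) end.
apply: iso_sym; exists f; split; last first.
  have ne (i : ord_str n) : ord0 <> lift ord0 i by move/(congr1 val).
  move=> [a|[i a]] [b|[j b]].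
  - apply: iff_trans (oaddP _ _) _; exact: (iff_sym (osum_same _ _ (linear_ord _))).
  - by split=> _; [apply/osumP; left|apply/oaddP].
  - by split=> [/oaddP//|/osumP[|[/esym/ne]]//].
  - split=> [/oaddP/osumP[h|[e h]]|/osumP[h|[e h]]].
    + by apply/osumP; left; rewrite /= /bump /= !add1n ltnS.
    + by subst j; apply/(osum_same _ _ (linear_ord _)).
    + by apply/oaddP; apply/osumP; left; rewrite /= /bump /= !add1n ltnS in h.
    + have e' : i = j := lift_inj e; subst j.
      by apply/oaddP; apply/(osum_same _ _ (linear_ord _)); rewrite (Prop_irrelevance e erefl) in h.
have sf p : exists q, f q = p.
  case: p => i a; case: (unliftP ord0 i) => [j e|e]; subst i.
    by exists (inr (existT _ j a)).
  by exists (inl a).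
have jf : injective f.
  move=> [a|[i a]] [b|[j b]] //= e.
  - by rewrite (existT_inj e).
  - by have e1 : i = j := lift_inj (projT1_eq e); subst j; rewrite (existT_inj e).
exists (fun p => sval (cid (sf p))) => p; last by case: cid.
by apply: jf; case: cid.
Qed.

Lemma linear_osum_ord n (L : ord_str n -> binstr) : (forall i, linear (L i)) -> linear (osum L).
Proof. by move=> h; apply: linear_osum => //; apply: linear_ord. Qed.

Lemma finite_sum_of_lsum (C : binstr -> Prop) X :
  finite_sum_of C X <-> exists l, List.Forall C l /\ iso X (lsum l).
Proof.
split=> [[n [L [hL hX]]]|[l [hl hX]]].
  exists [seq L i | i <- enum 'I_n]; split; last exact: iso_trans hX (osum_ord_lsum _).
  by elim: (enum 'I_n) => //= a s IH; constructor.
exists (size l), (fun i : ord_str (size l) => nth emptyo l i); split.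
  move=> i; case: i => i /= hi; elim: l i hl hi {hX} => // a l IH [|i] /List.Forall_cons_iff[h1 h2] //= hi.
  exact: IH.
apply: iso_trans hX _; apply: iso_sym; apply: iso_trans (osum_ord_lsum _) _.
rewrite (_ : map _ _ = l); first exact: iso_refl.
rewrite (_ : (fun i => _) = (fun j => nth emptyo l j) \o val) // map_comp val_enum_ord.
by rewrite -[RHS](mkseq_nth emptyo).
Qed.

(** * Additively indecomposable well orders *)

(** In a linear order [~ prec x a] plays the role of a <= x: [tail a] is the closed final segment
    from [a], and [ivl a b] is the half-open interval [a, b). *)
Definition tail (X : binstr) (a : X) : binstr := sub (fun x => ~ prec x a).
Definition ivl (X : binstr) (a b : X) : binstr := sub (fun x => ~ prec x a /\ prec x b).
Definition nomax (X : binstr) : Prop := forall a : X, exists b, prec a b.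
Definition nomin (X : binstr) : Prop := forall a : X, exists b, prec b a.
(* These are the orders isomorphic to some [omega_pow T]. *)
Definition AI (A : binstr) : Prop := [/\ wo A, inhabited A & forall a : A, emb A (tail a)].

Lemma AI_wo A : AI A -> wo A. Proof. by case. Qed.
Lemma AI_lin A : AI A -> linear A. Proof. by case=> [[]]. Qed.
Lemma AI_inh A : AI A -> inhabited A. Proof. by case. Qed.

Lemma emb_tail_iso (A B : binstr) (f : A -> B) a : strong_hom f -> emb (tail a) (tail (f a)).
Proof. by move=> hf; apply: (emb_image (f := f)) => [x y /hf//|x h /hf]. Qed.

Lemma AI_iso A B : iso A B -> AI A -> AI B.
Proof.
move=> AB [wA [a] hA]; have [f [bf hf]] := AB.
split; [exact: wo_iso (iso_sym AB) wA|by split; exact: f a|move=> b].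
have [g fg gf] := bf; rewrite -(gf b).
apply: emb_trans (iso_emb' AB) _; apply: emb_trans (hA (g b)) _; exact: emb_tail_iso.
Qed.

(** If [f a] lies in the upward closed [Q], then so does the image of the whole tail from [a], and
    [A] embeds in that tail. *)
Lemma AI_split_set (A X : binstr) (R Q : X -> Prop) : AI A -> emb A (sub R) ->
  (forall x y, Q x -> prec x y -> Q y) ->
  emb A (sub (fun x => R x /\ ~ Q x)) \/ emb A (sub (fun x => R x /\ Q x)).
Proof.
move=> [[lA wA] _ hA] /emb_subP[f [Rf hf]] hQ.
case: (pselect (exists a, Q (f a))) => [[a Qa]|nQ].
  right; apply: emb_trans (hA a) _; apply: (emb_image hf) => x /(lle lA) ax; split=> //.
  by case: ax => [/hf|<- //]; apply: hQ.
by left; apply/emb_subP; exists f; split=> // a; split=> // Qa; apply: nQ; exists a.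
Qed.

Lemma AI_split A P Q : AI A -> emb A (oadd P Q) -> emb A P \/ emb A Q.
Proof.
move=> AA h.
pose isr (p : oadd P Q) := if p is inr _ then True else False.
have : emb A (sub (fun p : oadd P Q => True)) by apply: emb_trans h (iso_emb (iso_subT _)).
move/AI_split_set => /(_ isr AA) [[x|x] [y|y] _ /oaddP //|/emb_subP[f [Rf hf]]|/emb_subP[f [Rf hf]]].
  have hx a : exists x, f a = inl x by case: (f a) (Rf a) => [x|y []//]; exists x.
  left; exists (fun a => sval (cid (hx a))) => a b /hf; case: cid => x /= ->; case: cid => y /= ->.
  by move/oaddP.
have hx a : exists x, f a = inr x by case: (f a) (Rf a) => [x []//|x]; exists x.
right; exists (fun a => sval (cid (hx a))) => a b /hf; case: cid => x /= ->; case: cid => y /= ->.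
by move/oaddP.
Qed.

Lemma AI_split_lsum A l : AI A -> emb A (lsum l) -> exists2 B, List.In B l & emb A B.
Proof.
move=> AA; elim: l => [|B l IH] /=; first by case: (AI_inh AA) => a [f _]; case: (f a).
by case/(AI_split AA) => [|/IH[C hC AC]]; [exists B => //; left|exists C => //; right].
Qed.

Lemma wo_nemb_add A (Q : binstr) : wo A -> inhabited Q -> ~ emb (oadd A Q) A.
Proof.
move=> wA [q] [g hg]; apply: (@wo_nemb_below A (g (inr q)) wA).
apply/(@emb_subP A A); exists (fun a => g (inl a)); split=> [a|x y h]; apply: hg; exact/oaddP.
Qed.

Lemma iso_below_tail (X : binstr) (c : X) : linear X -> iso X (oadd (below c) (tail c)).
Proof. by move=> lX; apply: (@iso_cut X (fun x => prec x c)) => // x y yc /(ltr lX); apply. Qed.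

(** [P] is isomorphic to some [below c] in [C], and the rest, [tail c], is isomorphic to [C]. *)
Lemma AI_absorb P C : AI C -> wo P -> ~ emb C P -> iso (oadd P C) C.
Proof.
move=> [wC _ hC] wP /(wo_lt wC wP)[c Pc].
apply: iso_trans (iso_sym (iso_below_tail c wC.1)); apply: iso_oadd Pc _.
by apply: wo_antisym => //; [apply: wo_sub|apply: emb_sub].
Qed.

(** Among all tails take one that is least for embeddability: it embeds in each of its own tails, as
    these are tails of [W]. *)
Lemma AI_tail (W : binstr) : wo W -> inhabited W -> exists x : W, AI (tail x).
Proof.
move=> wW [w0].
have [x hx] := @wo_least W (fun x => tail x) (ex_intro _ w0 I) (fun x => wo_sub _ wW).
exists x; split; [exact: wo_sub|by split; exists x; apply: lirr wW.1 _|move=> [a ha]].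
apply: emb_trans (hx a) _; apply/(@emb_subP (tail a) (tail x)).
have h (y : tail a) : ~ prec (sval y) x by case: y => y hy /= yx; apply: hy; apply: ltle wW.1 _ _ _ yx ha.
by exists (fun y => exist _ (sval y) (h y)); split=> // -[y hy].
Qed.

Lemma wf_oadd A B : wf A -> wf B -> wf (oadd A B).
Proof.
move=> wA wB P [p Pp].
case: (pselect (exists a, P (inl a))) => [/wA[a [Pa ma]]|nA].
  by exists (inl a); split=> // -[b Pb /oaddP|b _ /oaddP//]; apply: ma.
have [b [Pb mb]] : exists b, P (inr b) /\ forall c, P (inr c) -> ~ prec c b.
  by apply: wB; case: p Pp => [a Pa|b]; [case: nA; exists a|exists b].
by exists (inr b); split=> // -[c Pc|c Pc /oaddP]; [case: nA; exists c|apply: mb].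
Qed.

Lemma wo_oadd A B : wo A -> wo B -> wo (oadd A B).
Proof. by move=> [lA wA] [lB wB]; split; [apply: linear_oadd|apply: wf_oadd]. Qed.

Lemma wo_emptyo : wo emptyo.
Proof. by split; [apply: linear_emptyo|move=> P [[]]]. Qed.

Lemma wo_lsum l : List.Forall wo l -> wo (lsum l).
Proof. by elim=> [|A {}l wA _]; [apply: wo_emptyo|apply: wo_oadd]. Qed.

Lemma linear_below (X : binstr) (x : X) : linear X -> linear (below x).
Proof. by move=> lX; apply: (@linear_sub X lX). Qed.

Lemma wo_below (X : binstr) (x : X) : wo X -> wo (below x).
Proof. by move=> wX; apply: (@wo_sub X). Qed.

Lemma below_below (X : binstr) (x : X) (y : below x) : linear X -> iso (below y) (below (sval y)).
Proof.
move=> lX; case: y => y yx /=.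
pose f (z : @below (below x) (exist _ y yx)) : below y := exist _ (sval (sval z)) (proj2_sig z).
apply: (@iso_surj _ _ f) => //.
- by do 2 apply: linear_below.
- exact: linear_below.
move=> [z zy]; have zx : prec z x by apply: ltr lX _ _ _ zy yx.
by exists (exist _ (exist _ z zx) zy : @below (below x) (exist _ y yx)); apply: eq_exist.
Qed.

Definition has_cnf W := exists l, List.Forall AI l /\ iso W (lsum l).

Lemma has_cnf_iso A B : iso A B -> has_cnf B -> has_cnf A.
Proof. by move=> AB [l [hl h]]; exists l; split=> //; apply: iso_trans AB h. Qed.

(** Cut off an indecomposable tail; what remains is a proper initial segment, for which [has_cnf_wo]
    has the induction hypothesis. *)
Lemma has_cnf_step W : wo W -> (forall x : W, has_cnf (below x)) -> has_cnf W.
Proof.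
move=> wW h; case: (pselect (inhabited W)) => [iW|nW]; last first.
  by exists [::]; split=> //; apply: iso_empty; [move=> x; apply: nW|case].
have [x Ax] := AI_tail wW iW; have [l [hl Bl]] := h x.
exists (l ++ [:: tail x]); split; first by apply/List.Forall_app; split=> //; constructor.
apply: iso_trans (iso_below_tail x wW.1) _; apply: iso_trans _ (iso_sym (lsum_cat _ _)).
apply: iso_oadd => //; exact/iso_sym/lsum1.
Qed.

Lemma has_cnf_wo W : wo W -> has_cnf W.
Proof.
move=> wW; apply: has_cnf_step => // x.
elim/(well_founded_ind (wf_well_founded wW.2)): x => x IH.
apply: has_cnf_step => [|y]; first exact: wo_below.
by apply: has_cnf_iso (below_below y wW.1) _; apply: IH; case: y.
Qed.

Lemma lsum_merge l1 A B C l2 : iso (oadd A B) C ->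
  iso (lsum (l1 ++ A :: B :: l2)) (lsum (l1 ++ C :: l2)).
Proof.
move=> h; apply: iso_trans (lsum_cat _ _) _; apply: iso_trans _ (iso_sym (lsum_cat _ _)).
apply: iso_oadd; first exact: iso_refl.
by apply: iso_trans (oaddA _ _ _) _; apply: iso_oadd h _; apply: iso_refl.
Qed.

Lemma adj_sorted (R : binstr -> binstr -> Prop) (l : seq binstr) :
  (forall A B C, R A B -> R B C -> R A C) ->
  (forall l1 A B l2, l = l1 ++ A :: B :: l2 -> R B A) ->
  forall l1 C l2, l = l1 ++ C :: l2 -> forall D, List.In D l2 -> R D C.
Proof.
move=> tR adj l1 C l2; elim: l2 l1 C => // B l2 IH l1 C e D /=.
have BC := adj _ _ _ _ e; case=> [<- //|hD]; apply: (tR _ _ _ _ BC).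
by apply: (IH (l1 ++ [:: C])) => //; rewrite e -catA.
Qed.

Lemma Forall_mid (T : Type) (P : T -> Prop) l1 a l2 : List.Forall P (l1 ++ a :: l2) <->
  [/\ List.Forall P l1, P a & List.Forall P l2].
Proof.
split=> [/List.Forall_app[h1 /List.Forall_cons_iff[h2 h3]]//|[h1 h2 h3]].
by apply/List.Forall_app; split=> //; constructor.
Qed.

(** Cantor normal form. Whenever a block does not contain its successor, the successor absorbs it,
    which shortens the list; in the end the blocks decrease. *)
Lemma cnf W : wo W -> exists l, [/\ List.Forall AI l, iso W (lsum l) &
  forall l1 C l2, l = l1 ++ C :: l2 -> forall D, List.In D l2 -> emb D C].
Proof.
move=> /has_cnf_wo[l [hl hW]].
move: {2}(size l) (leqnn (size l)) => n; elim: n l hl hW => [|n IH] l hl hW hn.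
  by exists [::]; case: l hl hW hn => // hl hW _; split=> // -[].
case: (pselect (forall l1 A B l2, l = l1 ++ A :: B :: l2 -> emb B A)) => [adj|].
  exists l; split=> //; apply: adj_sorted adj => A B C; exact: emb_trans.
move=> /existsNP[l1 /existsNP[A /existsNP[B /existsNP[l2 /not_implyP[e nBA]]]]].
subst l; move/Forall_mid: hl => [h1 AA /List.Forall_cons_iff[AB h2]].
apply: (IH (l1 ++ B :: l2)).
- by apply/Forall_mid.
- apply: iso_trans hW (lsum_merge _ _ _); apply: AI_absorb => //; exact: AI_wo.
- by move: hn; rewrite !size_cat /= !addnS ltnS.
Qed.

Definition rwf X := wf (rev_str X).

Lemma rwf_oadd A B : rwf A -> rwf B -> rwf (oadd A B).
Proof. by move=> h1 h2; apply: wf_emb (iso_emb (rev_oadd _ _)) _; apply: wf_oadd. Qed.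

Lemma rwf_nomax (A : binstr) : rwf A -> inhabited A -> ~ nomax A.
Proof. by move=> wA [a] h; have [|b [_ mb]] := wA (fun _ => True); [exists a|have [c /mb] := h b; apply]. Qed.

Lemma wf_nomin (A : binstr) : wf A -> inhabited A -> ~ nomin A.
Proof. by move=> wA [a] h; have [|b [_ mb]] := wA (fun _ => True); [exists a|have [c /mb] := h b; apply]. Qed.

Lemma AI_nomax A : AI A -> ~ nomax A -> forall a b : A, a = b.
Proof.
move=> [[lA wA] _ hA] /existsNP[m /forallNP hm].
have {}hm x : x = m \/ prec x m by case: (ltot lA x m) => [|[|/hm//]]; auto.
have [f hf] := hA m; have fm x : sval (f x) = m by case: (f x) => y /= ny; case: (hm y).
suff h a : a = m by move=> a b; rewrite (h a) (h b).
case: (hm a) => [//|/hf /=]; by rewrite !fm => /(lirr lA).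
Qed.

Lemma nomax_iso (A B : binstr) : iso A B -> nomax A -> nomax B.
Proof.
move=> /iso_sym[f [[g fg gf] hf]] nA b; have [c hc] := nA (f b).
by exists (g c); apply/hf; rewrite gf.
Qed.

Lemma nomin_iso (A B : binstr) : iso A B -> nomin A -> nomin B.
Proof. by move=> /iso_rev h; apply: (nomax_iso h). Qed.

Lemma nomax_oaddr (A B : binstr) : nomax (oadd A B) -> nomax B.
Proof. by move=> n b; have [[c|c] /oaddP // bc] := n (inr b); exists c. Qed.

Lemma nomax_AI A B : AI A -> AI B -> emb A B -> nomax A -> nomax B.
Proof.
move=> AA AB [f hf] nA; apply: contrapT => /(AI_nomax AB) sB.
case: (AI_inh AA) => a; have [b /hf] := nA a; rewrite (sB (f a) (f b)); exact: lirr (AI_lin AB) _.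
Qed.

(** A block with a maximum is a single point, and so are the later blocks, which embed in it. Then a
    nonempty end of [W] would be reversely well founded and would have a maximum. *)
Lemma cnf_nomax W l : iso W (lsum l) -> List.Forall AI l ->
  (forall l1 C l2, l = l1 ++ C :: l2 -> forall D, List.In D l2 -> emb D C) ->
  nomax W -> List.Forall nomax l.
Proof.
move=> hW hl srt nW; apply/List.Forall_forall => C hC; have [l1 [l2 e]] := List.in_split C l hC.
subst l; move/Forall_mid: (hl) => [_ AC h2].
apply: contrapT => nC; have nlast : nomax (lsum (C :: l2)).
  by apply: (@nomax_oaddr (lsum l1)); apply: (nomax_iso (iso_trans hW (lsum_cat _ _)) nW).
apply: rwf_nomax nlast; last by case: (AI_inh AC) => c; split; left.
have sing D : AI D -> ~ nomax D -> rwf D.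
  move=> AD /(AI_nomax AD) sD P [x Px]; exists x; split=> // y _ /=.
  by rewrite (sD y x); apply: lirr (AI_lin AD) _.
have : List.Forall (fun D => AI D /\ emb D C) (C :: l2).
  constructor; first by split=> //; apply: emb_refl.
  apply/List.Forall_forall => D hD; split; last exact: srt hD.
  by move/List.Forall_forall: h2; apply.
elim: (C :: l2) => [_ P [[]]|D l IH /List.Forall_cons_iff[[AD DC] h]].
apply: rwf_oadd (IH h); apply: sing => // nD; apply: nC; exact: nomax_AI nD.
Qed.

(** * Powers of omega *)

Lemma finite_set_list (T : Type) (A : set T) : finite_set A ->
  exists l : seq T, forall t, A t -> List.In t l.
Proof.
move=> /(@finite_seqP {classic T})[s ->]; exists s => t /=.
elim: s => //= a s IH; rewrite inE => /orP[/eqP ->|/IH]; [left|right] => //.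
Qed.

Lemma finite_max (X : binstr) (P : X -> Prop) : linear X -> finite_set [set x | P x] ->
  (exists x, P x) -> exists m, P m /\ forall x, P x -> ~ prec m x.
Proof.
move=> lX /finite_set_list[l] /=; elim: l P => [|a l IH] P hl [x Px]; first by case: (hl x Px).
case: (pselect (exists y, P y /\ y <> a)) => [[y [Py ya]]|n]; last first.
  have e y : P y -> y = a by move=> Py; apply: contrapT => ya; apply: n; exists y.
  by exists x; split=> // y Py; rewrite (e y Py) (e x Px); apply: lirr lX _.
have hl' t : P t /\ t <> a -> List.In t l by move=> [Pt ta]; case: (hl t Pt) => // e; case: ta.
have [m [[Pm ma] hm]] := IH (fun y => P y /\ y <> a) hl' (ex_intro _ y (conj Py ya)).
case: (pselect (P a /\ prec m a)) => [[Pa mla]|n].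
  exists a; split=> // z Pz az; case: (pselect (z = a)) => [e|za].
    by rewrite e in az; case: (lirr lX az).
  by apply: (hm z) => //; apply: ltr lX _ _ _ mla az.
exists m; split=> // z Pz mz; case: (pselect (z = a)) => [e|za]; last exact: (hm z).
by apply: n; rewrite -e.
Qed.

Section OmegaPow.
Variables (T : binstr) (wT : wo T).
Let lT := wT.1.
Implicit Types f g h : omega_pow T.

Definition opow (f : T -> nat) (hf : finite_set [set t | f t <> 0%N]) : omega_pow T := exist _ f hf.

Lemma omega_pow_ext f g : (forall t, sval f t = sval g t) -> f = g.
Proof. by case: f g => f hf [g hg] /= h; apply: eq_exist; apply: funext. Qed.

Lemma supp_top f : (exists t, sval f t <> 0%N) ->
  exists m, sval f m <> 0%N /\ forall t, prec m t -> sval f t = 0%N.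
Proof.
move=> h; have [m [hm mm]] := finite_max lT (proj2_sig f) h.
by exists m; split=> // t mt; apply: contrapT => /mm.
Qed.

Lemma linear_omega_pow : linear (omega_pow T).
Proof.
split; first split.
- by move=> f [t [/=]]; rewrite ltnn.
- move=> f g h [t [ft et]] [s [gs es]]; case: (ltot lT t s) => [ts|[e|st]].
  + exists s; split=> [|u su]; first by rewrite et.
    by rewrite et ?es //; apply: ltr lT _ _ _ ts su.
  + subst s; exists t; split=> [|u tu]; first exact: ltn_trans ft gs.
    by rewrite et ?es.
  + exists t; split=> [|u tu]; first by rewrite -es.
    by rewrite et ?es //; apply: ltr lT _ _ _ st tu.
move=> f g; case: (pselect (exists t, sval f t <> sval g t)) => [hd|n]; last first.
  right; left; apply: omega_pow_ext => t; apply: contrapT => h; apply: n; by exists t.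
have [|t [nt mt]] := finite_max lT _ hd.
  apply: (sub_finite_set (B := [set t | sval f t <> 0%N] `|` [set t | sval g t <> 0%N])%classic).
    move=> t /= h; case: (pselect (sval f t = 0%N)) => [e|]; last by left.
    by right=> e'; apply: h; rewrite e e'.
  by rewrite finite_setU; split; [exact: (proj2_sig f)|exact: (proj2_sig g)].
have eq s : prec t s -> sval f s = sval g s by move=> ts; apply: contrapT => /mt.
case: (ltngtP (sval f t) (sval g t)) => [h|h|//].
  by left; exists t.
by right; right; exists t; split=> // s /eq.
Qed.

(** Accessibility by three nested inductions: on a bound [t] of the support, on the coefficient at
    [t], and on the accessibility of the function [z f] obtained by erasing that coefficient. *)
Lemma wf_omega_pow : wf (omega_pow T).
Proof.
apply: well_founded_wf.
have acc0 f : (forall t, sval f t = 0%N) -> Acc prec f.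
  by move=> f0; constructor=> g [t [/=]]; rewrite f0.
have A t : forall f, (forall s, prec t s -> sval f s = 0%N) -> Acc prec f.
  elim/(well_founded_ind (wf_well_founded wT.2)): t => t IH.
  have low f : (forall s, ~ prec s t -> sval f s = 0%N) -> Acc prec f.
    move=> hf; constructor=> g [u [gu eu]].
    have ut : prec u t by apply: contrapT => /hf e; move: gu; rewrite e.
    have hg s : ~ prec s t -> sval g s = 0%N.
      by move=> st; rewrite eu ?hf //; apply: ltle lT _ _ _ ut st.
    case: (pselect (exists t, sval g t <> 0%N)) => [h|n].
      have [m [gm hm]] := supp_top h.
      by apply: (IH m) => //; apply: contrapT => /hg.
    by apply: acc0 => s; apply: contrapT => h; apply: n; exists s.
  move=> f; move en: (sval f t) => n; elim/ltn_ind: n f en => n IHn f en hf.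
  pose z (f : omega_pow T) : T -> nat := fun s => if pselect (s = t) then 0 else sval f s.
  have zf f1 : finite_set [set s | z f1 s <> 0%N].
    by apply: sub_finite_set (proj2_sig f1) => s /=; rewrite /z; case: pselect.
  have : Acc prec (opow (zf f)).
    apply: low => s st; rewrite /= /z; case: pselect => // ne; apply: hf.
    by case: (lle lT st) => // e; case: ne.
  move ef: (opow (zf f)) => f0 a0.
  elim: {f0} a0 f en hf ef => f0 _ IHf f en hf ef.
  constructor=> g [u [gu eu]].
  have ut : ~ prec t u by move=> /hf e; move: gu; rewrite e.
  have hg s : prec t s -> sval g s = 0%N.
    by move=> ts; rewrite eu ?hf //; apply: lelt lT _ _ _ ut ts.
  case: (lle lT ut) => [ult|e]; last first.
    by subst u; apply: (IHn (sval g t)) => //; rewrite -en.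
  apply: (IHf (opow (zf g))) => //; last by rewrite eu.
  rewrite -ef; exists u; split=> [|s us] /=; rewrite /z.
    by case: pselect => // e; rewrite e in ult; case: (lirr lT ult).
  by case: pselect => // ne; apply: eu.
move=> f; case: (pselect (exists t, sval f t <> 0%N)) => [h|n].
  by have [m [_ hm]] := supp_top h; apply: (A m).
by apply: acc0 => s; apply: contrapT => h; apply: n; exists s.
Qed.

Lemma wo_omega_pow : wo (omega_pow T).
Proof. by split; [apply: linear_omega_pow|apply: wf_omega_pow]. Qed.

Lemma opow_add_fin f g : finite_set [set t | (sval f t + sval g t)%N <> 0%N].
Proof.
apply: (sub_finite_set (B := [set t | sval f t <> 0%N] `|` [set t | sval g t <> 0%N])%classic).
  move=> t /= h; case: (pselect (sval f t = 0%N)) => [e|]; last by left.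
  by right=> e'; apply: h; rewrite e e'.
by rewrite finite_setU; split; [exact: (proj2_sig f)|exact: (proj2_sig g)].
Qed.

Definition opow_add f g := opow (opow_add_fin f g).

Lemma opow_0_fin : finite_set [set t : T | 0%N <> 0%N].
Proof. by apply: sub_finite_set (finite_set0 T) => t /=. Qed.

(** The pointwise sum with [f] (the natural sum of ordinals) is strictly increasing and never takes
    a value below [f]. *)
Lemma AI_omega_pow : AI (omega_pow T).
Proof.
split; [exact: wo_omega_pow|by split; exact: opow opow_0_fin|move=> f].
apply/emb_subP; exists (opow_add f); split.
  by move=> g [t [/=]]; rewrite -{2}[sval f t]addn0 ltn_add2l.
by move=> g h [t [gt e]]; exists t; split=> [|s /e /= ->//]; rewrite /= ltn_add2l.
Qed.

(** The normal form of the single power omega^t. *)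
Definition delta_fun (t : T) : T -> nat := fun s => if pselect (s = t) then 1 else 0.

Lemma delta_fin t : finite_set [set s | delta_fun t s <> 0%N].
Proof.
apply: (sub_finite_set (B := [set t])%classic); last exact: finite_set1.
by move=> s /=; rewrite /delta_fun; case: pselect.
Qed.

Definition odelta t : omega_pow T := opow (delta_fin t).

Lemma delta_eq t : delta_fun t t = 1%N.
Proof. by rewrite /delta_fun; case: pselect. Qed.

Lemma delta_ne t s : s <> t -> delta_fun t s = 0%N.
Proof. by rewrite /delta_fun; case: pselect. Qed.

Lemma delta_gt t s : prec t s -> delta_fun t s = 0%N.
Proof. by move=> ts; apply: delta_ne => e; rewrite e in ts; exact: lirr lT _ ts. Qed.

Lemma nomax_omega_pow : inhabited T -> nomax (omega_pow T).
Proof.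
move=> [t] f; exists (opow_add f (odelta t)); exists t; split=> [|s ts] /=.
  by rewrite delta_eq addn1.
by rewrite delta_gt // addn0.
Qed.

Lemma emb_delta : emb T (omega_pow T).
Proof.
exists odelta => s t st; exists t; split=> [|u tu] /=; first by rewrite (delta_gt st) delta_eq.
by rewrite !delta_gt //; apply: (ltr lT st tu).
Qed.

End OmegaPow.

Section Extend.
Variables (T T' : binstr) (lT : linear T) (lT' : linear T') (e : T -> T') (he : hom e).

Let ie : injective e := hom_inj lT lT' he.

Definition ext_fun (f : T -> nat) (t' : T') : nat :=
  match pselect (exists t, e t = t') with left h => f (sval (cid h)) | right _ => 0 end.

Lemma ext_fun_in f t : ext_fun f (e t) = f t.
Proof.
rewrite /ext_fun; case: pselect => [h|[]]; last by exists t.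
by case: cid => s /= /ie ->.
Qed.

Lemma ext_fun_out f t' : ~ (exists t, e t = t') -> ext_fun f t' = 0%N.
Proof. by rewrite /ext_fun; case: pselect. Qed.

Lemma ext_fin (f : omega_pow T) : finite_set [set t' | ext_fun (sval f) t' <> 0%N].
Proof.
apply: (sub_finite_set (B := e @` [set t | sval f t <> 0%N])%classic); last exact: finite_image (proj2_sig f).
move=> t' /=; case: (pselect (exists t, e t = t')) => [[t <-]|/ext_fun_out -> //].
by rewrite ext_fun_in => h; exists t.
Qed.

Definition oext (f : omega_pow T) : omega_pow T' := exist _ (ext_fun (sval f)) (ext_fin f).

Lemma hom_oext : hom oext.
Proof.
move=> f g [t [ft h]]; exists (e t); split=> [|s' es] /=; first by rewrite !ext_fun_in.
case: (pselect (exists t, e t = s')) => [[s es']|ns]; last by rewrite !ext_fun_out.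
rewrite -es' !ext_fun_in h //; rewrite -es' in es.
by case: (ltot lT t s) => [//|[eq|/he st]]; [rewrite eq in es; case: (lirr lT' es)|case: (lasym lT' es st)].
Qed.

Lemma emb_omega_pow : emb (omega_pow T) (omega_pow T').
Proof. by exists oext; apply: hom_oext. Qed.

Lemma oext_below (d : T') (f : omega_pow T) : (forall t, prec (e t) d) -> prec (oext f) (odelta d).
Proof.
move=> ed; exists d; split=> [|s' ds] /=.
  rewrite delta_eq ext_fun_out // => -[t et]; have := ed t; rewrite et; exact: lirr lT' _.
rewrite delta_ne => [|eq]; last by rewrite eq in ds; case: (lirr lT' ds).
rewrite ext_fun_out // => -[t et]; have := ed t; rewrite et; exact: (lasym lT' ds).
Qed.

End Extend.

Lemma emb_omega_pow_below (T T' : binstr) (d : T') : linear T -> wo T' -> emb T (below d) ->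
  emb (omega_pow T) (below (odelta d)).
Proof.
move=> lT wT' /(@emb_subP T T')[e [ed he]]; apply/(@emb_subP _ (omega_pow T')).
exists (oext lT wT'.1 he); split; last exact: hom_oext.
by move=> f; apply: oext_below.
Qed.

(** [A] embeds in [omega_pow A], so it is all of it or an initial segment [below f]. With [m] the
    leading exponent of [f], indecomposability excludes every [f] except omega^m itself, and below
    omega^m lies [omega_pow (below m)]. *)
Lemma AI_is_omega_pow A : AI A -> exists T, wo T /\ iso A (omega_pow T).
Proof.
move=> AA; have [wA [a0] hA] := AA; have lA := wA.1.
have wP := wo_omega_pow wA; have lP := wP.1.
case: (pselect (emb (omega_pow A) A)) => [h|/(wo_lt wP wA)].
  by exists A; split=> //; apply: wo_antisym => //; apply: emb_delta.
move=> [f Af].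
have nz : exists t, sval f t <> 0%N.
  have [g [t [/= gt _]]] : exists g, prec g f by have [h _] := iso_emb Af; have [g gf] := h a0; exists g.
  by exists t => e; rewrite e in gt.
have [m [fm hm]] := supp_top wA nz.
case: (ltot lP (odelta m) f) => [df|[df|[u [/= fu _]]]]; last first.
- case: (pselect (u = m)) => [e|/delta_ne e]; rewrite ?e // in fu.
  by case: fm; move: fu; rewrite delta_eq; case: (sval f m).
- exists (below m); split; first exact: wo_below.
  apply: iso_trans Af _; rewrite -df; apply: iso_sym.
  pose e (t : below m) : A := sval t.
  have he : hom e by [].
  have em t : prec (e t) m by case: t.
  have lm := linear_below m lA.
  apply: (@iso_surj (omega_pow (below m)) (below (odelta m))
           (fun g => exist _ (oext lm lA he g) (oext_below lm lA he g em))).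
  + by apply: linear_omega_pow; apply: wo_below.
  + exact: linear_below.
  + exact: hom_oext.
  move=> [g gd]; have [u [/= gu hu]] := gd.
  have eu : u = m by apply: contrapT => /delta_ne eu; rewrite eu in gu.
  subst u; have {}gu : (sval g m < 1)%N by rewrite -(delta_eq m).
  have g0 s : ~ prec s m -> sval g s = 0%N.
    move=> sm; case: (lle lA sm) => [ms|<-]; last by move: gu; case: (sval g m).
    by rewrite hu // delta_gt.
  have fin : finite_set [set t : below m | sval g (sval t) <> 0%N].
    apply: (finite_preimage (B := [set t | sval g t <> 0%N]) (f := e)); last exact: (proj2_sig g).
    by move=> x y _ _; apply: (hom_inj lm lA he).
  exists (exist _ (fun t => sval g (sval t)) fin); apply: eq_exist; apply: omega_pow_ext => s /=.
  case: (pselect (prec s m)) => [sm|sm].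
    exact: (@ext_fun_in (below m) A lm lA e he (fun t => sval g (sval t)) (exist _ s sm)).
  by rewrite g0 // ext_fun_out // => -[t es]; apply: sm; rewrite -es.
(* [S] lowers the coefficient at [m] by one. It is increasing from omega^m on. If omega^m < f, an
   embedding of [below f] into its tail from omega^m, followed by [S], would land below [S f], in a
   proper initial segment. *)
pose sb (g : omega_pow A) : A -> nat := fun s => (sval g s - delta_fun m s)%N.
have sbf g : finite_set [set s | sb g s <> 0%N].
  by apply: sub_finite_set (proj2_sig g) => s /= h e; apply: h; rewrite /sb e.
pose S g : omega_pow A := opow (sbf g).
have mono (g h : omega_pow A) : (0 < sval g m)%N -> prec g h -> prec (S g) (S h).
  move=> gm [u [gu eu]]; exists u; split=> [|s us]; last by rewrite /= /sb eu.
  rewrite /= /sb; case: (pselect (u = m)) => [e|ne]; last by rewrite !delta_ne // !subn0.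
  by subst u; rewrite delta_eq; apply: ltn_sub2r => //; apply: leq_ltn_trans gm gu.
have dm : (0 < sval (odelta m) m)%N by rewrite /= delta_eq.
have Sf : prec (S f) f.
  exists m; split=> [|s ms]; rewrite /= /sb ?delta_eq; last by rewrite delta_gt // subn0.
  by rewrite subn1 prednK // lt0n; apply/eqP.
have gm (g : omega_pow A) : ~ prec g (odelta m) -> prec g f -> (0 < sval g m)%N.
  move=> gd [u [gu eu]]; rewrite lt0n; apply/eqP => g0; apply: gd.
  exists m; split=> [|s ms] /=; first by rewrite g0 delta_eq.
  rewrite delta_gt //; have um : ~ prec m u by move=> /hm e; rewrite e in gu.
  by rewrite eu ?hm //; apply: lelt lA _ _ _ um ms.
have [F [bF hF]] := Af.
pose D : below f := exist _ (odelta m) df.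
have AIf : AI (below f) by apply: AI_iso Af AA.
have [_ _ /(_ D)] := AIf; move=> /emb_subP[G [GD hG]].
case: (@wo_nemb_below (below f) (exist _ (S f) Sf) (AI_wo AIf)).
apply/(@emb_subP _ (below f)).
have Gf x : prec (S (sval (G x))) (S f).
  by apply: mono; [apply: gm; [exact: GD|case: (G x)]|case: (G x)].
exists (fun x => exist _ (S (sval (G x))) (ltr lP (Gf x) Sf)); split=> [x|x y /hG h] /=; first exact: Gf.
by apply: mono => //; apply: gm; [exact: GD|case: (G x)].
Qed.

Definition copies (A : binstr) : binstr := osum (fun _ : omega_star => A).

Lemma linear_omega_star : linear omega_star.
Proof. exact: linear_rev linear_nat. Qed.

Lemma linear_copies A : linear A -> linear (copies A).
Proof. by move=> lA; apply: linear_osum => //; apply: linear_omega_star. Qed.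

(** Together with [class_Z_elim] this frees the class Z from exponents: theta >= 1 becomes the
    absence of a maximum in [A], and theta < delta becomes [~ emb B A]. *)
Lemma class_Z_intro X A B : AI A -> AI B -> nomax A -> ~ emb B A ->
  iso X (oadd (copies A) B) -> class_Z X.
Proof.
move=> AA AB nA BA hX.
have [theta [wt At]] := AI_is_omega_pow AA; have [delta [wd Bd]] := AI_is_omega_pow AB.
have noemb : ~ emb delta theta.
  move=> [e he]; apply: BA; apply: emb_trans (iso_emb Bd) _; apply: emb_trans (iso_emb' At).
  by apply: (emb_omega_pow wd.1 wt.1 he).
exists theta, delta; split; [exact/woE|exact/woE| | |].
- apply: contrapT => nt; case: (AI_inh AA) => a; have [b ab] := nA a.
  have [f hf] := iso_emb At; have := hf _ _ ab.
  rewrite (_ : f b = f a); first by apply: lirr; apply: linear_omega_pow.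
  by apply: omega_pow_ext => t; case: nt.
- by case: (wo_trichotomy wt wd) => [/iso_emb'//|[//|[a /iso_emb h]]]; case: noemb; apply: emb_trans h (emb_sub _).
- apply: iso_trans hX _; apply: iso_oadd Bd; apply: iso_osum => //; exact: linear_omega_star.
Qed.

Lemma class_Z_elim X : class_Z X -> exists A B,
  [/\ AI A, AI B, nomax A, ~ emb B A & iso X (oadd (copies A) B)].
Proof.
move=> [theta [delta [/woE wt /woE wd it [d td] hX]]].
exists (omega_pow theta), (omega_pow delta); split => //; do ?[exact: AI_omega_pow|exact: nomax_omega_pow].
move=> h; apply: (wo_nemb_below (wo_omega_pow wd) (a := odelta d)); apply: emb_trans h _.
by apply: (emb_omega_pow_below wt.1 wd); apply: iso_emb.
Qed.

(** * Orders whose final segments are well founded *)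

Lemma dep_choice (T : Type) (P : T -> Prop) (R : T -> T -> Prop) x0 :
  (forall x, P x -> exists y, P y /\ R x y) -> P x0 ->
  exists u : nat -> T, [/\ u 0 = x0, forall n, P (u n) & forall n, R (u n) (u n.+1)].
Proof.
move=> h P0.
pose step (p : {x | P x}) : {x | P x} :=
  let c := cid (h _ (proj2_sig p)) in exist _ (sval c) (proj2_sig c).1.
exists (fun n => sval (iter n step (exist _ x0 P0))); split=> // n; first exact: proj2_sig.
rewrite iterS; move: (iter n _ _) => q; exact: (proj2_sig (cid (h _ (proj2_sig q)))).2.
Qed.

Lemma nat_least (P : nat -> Prop) : (exists n, P n) -> exists n, P n /\ forall m, (m < n)%N -> ~ P m.
Proof.
move=> [n]; elim/ltn_ind: n => n IH Pn.
case: (pselect (exists m, (m < n)%N /\ P m)) => [[m [mn Pm]]|h]; first exact: IH mn Pm.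
by exists n; split=> // m mn Pm; apply: h; exists m.
Qed.

Lemma inc_seq (u : nat -> nat) : (forall n, (u n < u n.+1)%N) -> forall i j, (i < j)%N -> (u i < u j)%N.
Proof.
move=> h i; elim=> // j IH; rewrite ltnS leq_eqVlt => /orP[/eqP->//|/IH ij].
exact: ltn_trans ij (h j).
Qed.

Lemma inf_subseq (P : nat -> Prop) : (forall N, exists n, (N <= n)%N /\ P n) ->
  exists s : nat -> nat, (forall i j, (i < j)%N -> (s i < s j)%N) /\ forall i, P (s i).
Proof.
move=> h; have [n0 [_ P0]] := h 0.
have [x _|s [_ Ps hs]] := @dep_choice nat P (fun a b => (a < b)%N) n0 _ P0.
  by have [n [xn Pn]] := h x.+1; exists n.
by exists s; split=> //; apply: inc_seq.
Qed.

Definition lwf (V : binstr) : Prop := forall v : V, wf (tail v).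

Lemma lwf_emb A B : linear A -> linear B -> emb A B -> lwf B -> lwf A.
Proof.
move=> lA lB [f hf] wB a; apply: wf_emb (wB (f a)).
by apply: emb_tail_iso; apply: hom_strong.
Qed.

Lemma wf_lwf A : wf A -> lwf A.
Proof. by move=> wA a; apply: wf_emb (emb_sub _) wA. Qed.

Lemma lwf_cases A : linear A -> lwf A -> wf A \/ (nomin A /\ inhabited A).
Proof.
move=> lA wA; case: (pselect (nomin A)) => [nA|/existsNP[m /forallNP hm]].
  case: (pselect (inhabited A)) => [iA|nI]; [by right|left].
  by move=> P [x]; case: nI.
left; apply: wf_emb (wA m); apply/emb_subP.
by exists id; split=> // x; apply: hm.
Qed.

Definition desc_coinitial (V : binstr) (u : nat -> V) :=
  (forall n, prec (u n.+1) (u n)) /\ forall v, exists n, prec (u n) v.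

Lemma desc_le (V : binstr) (u : nat -> V) : linear V -> (forall n, prec (u n.+1) (u n)) ->
  forall i j, (i <= j)%N -> ~ prec (u i) (u j).
Proof.
move=> lV h i j; elim: j => [|j IH]; first by rewrite leqn0 => /eqP->; apply: lirr.
rewrite leq_eqVlt => /orP[/eqP->|ij]; first exact: lirr.
by move=> k; apply: (IH ij); apply: (ltr lV k (h j)).
Qed.

Lemma desc_not_wf (V : binstr) (u : nat -> V) : (forall n, prec (u n.+1) (u n)) -> ~ wf V.
Proof.
move=> h w; have [|v [[n <-] m]] := w (fun v => exists n, u n = v); first by exists (u 0), 0.
by apply: (m (u n.+1)) => //; exists n.+1.
Qed.

(** Any strictly descending sequence is coinitial: a lower bound [v] would confine it to the
    well-founded [tail v]. *)
Lemma lwf_coinitial (V : binstr) (x0 : V) : linear V -> lwf V -> nomin V ->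
  exists u : nat -> V, u 0 = x0 /\ desc_coinitial u.
Proof.
move=> lV wV nV.
have [x _|u [u0 _ hu]] := @dep_choice V (fun _ => True) (fun a b => prec b a) x0 _ I.
  by have [y yx] := nV x; exists y.
exists u; split=> //; split=> // v; apply: contrapT => /forallNP h.
exact: (@desc_not_wf (tail v) (fun n => exist _ (u n) (h n))) (wV v).
Qed.

Lemma iso_blocks (V : binstr) (u : nat -> V) : linear V -> desc_coinitial u ->
  iso (below (u 0)) (@osum omega_star (fun n => ivl (u n.+1) (u n))).
Proof.
move=> lV [du cu]; apply: iso_sym.
have ub n x : prec x (u n) -> prec x (u 0).
  by move=> h; apply: (ltle lV h (desc_le lV du (leq0n n))).
pose f (p : @osum omega_star (fun n => ivl (u n.+1) (u n))) : below (u 0) :=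
  exist _ (sval (projT2 p)) (ub _ _ (proj2_sig (projT2 p)).2).
apply: (@iso_surj _ _ f).
- by apply: linear_osum; [apply: linear_omega_star|move=> n; apply: linear_sub].
- exact: linear_below.
- move=> [n [x [h1 h2]]] [m [y [h3 h4]]] h; change (prec x y).
  case: (osum_le h) => /= [mn|e]; last by subst m; apply: (proj1 (osum_same _ _ linear_omega_star) h).
  apply: (ltle lV h2); apply: (lele lV _ h3); exact: (desc_le lV du).
- move=> [x hx]; have [n [hn mn]] : exists n, ~ prec x (u n.+1) /\ forall m, (m < n)%N -> ~ ~ prec x (u m.+1).
    by apply: nat_least; have [n un] := cu x; exists n => /(ltr lV un); apply: (desc_le lV du).
  have xn : prec x (u n) by case: n hn mn => // n _ /(_ n (ltnSn n)) /contrapT.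
  by exists (existT _ n (exist _ x (conj hn xn))); apply: eq_exist.
Qed.

(* For a coinitially descending [V], the well orders [A] with [Rec V A] determine
   [V] up to bi-embeddability and an end piece. *)
Definition Rec (V A : binstr) : Prop := forall v : V, emb A (below v).

Lemma Rec_down V A B : emb A B -> Rec V B -> Rec V A.
Proof. by move=> AB h v; apply: emb_trans AB (h v). Qed.

Lemma lwf_ivl (V : binstr) (y x : V) : linear V -> lwf V -> wo (ivl y x).
Proof.
move=> lV wV; split; first exact: linear_sub.
by apply: wf_emb (wV y); apply: emb_subS => z [].
Qed.

(** Otherwise there is a sequence of intervals, each failing to embed below some point beneath which
    the next interval lies. The least of these well orders embeds in its successor, a
    contradiction. *)
Lemma Rec_germ V : linear V -> lwf V -> inhabited V ->
  exists x0 : V, forall y x, ~ prec x0 x -> Rec V (ivl y x).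
Proof.
move=> lV wV [v0]; apply: contrapT => /forallNP h.
pose P (s : V * V * V) := ~ emb (ivl s.1.1 s.1.2) (below s.2).
pose R (s t : V * V * V) := ~ prec s.2 t.1.2.
have h' x0 : exists s, P s /\ ~ prec x0 s.1.2.
  have /existsNP[y /existsNP[x /not_implyP[xx0 /existsNP[z hz]]]] := h x0.
  by exists (y, x, z).
have [s0 [P0 _]] := h' v0.
have [|s [_ Ps Rs]] := @dep_choice _ P R s0 _ P0; first by move=> s _; have [t ht] := h' s.2; exists t.
have [n hn] := @wo_least nat (fun n => ivl (s n).1.1 (s n).1.2) (ex_intro _ 0 I) (fun n => lwf_ivl _ _ lV wV).
apply: (Ps n); apply: emb_trans (hn n.+1) _; apply: (@emb_subS V) => x [_ h1]; exact: (ltle lV h1 (Rs n)).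
Qed.

Lemma Rec_ivl (V A : binstr) (v : V) : linear V -> nomin V -> wo A -> Rec V A ->
  exists w, prec w v /\ emb A (ivl w v).
Proof.
move=> lV nV [lA wA] /(_ v) /(@emb_subP A V)[f [fv hf]].
case: (pselect (inhabited A)) => [[a0]|nA]; last first.
  have [w wv] := nV v; exists w; split=> //; have g : A -> ivl w v by move=> a; case: nA; split.
  by exists g => a; case: nA; split.
have [m [_ hm]] := wA (fun _ => True) (ex_intro _ a0 I).
exists (f m); split=> //; apply/emb_subP; exists f; split=> // a; split=> // /(hom_strong lA lV hf).
exact: hm.
Qed.

Lemma Rec_oadd V A B : linear V -> nomin V -> wo B -> Rec V A -> Rec V B -> Rec V (oadd A B).
Proof.
move=> lV nV wB hA hB v; have [w [wv hw]] := Rec_ivl v lV nV wB hB.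
apply: (emb_oadd_sub (hA w) hw) => [x y xw [yw _]|x xw|x []//]; first exact: (ltle lV xw yw).
exact: (ltr lV xw wv).
Qed.

Lemma Rec_lsum V l : linear V -> nomin V -> List.Forall wo l -> List.Forall (Rec V) l -> Rec V (lsum l).
Proof.
move=> lV nV; elim: l => [|A l IH] /=; first by move=> _ _ v; exists (of_void _) => -[].
move=> /List.Forall_cons_iff[wA wl] /List.Forall_cons_iff[rA rl].
by apply: Rec_oadd => //; [apply: wo_lsum|apply: IH].
Qed.

(** Each [P n] is placed in an interval [u(n+1), u n) just below the one used before, starting from
    [v]; recurrence always leaves room. *)
Lemma greedy (P : nat -> binstr) (V : binstr) : linear V -> nomin V ->
  (forall n, wo (P n)) -> (forall n, Rec V (P n)) -> Rec V (@osum omega_star P).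
Proof.
move=> lV nV wP rP v.
have /choice[W hW] : forall p : nat * V, exists w, prec w p.2 /\ emb (P p.1) (ivl w p.2).
  by move=> [n x]; apply: Rec_ivl.
have [u [u0 uS]] : exists u : nat -> V, u 0 = v /\ forall n, u n.+1 = W (n, u n).
  by exists (fix u n := if n is m.+1 then W (m, u m) else v).
have du n : prec (u n.+1) (u n) by rewrite uS; apply: (hW (n, u n)).1.
apply: (@emb_osum_into omega_star P (below v) (fun n x => ~ prec (sval x) (u n.+1) /\ prec (sval x) (u n))).
- exact: linear_omega_star.
- move=> n; have [_ /emb_subP[f [fP hf]]] := hW (n, u n); rewrite /= -uS in fP.
  have fv a : prec (f a) v.
    by rewrite -u0; exact: (ltle lV (fP a).2 (desc_le lV du (leq0n n))).
  by apply/emb_subP; exists (fun a => exist _ (f a) (fv a) : below v); split.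
- move=> n m [x xv] [y yv] /= mn [x1 x2] [y1 y2].
  apply: (ltle lV x2); apply: (lele lV _ y1); exact: (desc_le lV du).
Qed.

(** Cut [below x0] into intervals along a coinitial sequence and place these greedily in [V']. *)
Lemma Rec_below (V V' : binstr) (x0 : V) : linear V -> lwf V -> nomin V -> linear V' -> nomin V' ->
  (forall y x, ~ prec x0 x -> Rec V' (ivl y x)) -> Rec V' (below x0).
Proof.
move=> lV wV nV lV' nV' h; have [u [u0 cu]] := lwf_coinitial x0 lV wV nV.
rewrite -u0; apply: Rec_down (iso_emb (iso_blocks lV cu)) _; apply: greedy => // n.
  exact: lwf_ivl.
by apply: h; rewrite -u0; apply: (desc_le lV cu.1).
Qed.

(** * Well quasi-orders *)

Definition wqo (C : binstr -> Prop) := forall u : nat -> binstr,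
  (forall n, C (u n)) -> exists i j, (i < j)%N /\ emb (u i) (u j).

Definition min_rel (R : nat -> nat -> Prop) := forall s : nat -> nat, exists i, forall k, R (s i) (s k).

(** Infinitely many indices are [R1]-below all later ones; among these, one is [R2]-below all the
    others. *)
Lemma dickson R1 R2 : min_rel R1 -> min_rel R2 -> exists i j, [/\ (i < j)%N, R1 i j & R2 i j].
Proof.
move=> h1 h2.
have [N|s [si hs]] := @inf_subseq (fun m => forall k, (m <= k)%N -> R1 m k).
  have [i hi] := h1 (addn N); exists (N + i)%N; split=> [|k ik]; first exact: leq_addr.
  by have := hi (k - N)%N; rewrite subnKC //; apply: leq_trans (leq_addr i N) ik.
have [i hi] := h2 s; have sii : (s i < s i.+1)%N by apply: si.
by exists (s i), (s i.+1); split=> //; apply: hs; apply: ltnW.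
Qed.

Lemma wqo_union C D : wqo C -> wqo D -> wqo (fun X => C X \/ D X).
Proof.
move=> wC wD u hu.
case: (pselect (forall N, exists n, (N <= n)%N /\ C (u n))) => [/inf_subseq[s [si hs]]|].
  by have [i [j [ij h]]] := wC (u \o s) hs; exists (s i), (s j); split=> //; apply: si.
move=> /existsNP[N /forallNP hN].
have [n|i [j [ij h]]] := wD (fun n => u (N + n)%N).
  by case: (hu (N + n)%N) => // h; case: (hN (N + n)%N); split=> //; apply: leq_addr.
by exists (N + i)%N, (N + j)%N; rewrite ltn_add2l.
Qed.

Lemma wqo_wo : wqo wo.
Proof.
move=> u hu; have [i hi] := wo_least (ex_intro _ 0 I) hu.
by exists i, i.+1; split=> //; apply: hi.
Qed.

(** An order without minimum is compared through two data: the class of its recurrent well orders,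
    which controls the part below the point given by [Rec_germ], and the well-ordered tail from that
    point. Both admit least terms, so [dickson] applies. *)
Lemma wqo_lwf : wqo (fun V => linear V /\ lwf V).
Proof.
move=> u hu.
suff [i [j h]] : exists i j, (i < j)%N /\ emb (u i) (u j) by exists i, j.
have : wqo (fun V => wo V \/ [/\ linear V, lwf V, nomin V & inhabited V]).
  apply: wqo_union wqo_wo _ => {hu}u hu.
  have germ n : exists x : u n, forall z y, ~ prec x y -> Rec (u n) (ivl z y).
    by have [h1 h2 h3 h4] := hu n; apply: Rec_germ.
  pose x n := sval (cid (germ n)).
  have hx n : forall z y, ~ prec (x n) y -> Rec (u n) (ivl z y) by rewrite /x; case: cid.
  have [||i [j [ij h1 h2]]] := @dickson (fun i j => forall a, wo a -> Rec (u i) a -> Rec (u j) a)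
    (fun i j => emb (tail (x i)) (tail (x j))).
  (* In a sequence without a least class, each [a n] recurs at stage n but not at stage n+1. The
     least [a n] embeds in [a n.+1], which does recur there. *)
  - move=> s; apply: contrapT => /forallNP h.
    have h' i : exists k, ~ (forall a, wo a -> Rec (u (s i)) a -> Rec (u (s k)) a).
      by have /existsNP[k hk] := h i; exists k.
    have [i0 _|t [_ _ ht]] := @dep_choice nat (fun _ => True)
      (fun i k => ~ (forall a, wo a -> Rec (u (s i)) a -> Rec (u (s k)) a)) 0 _ I.
      by have [k hk] := h' i0; exists k; split=> //; apply: hk.
    have /choice[a ha] : forall n, exists a, [/\ wo a, Rec (u (s (t n))) a & ~ Rec (u (s (t n.+1))) a].
      by move=> n; have /existsNP[a /not_implyP[wa /not_implyP[r1 r2]]] := ht n; exists a.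
    have [|n hn] := @wo_least nat a (ex_intro _ 0 I); first by move=> n; case: (ha n).
    case: (ha n) => _ _ []; apply: Rec_down (hn n.+1) _; by case: (ha n.+1).
  - move=> s; apply: (@wo_least nat (fun k => tail (x (s k))) (ex_intro _ 0 I)) => n.
    have [l w _ _] := hu (s n); split; [exact: linear_sub|exact: w].
  exists i, j; split=> //.
  have [li wi ni _] := hu i; have [lj wj nj _] := hu j.
  apply: emb_trans (iso_emb (iso_below_tail (x i) li)) _.
  apply: emb_trans (iso_emb' (iso_below_tail (x j) lj)); apply: emb_oadd h2.
  apply: (@Rec_below (u i) (u j)) => // z y h; apply: h1; [exact: lwf_ivl|exact: hx].
apply=> n; have [l w] := hu n; case: (lwf_cases l w) => [wn|[n1 n2]]; [by left|by right].
Qed.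

Definition rrwf X := lwf (rev_str X).

Lemma wqo_rev C : wqo C -> wqo (fun V => C (rev_str V)).
Proof.
move=> wC u /wC[i [j [ij /emb_rev]]]; rewrite !rev_strK => h; by exists i, j.
Qed.

Definition piece V := linear V /\ (lwf V \/ rrwf V).

Lemma wqo_piece : wqo piece.
Proof.
have h := wqo_union wqo_lwf (wqo_rev wqo_lwf).
move=> u hu; apply: h => n; case: (hu n) => l [w|w]; [by left|right; split=> //; exact: linear_rev].
Qed.

Lemma dcc C (u : nat -> binstr) : wqo C -> (forall n, C (u n)) -> (forall n, emb (u n.+1) (u n)) ->
  exists N, forall n, (N <= n)%N -> emb (u N) (u n).
Proof.
move=> wC hu du.
have mono i j : (i <= j)%N -> emb (u j) (u i).
  elim: j => [|j IH]; first by rewrite leqn0 => /eqP->; apply: emb_refl.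
  rewrite leq_eqVlt => /orP[/eqP->|ij]; [exact: emb_refl|exact: emb_trans (du j) (IH ij)].
apply: contrapT => /forallNP h.
have [N _|t [_ _ ht]] := @dep_choice nat (fun _ => True) (fun a b => (a <= b)%N /\ ~ emb (u a) (u b)) 0 _ I.
  by have /existsNP[n /not_implyP[h1 h2]] := h N; exists n.
have [i [j [ij e]]] := wC (u \o t) (fun n => hu (t n)).
have tm : forall a b, (a <= b)%N -> (t a <= t b)%N.
  move=> a; elim=> [|b IH]; first by rewrite leqn0 => /eqP->.
  rewrite leq_eqVlt => /orP[/eqP->//|ab]; exact: leq_trans (IH ab) (ht b).1.
by case: (ht i) => _ []; apply: emb_trans e (mono _ _ (tm _ _ ij)).
Qed.

(** Otherwise choose indices such that each chosen term embeds in no term from the next chosen index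
    on; this is a bad sequence for the well-quasi-order. *)
Lemma recurrent C (p : nat -> binstr) : wqo C -> (forall n, C (p n)) ->
  exists N, forall k, (N <= k)%N -> forall M, exists m, (M <= m)%N /\ emb (p k) (p m).
Proof.
move=> wC hp; apply: contrapT => /forallNP h.
have h' N : exists k, (N <= k)%N /\ exists M, forall m, (M <= m)%N -> ~ emb (p k) (p m).
  have /existsNP[k /not_implyP[Nk /existsNP[M /forallNP hM]]] := h N.
  by exists k; split=> //; exists M => m Mm e; apply: (hM m).
have [k0 [_ b0]] := h' 0.
have [k [M hM]|t [_ _ ht]] := @dep_choice nat (fun k => exists M, forall m, (M <= m)%N -> ~ emb (p k) (p m))
  (fun a b => (a < b)%N /\ forall m, (b <= m)%N -> ~ emb (p a) (p m)) k0 _ b0.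
  have [k' [h1 h2]] := h' (maxn M k.+1); rewrite geq_max in h1; case/andP: h1 => h3 h4.
  by exists k'; split=> //; split=> // m km; apply: hM; apply: leq_trans km.
have [i [j [ij e]]] := wC (p \o t) (fun n => hp (t n)).
have ti := inc_seq (fun n => (ht n).1).
case: (ht i) => _ /(_ (t j)) []; last exact: e.
by move: ij; rewrite leq_eqVlt => /orP[/eqP->//|/ti/ltnW].
Qed.

(** * Scattered orders *)

(** A nonempty, transitive, dense relation inside [prec]. It amounts to an embedded copy of the
    rationals, but is easier to exhibit and to refute. *)
Definition dense_rel (X : binstr) (R : X -> X -> Prop) : Prop :=
  [/\ forall x y, R x y -> prec x y, forall y x z, R x y -> R y z -> R x z,
      forall x y, R x y -> exists z, R x z /\ R z y & exists x y, R x y].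

Definition has_dense X := exists R, @dense_rel X R.

Lemma argmax (le : nat -> nat -> Prop) (D : nat -> Prop) k :
  (forall i j, le i j \/ le j i) -> (forall j i l, le i j -> le j l -> le i l) ->
  (forall i, (i < k)%N -> ~ D i) \/ exists j, [/\ (j < k)%N, D j & forall i, (i < k)%N -> D i -> le i j].
Proof.
move=> tot tr; elim: k => [|k [IH|[j [jk Dj hj]]]]; first by left.
  case: (pselect (D k)) => Dk; last first.
    by left=> i; rewrite ltnS leq_eqVlt => /orP[/eqP->//|/IH].
  right; exists k; split=> // i; rewrite ltnS leq_eqVlt => /orP[/eqP->//|/IH//].
  by case: (tot k k).
right; case: (pselect (D k /\ le j k)) => [[Dk jk']|n].
  exists k; split=> // i; rewrite ltnS leq_eqVlt => /orP[/eqP->//|ik Di]; first by case: (tot k k).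
  exact: tr (hj i ik Di) jk'.
exists j; split=> //; first exact: ltnW.
move=> i; rewrite ltnS leq_eqVlt => /orP[/eqP-> Dk|]; last exact: hj.
by case: (tot k j) => // h; case: n.
Qed.

(** Cantor's construction: along an enumeration of the rationals, the new point is put [R]-between
    the largest placed point of a smaller rational (or [a]) and the smallest placed point of a
    larger one (or [b]). *)
Lemma dense_embeds (X : binstr) : linear X -> has_dense X -> embeds rationals X.
Proof.
move=> lX [R [R1 R2 R3 [a [b Rab]]]].
(* The default value 0 makes the enumeration repeat rationals, so [inv] also asks that equal
   rationals receive equal points. *)
pose q (n : nat) : rat := odflt 0%R (unpickle n).
pose inv (l : seq X) := (forall i, (i < size l)%N -> R a (nth a l i) /\ R (nth a l i) b) /\
  forall i j, (i < size l)%N -> (j < size l)%N -> ((q i < q j)%R -> R (nth a l i) (nth a l j)) /\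
    (q i = q j -> nth a l i = nth a l j).
have step l : inv l -> exists l', inv l' /\ exists x, l' = rcons l x.
  move=> [inv1 inv2]; set n := size l.
  suff [x [x1 x2 x3]] : exists x, [/\ R a x /\ R x b,
      forall i, (i < n)%N -> ((q i < q n)%R -> R (nth a l i) x) /\ ((q n < q i)%R -> R x (nth a l i)) &
      forall i, (i < n)%N -> q i = q n -> nth a l i = x].
    exists (rcons l x); split; last by exists x.
    split=> [i|i j]; rewrite !size_rcons !ltnS !nth_rcons -/n.
      by rewrite leq_eqVlt => /orP[/eqP->|h]; rewrite ?ltnn ?eqxx // h; apply: inv1.
    rewrite leq_eqVlt => /orP[/eqP->|h]; rewrite leq_eqVlt => /orP[/eqP->|h'].
    - by rewrite ltnn eqxx; split=> //; rewrite Order.POrderTheory.ltxx.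
    - by rewrite ltnn eqxx h'; split=> [/(x2 j h').2//|/esym/(x3 _ h')].
    - by rewrite ltnn eqxx h; split=> [/(x2 i h).1//|/(x3 _ h)].
    - by rewrite h h'; apply: inv2.
  case: (pselect (exists i, (i < n)%N /\ q i = q n)) => [[i [hi e]]|ne].
    exists (nth a l i); split=> [|j hj|j hj ej]; first exact: inv1.
      by rewrite -e; split=> h; apply: (inv2 _ _ _ _).1.
    by apply: (inv2 _ _ _ _).2 => //; rewrite e.
  have letr (j i k : nat) : (q i <= q j)%R -> (q j <= q k)%R -> (q i <= q k)%R by apply: Order.POrderTheory.le_trans.
  have letot (i j : nat) : (q i <= q j)%R \/ (q j <= q i)%R by apply/orP; apply: Order.TotalTheory.le_total.
  have [lo [lo1 lo2]] : exists lo, (lo = a \/ exists j, [/\ (j < n)%N, (q j < q n)%R & lo = nth a l j]) /\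
      forall i, (i < n)%N -> (q i < q n)%R -> R (nth a l i) lo \/ nth a l i = lo.
    have [h|[j [jn qj hj]]] := @argmax (fun i j => (q i <= q j)%R) (fun i => (q i < q n)%R) n letot (fun j i k => @letr j i k).
      by exists a; split; [left|move=> i /h].
    exists (nth a l j); split; first by right; exists j.
    move=> i hi /(hj i hi); rewrite Order.POrderTheory.le_eqVlt => /orP[/eqP e|h].
      by right; apply: (inv2 _ _ _ _).2.
    by left; apply: (inv2 _ _ _ _).1.
  have [hi [hi1 hi2]] : exists hi, (hi = b \/ exists j, [/\ (j < n)%N, (q n < q j)%R & hi = nth a l j]) /\
      forall i, (i < n)%N -> (q n < q i)%R -> R hi (nth a l i) \/ nth a l i = hi.
    have [|h|[j [jn qj hj]]] := @argmax (fun i j => (q j <= q i)%R) (fun i => (q n < q i)%R) n (fun i j => letot j i).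
    - by move=> j i k h1 h2; apply: letr h2 h1.
    - by exists b; split; [left|move=> i /h].
    exists (nth a l j); split; first by right; exists j.
    move=> i hi /(hj i hi); rewrite Order.POrderTheory.le_eqVlt => /orP[/eqP e|h].
      by right; apply: (inv2 _ _ _ _).2.
    by left; apply: (inv2 _ _ _ _).1.
  have alo : R a lo \/ a = lo by case: lo1 => [->|[j [jn _ ->]]]; [right|left; case: (inv1 j jn)].
  have hib : R hi b \/ b = hi by case: hi1 => [->|[j [jn _ ->]]]; [right|left; case: (inv1 j jn)].
  have lohi : R lo hi.
    case: lo1 => [->|[j [jn qj ->]]]; case: hi1 => [->|[k [kn qk ->]]] //.
    - by case: (inv1 k kn).
    - by case: (inv1 j jn).
    - by apply: (inv2 j k jn kn).1; apply: Order.POrderTheory.lt_trans qj qk.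
  have [x [h1 h2]] := R3 _ _ lohi; exists x; split.
  - by split; [case: alo => [h|->//]; apply: R2 h1|case: hib => [h|->//]; apply: R2 h2 h].
  - move=> i hi'; split=> h; first by case: (lo2 i hi' h) => [h'|->//]; apply: R2 h1.
    by case: (hi2 i hi' h) => [h'|->//]; apply: R2 h'.
  - by move=> i hi' e; case: ne; exists i.
have inv0 : inv [::] by [].
have [u [u0 Pu Ru]] := dep_choice step inv0.
have su n : size (u n) = n by elim: n => [|n IH]; [rewrite u0|have [x ->] := Ru n; rewrite size_rcons IH].
have pre n m i : (i < n)%N -> (n <= m)%N -> nth a (u m) i = nth a (u n) i.
  move=> hi; elim: m => [|m IH]; first by rewrite leqn0 => /eqP e; rewrite e in hi *.
  rewrite leq_eqVlt => /orP[/eqP->//|nm]; have [x ->] := Ru m.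
  by rewrite nth_rcons su (leq_trans hi nm) IH.
pose f (r : rat) := nth a (u (pickle r).+1) (pickle r).
have fq r : q (pickle r) = r by rewrite /q pickleK.
apply: (@emb_embeds rationals X) => //.
  split; first by split=> [x h|x y z /=];
    [move: h; rewrite /= Order.POrderTheory.ltxx|apply: Order.POrderTheory.lt_trans].
  by move=> x y /=; case: (Order.TotalTheory.ltgtP x y); auto.
exists f => r s /= rs; apply: R1; rewrite /f.
set m := (maxn (pickle r) (pickle s)).+1.
have hr : (pickle r < m)%N by rewrite ltnS leq_maxl.
have hs : (pickle s < m)%N by rewrite ltnS leq_maxr.
rewrite -(@pre (pickle r).+1 m) // -(@pre (pickle s).+1 m) //.
by apply: ((Pu m).2 _ _ _ _).1; rewrite ?su // !fq.
Qed.

Lemma embeds_dense X : embeds rationals X -> has_dense X.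
Proof.
move=> [f [jf hf]]; exists (fun x y => exists p q : rat, [/\ (p < q)%R, f p = x & f q = y]); split.
- by move=> _ _ [p [q [pq <- <-]]]; apply/(hf p q).
- move=> _ _ _ [p [q [pq <- <-]]] [r [s [rs /jf e <-]]]; exists p, s; split=> //.
  by apply: Order.POrderTheory.lt_trans pq _; rewrite -e.
- move=> _ _ [p [q [pq <- <-]]]; have := Num.Theory.midf_lt pq => -[h1 h2].
  by exists (f ((p + q) / 2)%R); split; [exists p, ((p + q) / 2)%R|exists ((p + q) / 2)%R, q].
- by exists (f 0%R), (f 1%R), 0%R, 1%R.
Qed.

Lemma scatteredE X : scattered X <-> linear X /\ ~ has_dense X.
Proof.
by split=> -[lX h]; split=> // h'; apply: h; [apply: dense_embeds|apply: embeds_dense].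
Qed.

Lemma dense_emb A B : linear A -> linear B -> emb A B -> has_dense A -> has_dense B.
Proof.
move=> lA lB [f hf] [R [R1 R2 R3 [a [b Rab]]]]; have jf := hom_inj lA lB hf.
exists (fun x y => exists p q, [/\ R p q, f p = x & f q = y]); split.
- by move=> _ _ [p [q [/R1/hf h <- <-]]].
- move=> _ _ _ [p [q [pq <- <-]]] [r [s [rs /jf e <-]]]; subst r; exists p, s; split=> //.
  exact: R2 rs.
- by move=> _ _ [p [q [/R3[r [h1 h2]] <- <-]]]; exists (f r); split; [exists p, r|exists r, q].
- by exists (f a), (f b), a, b.
Qed.

Lemma scattered_emb A B : linear A -> emb A B -> scattered B -> scattered A.
Proof.
move=> lA AB /scatteredE[lB nB]; apply/scatteredE; split=> // /dense_emb h; apply: nB; exact: h AB.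
Qed.

(** Take the least [c] for which some [d], not below [a], satisfies [R d c]: density gives a smaller
    one. *)
Lemma lwf_not_dense A : linear A -> lwf A -> ~ has_dense A.
Proof.
move=> lA wA [R [R1 R2 R3 [a [b Rab]]]].
have nba : ~ prec b a by apply: (lasym lA); apply: R1.
have [|[c nc] [[d [da Rdc]] mc]] := wA a (fun x => exists d, ~ prec d a /\ R d (sval x)).
  by exists (exist _ b nba), a; split=> //; apply: (lirr lA).
have [e [de ec]] := R3 _ _ Rdc.
have ea : ~ prec e a by move=> h; apply: da; apply: (ltr lA) (R1 _ _ de) h.
by apply: (mc (exist _ e ea)); [exists d|apply: R1].
Qed.

Lemma rev_dense A : has_dense A -> has_dense (rev_str A).
Proof.
move=> [R [R1 R2 R3 [a [b Rab]]]]; exists (fun x y => R y x); split.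
- by move=> x y /R1.
- by move=> x y z h1 h2; apply: R2 h1.
- by move=> x y /R3[z [h1 h2]]; exists z.
- by exists b, a.
Qed.

Lemma rrwf_not_dense A : linear A -> rrwf A -> ~ has_dense A.
Proof. by move=> lA wA /rev_dense; apply: lwf_not_dense => //; apply: linear_rev. Qed.

Lemma oadd_not_dense A B : ~ has_dense A -> ~ has_dense B -> ~ has_dense (oadd A B).
Proof.
move=> nA nB [R [R1 R2 R3 [p [q Rpq]]]].
have hA a b : R (inl a) (inl b) -> False.
  move=> Rab; apply: nA; exists (fun x y => R (inl x) (inl y)); split.
  - by move=> x y /R1/oaddP.
  - by move=> x y z; apply: R2.
  - by move=> x y /R3[[z|z] [h1 h2]]; [exists z|move/R1/oaddP: h2].
  - by exists a, b.
have hB a b : R (inr a) (inr b) -> False.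
  move=> Rab; apply: nB; exists (fun x y => R (inr x) (inr y)); split.
  - by move=> x y /R1/oaddP.
  - by move=> x y z; apply: R2.
  - by move=> x y /R3[[z|z] [h1 h2]]; [move/R1/oaddP: h1|exists z].
  - by exists a, b.
case: p q Rpq => [a|a] [b|b] h; [exact: hA h| |by move/R1/oaddP: h|exact: hB h].
by have [[c|c] [h1 h2]] := R3 _ _ h; [apply: hA h1|apply: hB h2].
Qed.

Lemma lsum_not_dense l : List.Forall (fun A => ~ has_dense A) l -> ~ has_dense (lsum l).
Proof.
elim=> [|A {}l nA _ IH] /=; first by apply: lwf_not_dense; [apply: linear_emptyo|case].
exact: oadd_not_dense.
Qed.

(** * Sums of copies of omega and its reverse *)

Definition color (b : bool) : binstr := if b then omega else omega_star.
Definition Xof (S : binstr) (col : S -> bool) : binstr := osum (fun s => color (col s)).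

Lemma linear_color b : linear (color b).
Proof. by case: b; [apply: linear_nat|apply: linear_omega_star]. Qed.

Lemma linear_Xof (S : binstr) (col : S -> bool) : linear S -> linear (Xof col).
Proof. by move=> lS; apply: linear_osum => // s; apply: linear_color. Qed.

Definition pt b : color b := match b with true => 0%N | false => 0%N end.

(** The isomorphism invariant behind the insertion arguments: sums of copies of omega and omega^*
    have it, the enlarged orders do not. *)
Definition has_nb (X : binstr) : Prop := forall x : X,
  (exists y, prec x y /\ forall z, ~ (prec x z /\ prec z y)) \/
  (exists y, prec y x /\ forall z, ~ (prec y z /\ prec z x)).

Lemma has_nb_iso (A B : binstr) : iso A B -> has_nb A -> has_nb B.
Proof.
move=> /iso_sym[f [[g fg gf] hf]] nA x.
have hg u v : prec (g u) (g v) <-> prec u v by rewrite hf !gf.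
have hfx y : prec (f x) y <-> prec x (g y) by rewrite hf gf.
have hfy y : prec y (f x) <-> prec (g y) x by rewrite hf gf.
case: (nA (f x)) => [[y [xy ny]]|[y [xy ny]]]; [left|right]; exists (g y); split.
- exact/hfx.
- move=> z [h1 h2]; apply: (ny (f z)); split; [exact/hf|by rewrite -[y]gf; apply/hf].
- exact/hfy.
- move=> z [h1 h2]; apply: (ny (f z)); split; [by rewrite -[y]gf; apply/hf|exact/hf].
Qed.

Lemma has_nb_Xof (S : binstr) (col : S -> bool) : linear S -> has_nb (Xof col).
Proof.
move=> lS [s a].
have same (p : Xof col) (b c : color (col s)) :
    prec (existT _ s b : Xof col) p -> prec p (existT _ s c : Xof col) ->
    exists d, [/\ p = existT _ s d, prec b d & prec d c].
  case: p => t d h1 h2.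
  have e : s = t.
    case: (osum_le h1) => /= [st|//]; case: (osum_le h2) => /= [ts|//].
    by case: (lasym lS st).
  subst t; exists d; split=> //; [exact: (proj1 (osum_same _ _ lS) h1)|exact: (proj1 (osum_same _ _ lS) h2)].
have step : exists c : color (col s), (prec a c /\ forall d, prec a d -> ~ prec d c) \/
    (prec c a /\ forall d, prec c d -> ~ prec d a).
  case: (col s) a => a; exists (a.+1 : nat); [left|right]; split=> //= d.
  - by rewrite ltnS => /leq_trans h /h; rewrite ltnn.
  - by move=> h1 h2; move: (leq_ltn_trans h2 h1); rewrite ltnn.
case: step => c [[h1 h2]|[h1 h2]]; [left|right]; exists (existT _ s c); split; do ?exact/(osum_same _ _ lS).
- by move=> p [/same h /h[d [_ /h2]]].
- by move=> p [/same h /h[d [_ /h2]]].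
Qed.

Definition one : binstr := BinStr (fun _ _ : unit => False).

Lemma oadd_ll (A B : binstr) (a b : A) : @prec (oadd A B) (inl a) (inl b) <-> prec a b.
Proof. exact: oaddP. Qed.

Lemma oadd_rr (A B : binstr) (a b : B) : @prec (oadd A B) (inr a) (inr b) <-> prec a b.
Proof. exact: oaddP. Qed.

Lemma oadd_lr (A B : binstr) (a : A) (b : B) : @prec (oadd A B) (inl a) (inr b).
Proof. exact/oaddP. Qed.

Lemma oadd_rl (A B : binstr) (a : A) (b : B) : ~ @prec (oadd A B) (inr b) (inl a).
Proof. by move/oaddP. Qed.

Lemma has_nb_gap D U : ~ has_nb (oadd D (oadd (oadd omega (oadd one omega_star)) U)).
Proof.
set X := oadd _ _; move=> /(_ (inr (inl (inr (inl tt))) : X)) [[y [xy ny]]|[y [xy ny]]].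
- case: y xy ny => [d /oadd_rl//|[[n /oadd_rr/oadd_ll/oadd_rl//|[u /oadd_rr/oadd_ll/oadd_rr/oadd_ll//|n _ ny]]|u _ ny]].
    apply: (ny (inr (inl (inr (inr n.+1))))); split; apply/oadd_rr/oadd_ll/oadd_rr; first exact: oadd_lr.
    apply/oadd_rr; exact: ltnSn.
  apply: (ny (inr (inl (inr (inr 0%N))))); split; apply/oadd_rr; last exact: oadd_lr.
  apply/oadd_ll/oadd_rr; exact: oadd_lr.
- case: y xy ny => [d _ ny|[[n _ ny|[u /oadd_rr/oadd_ll/oadd_rr/oadd_ll//|n /oadd_rr/oadd_ll/oadd_rr/oadd_rl//]]|u /oadd_rr/oadd_rl//]].
    apply: (ny (inr (inl (inl 0%N)))); split; first exact: oadd_lr.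
    apply/oadd_rr/oadd_ll; exact: oadd_lr.
  apply: (ny (inr (inl (inl n.+1)))); split; apply/oadd_rr/oadd_ll; last exact: oadd_lr.
  apply/oadd_ll; exact: ltnSn.
Qed.

Lemma not_wf_desc V : ~ wf V -> exists u : nat -> V, forall n, prec (u n.+1) (u n).
Proof.
move=> /existsNP[P /not_implyP[[x0 Px0] /forallNP h]].
have [x Px|u [_ _ hu]] := @dep_choice V P (fun a b => prec b a) x0 _ Px0; last by exists u.
apply: contrapT => n; apply: (h x); split=> // y Py yx; apply: n; by exists y.
Qed.

Lemma not_wf_emb V : linear V -> ~ wf V -> emb omega_star V.
Proof.
move=> lV /not_wf_desc[u hu]; exists u => m n /= nm.
have := desc_le lV hu nm; move=> /(lelt lV); apply; exact: hu.
Qed.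

Definition reg (S : binstr) (col : S -> bool) (Q : S -> Prop) : binstr := @sub (Xof col) (fun p => Q (projT1 p)).

Lemma emb_reg (S : binstr) (col : S -> bool) (Q : S -> Prop) : emb (sub Q) (reg col Q).
Proof.
apply/emb_subP; exists (fun s => existT (fun s => color (col s)) (sval s) (pt (col (sval s)))); split.
  by case.
by move=> [x Qx] [y Qy] /= xy; left.
Qed.

Lemma emb_color_reg (S : binstr) (col : S -> bool) (Q : S -> Prop) s :
  linear S -> Q s -> emb (color (col s)) (reg col Q).
Proof.
move=> lS Qs; apply/emb_subP; exists (existT (fun s => color (col s)) s); split=> // x y xy.
exact/(osum_same _ _ lS).
Qed.

Lemma reg_osum (S : binstr) (col : S -> bool) (Q : S -> Prop) : linear S ->
  iso (reg col Q) (@osum (sub Q) (fun s => color (col (sval s)))).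
Proof.
move=> lS; pose f (p : @osum (sub Q) (fun s => color (col (sval s)))) : reg col Q :=
  exist _ (existT _ (sval (projT1 p)) (projT2 p)) (proj2_sig (projT1 p)).
have lQ := linear_sub lS Q.
apply: iso_sym; apply: (@iso_surj _ _ f).
- by apply: linear_osum => // s; apply: linear_color.
- by apply: linear_sub; apply: linear_Xof.
- move=> [s a] [t b] h; case: (osum_le h) => [st|/= e]; first by left.
  subst t; have /(proj1 (osum_same _ _ lQ)) h' := h.
  exact: (proj2 (osum_same _ _ lS) h').
- by move=> [[s a] Qs]; exists (existT _ (exist _ s Qs) a); apply: eq_exist.
Qed.

Lemma lwf_osum (S : binstr) (L : S -> binstr) : linear S -> lwf S -> (forall s, wo (L s)) -> lwf (osum L).
Proof.
move=> lS wS wL [s a]; set v := existT _ s a : osum L; move=> P [[[t b] hb] Pp].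
have tl (p : osum L) : ~ prec p v -> ~ prec (projT1 p) s.
  by move=> h ts; apply: h; case: p ts => u c ts; apply/osumP; left.
pose mk (p : osum L) (h : ~ prec p v) : tail v := exist _ p h.
have [|[u hu] [[p [Pp' e]] mu]] := wS s (fun u => exists p, P p /\ projT1 (sval p) = sval u).
  by exists (exist _ t (tl _ hb)), (mk _ hb).
case: p Pp' e => -[w c] hc Pc /= e; subst w.
have [|d [[hd Pd] md]] := (wL u).2 (fun d => exists h : ~ prec (existT _ u d : osum L) v, P (mk _ h)).
  by exists c, hc.
exists (mk _ hd); split=> // -[[w x] hx] Px h.
case: (osum_le h) => /= [wu|e].
  apply: (mu (exist _ w (tl _ hx))) => //; by exists (mk _ hx).
by subst w; apply: (md x); [exists hx|exact: (proj1 (osum_same _ _ lS) h)].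
Qed.

Lemma wo_nat : wo omega.
Proof.
split; first exact: linear_nat.
move=> P /nat_least[n [Pn mn]]; exists n; split=> // m Pm /mn; exact.
Qed.

(** * Monochromatic pieces of the index order *)

Section Pieces.
Variables (S : binstr) (col : S -> bool).
Hypothesis lS : linear S.

Definition mono_on (b : bool) (Q : S -> Prop) : Prop :=
  (forall s, Q s -> col s = b) /\ if b then lwf (sub Q) else rrwf (sub Q).

Lemma mono_on_sub b (Q Q' : S -> Prop) : (forall s, Q' s -> Q s) -> mono_on b Q -> mono_on b Q'.
Proof.
move=> QQ [cQ wQ]; split=> [s /QQ/cQ//|].
have h := emb_subS QQ; case: b {cQ} wQ => wQ.
  by apply: lwf_emb h wQ; apply: linear_sub.
by apply: lwf_emb (emb_rev h) wQ; apply: linear_rev; apply: linear_sub.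
Qed.

Lemma mono_on_small (Q : S -> Prop) a : (forall s, Q s -> s = a) -> mono_on (col a) Q.
Proof.
move=> h; split=> [s /h->//|].
have nQ (x y : sub Q) : ~ prec x y.
  by case: x y => x Qx [y Qy] /=; rewrite (h x Qx) (h y Qy); apply: lirr.
by case: (col a); apply: wf_lwf => P [x Px]; exists x; split=> // y _; apply: nQ.
Qed.

Lemma mono_on_empty (Q : S -> Prop) b : (forall s, ~ Q s) -> mono_on b Q.
Proof.
by move=> h; split=> [s /h//|]; case: b; apply: wf_lwf => P [[x Qx]]; case: (h x).
Qed.

Lemma mono_on_piece b (Q : S -> Prop) : mono_on b Q ->
  if b then lwf (reg col Q) /\ nomax (reg col Q) else rrwf (reg col Q) /\ nomin (reg col Q).
Proof.
move=> [cQ wQ]; have lQ := linear_sub lS Q; have lR := linear_sub (linear_Xof col lS).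
have iR := reg_osum col Q lS.
have lO : linear (@osum (sub Q) (fun s => color (col (sval s)))).
  by apply: linear_osum => // s; apply: linear_color.
have cs (s : sub Q) : col (sval s) = b by apply: cQ; case: s.
case: b wQ cs {cQ} => wQ cs; split.
- apply: lwf_emb (iso_emb iR) _ => //; first exact: lR.
  by apply: lwf_osum => // s; rewrite cs; apply: wo_nat.
- apply: (nomax_iso (iso_sym iR)) => -[s a].
  have [c ac] : exists c, prec a c by move: a; rewrite cs => a; exists (a.+1 : nat) => /=.
  by exists (existT _ s c); apply/(osum_same _ _ lQ).
- apply: lwf_emb (emb_trans (iso_emb (iso_rev iR)) (iso_emb (rev_osum _ lQ))) _.
  + by apply: linear_rev; apply: lR.
  + by apply: linear_osum => [|s]; apply: linear_rev => //; apply: linear_color.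
  apply: lwf_osum => //; first exact: linear_rev.
  move=> s; rewrite cs; split; first exact: linear_rev linear_omega_star.
  by rewrite /= /omega_star rev_strK; case: wo_nat.
- apply: (nomin_iso (iso_sym iR)) => -[s a].
  have [c ac] : exists c, prec c a by move: a; rewrite cs => a; exists (a.+1 : nat) => /=.
  by exists (existT _ s c); apply/(osum_same _ _ lQ).
Qed.

Lemma reg_piece b (Q : S -> Prop) : mono_on b Q -> piece (reg col Q).
Proof.
move=> /mono_on_piece h; split; first exact: linear_sub (linear_Xof _ lS) _.
by case: b h => -[h _]; [left|right].
Qed.

(** Either an index of the other color contributes a copy of omega^*, or a descending sequence of
    indices does. *)
Lemma not_mono_on_true (Q : S -> Prop) : ~ mono_on true Q -> emb omega_star (reg col Q).
Proof.
move=> h; case: (pselect (exists s, Q s /\ col s = false)) => [[s [Qs cs]]|n].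
  by have := emb_color_reg col lS Qs; rewrite cs.
apply: emb_trans (emb_reg col Q).
apply: not_wf_emb; first exact: linear_sub.
move=> w; apply: h; split; last exact: wf_lwf.
by move=> s Qs; apply: contrapT => ns; apply: n; exists s; split=> //; apply/negbTE/negP.
Qed.

Lemma not_mono_on_false (Q : S -> Prop) : ~ mono_on false Q -> emb omega (reg col Q).
Proof.
move=> h; case: (pselect (exists s, Q s /\ col s = true)) => [[s [Qs cs]]|n].
  by have := emb_color_reg col lS Qs; rewrite cs.
apply: emb_trans (emb_reg col Q).
rewrite -[sub Q]rev_strK -[omega]rev_strK; apply: emb_rev; apply: not_wf_emb.
  exact: linear_rev (linear_sub lS Q).
move=> w; apply: h; split; last exact: wf_lwf.
by move=> s Qs; apply/negbTE/negP => cs; apply: n; exists s.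
Qed.

(** The monotone [pi] cuts [Q] into consecutive intervals. Since an empty piece is monochromatic,
    the condition can be stated for all [k]. *)
Definition piecewise (Q : S -> Prop) : Prop := exists (m : nat) (pi : S -> nat),
  [/\ forall s t, Q s -> Q t -> prec s t -> (pi s <= pi t)%N, forall s, Q s -> (pi s < m)%N &
      forall k, exists b, mono_on b (fun s => Q s /\ pi s = k)].

Lemma piecewise_sub (Q Q' : S -> Prop) : (forall s, Q' s -> Q s) -> piecewise Q -> piecewise Q'.
Proof.
move=> QQ [m [pi [h1 h2 h3]]]; exists m, pi; split=> [s t /QQ Qs /QQ Qt|s /QQ|k]; do ?by auto.
by have [b hb] := h3 k; exists b; apply: mono_on_sub hb => s [/QQ].
Qed.

Lemma piecewise_mono_on b Q : mono_on b Q -> piecewise Q.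
Proof.
by move=> h; exists 1%N, (fun _ => 0%N); split=> // k; exists b; apply: mono_on_sub h => s [].
Qed.

Lemma piecewise_cat (Q1 Q2 Q : S -> Prop) : piecewise Q1 -> piecewise Q2 -> (forall s t, Q1 s -> Q2 t -> prec s t) ->
  (forall s, Q s -> Q1 s \/ Q2 s) -> piecewise Q.
Proof.
move=> [m1 [pi1 [a1 b1 c1]]] [m2 [pi2 [a2 b2 c2]]] h12 hQ.
pose pi s := if pselect (Q1 s) then pi1 s else (m1 + pi2 s)%N.
have p1 s : Q1 s -> pi s = pi1 s by rewrite /pi; case: pselect.
have p2 s : ~ Q1 s -> pi s = (m1 + pi2 s)%N by rewrite /pi; case: pselect.
have q2 s : Q s -> ~ Q1 s -> Q2 s by move=> /hQ[].
exists (m1 + m2)%N, pi; split.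
- move=> s t Qs Qt st; case: (pselect (Q1 s)) => n1; case: (pselect (Q1 t)) => n2.
  + by rewrite !p1 //; apply: a1.
  + by rewrite p1 // p2 //; apply: leq_trans (leq_addr _ _); apply/ltnW/b1.
  + by case: (lasym lS st); apply: h12 => //; apply: q2.
  + by rewrite !p2 // leq_add2l; apply: a2 => //; apply: q2.
- move=> s Qs; case: (pselect (Q1 s)) => n1.
    by rewrite p1 //; apply: leq_trans (leq_addr _ _); apply: b1.
  by rewrite p2 // ltn_add2l; apply: b2; apply: q2.
- move=> k; case: (ltnP k m1) => km.
    have [b hb] := c1 k; exists b; apply: mono_on_sub hb => s [Qs e].
    case: (pselect (Q1 s)) => n1; first by rewrite -e p1.
    by move: km; rewrite -e p2 // ltnNge leq_addr.
  have [b hb] := c2 (k - m1)%N; exists b; apply: mono_on_sub hb => s [Qs e].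
  case: (pselect (Q1 s)) => n1; last by rewrite -e p2 // addKn; split=> //; apply: q2.
  by move: (b1 s n1); rewrite -p1 // e ltnNge km.
Qed.

Definition itvcc (a b : S) : S -> Prop := fun s => ~ prec s a /\ ~ prec b s.
Definition itvco (a b : S) : S -> Prop := fun s => ~ prec s a /\ prec s b.
(** The points that finitely many pieces separate from [x]. Any bounded part of this class above [x]
    is [piecewise]; whether the class itself is must be decided. *)
Definition Eup (x : S) : S -> Prop := fun s => ~ prec s x /\ piecewise (itvcc x s).
Definition Edown (x : S) : S -> Prop := fun s => ~ prec x s /\ piecewise (itvcc s x).

Lemma piecewise_itvcc_refl a : piecewise (itvcc a a).
Proof.
apply: (@piecewise_mono_on (col a)); apply: mono_on_small => s [h1 h2].
by case: (ltot lS s a) => [//|[]].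
Qed.

Lemma Eup_down x s t : Eup x s -> ~ prec t x -> ~ prec s t -> Eup x t.
Proof.
by move=> [xs ps] tx st; split=> //; apply: piecewise_sub ps => u [h1 h2]; split=> //; apply: (lele lS) h2 st.
Qed.

(* Otherwise the relation "[a] and [b] delimit a non-piecewise interval" is dense. *)
Lemma piecewise_all : ~ has_dense S -> (forall x, piecewise (Eup x)) ->
  (forall x, piecewise (Edown x)) -> piecewise (fun _ => True).
Proof.
move=> nd hu hd.
pose R a b := prec a b /\ ~ piecewise (itvcc a b).
case: (pselect (exists a b, R a b)) => [Rab|nR].
  exfalso; apply: nd; exists R; split=> //.
  - by move=> a b [].
  - move=> a b c [ab nab] [bc nbc]; split; first exact: (ltr lS) bc.
    by move=> p; apply: nab; apply: piecewise_sub p => s [h1 h2]; split=> //; apply: (lele lS) h2 (lasym lS bc).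
  move=> a b [ab nab]; apply: contrapT => /forallNP h; apply: nab.
  (* Cut [a, b] where [Eup a] ends. As no point splits [a, b] into two bad intervals, the points
     beyond the cut belong to [Edown b]. *)
  apply: (@piecewise_cat (fun s => itvcc a b s /\ Eup a s) (fun s => itvcc a b s /\ ~ Eup a s)).
  - by apply: piecewise_sub (hu a) => s [].
  - apply: piecewise_sub (hd b) => s [[h1 h2] nE]; split=> //.
    case: (lle lS h2) => [sb|->]; last exact: piecewise_itvcc_refl.
    apply: contrapT => np; apply: (h s); split; split=> //.
      by case: (lle lS h1) => // e; subst s; case: nE; split=> //; apply: piecewise_itvcc_refl.
    by move=> p; apply: nE.
  - move=> s t [[h1 h2] Es] [[h3 h4] Et]; apply: contrapT => nst; apply: Et.
    exact: Eup_down Es h3 nst.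
  - by move=> s hs; case: (pselect (Eup a s)); [left|right].
have pab a b : ~ prec b a -> piecewise (itvcc a b).
  move=> /(lle lS)[ab|->]; last exact: piecewise_itvcc_refl.
  by apply: contrapT => n; apply: nR; exists a, b.
case: (pselect (exists x : S, True)) => [[x _]|ne]; last first.
  by apply: (@piecewise_mono_on true); apply: mono_on_empty => s _; apply: ne; exists s.
apply: (@piecewise_cat (Edown x) (fun s => prec x s)) => [//||s t [h1 _] h2|s _].
- by apply: piecewise_sub (hu x) => s xs; split; [|apply: pab]; apply: (lasym lS).
- by apply: (lelt lS) h2.
- by case: (lltP x s) => h; [right|left; split=> //; apply: pab].
Qed.

End Pieces.

(** * Inserting a point without neighbours *)

Section Insertion.
Variables (S : binstr) (col : S -> bool) (x : S).
Hypotheses (lS : linear S) (cX : CSB (Xof col)) (npw : ~ piecewise col (Eup col x)).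
Let E := Eup col x.
Let X := Xof col.
Let lX : linear X := linear_Xof col lS.

Lemma Eup_self : E x.
Proof. by split; [apply: lirr|apply: piecewise_itvcc_refl]. Qed.

Lemma E_above s t : ~ prec s x -> ~ E s -> E t -> prec t s.
Proof.
move=> xs nE Et; apply: contrapT => h; apply: nE.
exact: (Eup_down lS Et xs h).
Qed.

(** A monochromatic end of [E] from [z] on would make [E] piecewise. For each color the failure
    already shows in a bounded interval, because well-foundedness of tails can be tested below a
    given point. *)
Lemma E_step z : E z -> exists z', [/\ E z', prec z z' & forall b, ~ mono_on col b (itvco z z')].
Proof.
move=> Ez.
have ntail b : ~ mono_on col b (fun s => E s /\ ~ prec s z).
  move=> /(piecewise_mono_on lS) p; apply: npw; apply: (@piecewise_cat S col lS (itvco x z) (fun s => E s /\ ~ prec s z)) => //.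
  - by apply: (piecewise_sub lS _ Ez.2) => s [h1 h2]; split=> //; apply: (lasym lS).
  - by move=> s t [_ sz] [_ tz]; apply: (ltle lS) sz tz.
  - by move=> s Es; case: (lltP s z) => sz; [left; split=> //; case: Es|right].
have nb b : exists t, [/\ E t, ~ prec t z & ~ mono_on col b (itvcc z t)].
  apply: contrapT => n; apply: (ntail b).
  have h t : E t -> ~ prec t z -> mono_on col b (itvcc z t).
    by move=> Et tz; apply: contrapT => nt; apply: n; exists t.
  split=> [s [Es sz]|].
    by apply: (h s Es sz).1; split=> //; apply: lirr.
  case: b {ntail n} h => h.
    apply: wf_lwf => P [[p [Ep pz]] Pp].
    have zz : itvcc z p z by split; [apply: lirr|].
    have w : wf (sub (itvcc z p)).
      apply: wf_emb ((h p Ep pz).2 (exist _ z zz)).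
      by apply/emb_subP; exists id; split=> // -[s [h1 h2]].
    have [|[q hq] [[hq' Pq] mq]] := w (fun q => exists h, P (exist _ (sval q) h)).
      have cp : itvcc z p p by split; [|apply: lirr].
      by exists (exist _ p cp), (conj Ep pz).
    exists (exist _ q hq'); split=> // -[r hr] Pr /= rq.
    have cr : itvcc z p r.
      split; first exact: (proj2 hr).
      by move=> pr; apply: (proj2 hq); apply: (ltr lS) pr rq.
    by apply: (mq (exist _ r cr)) => //; exists hr.
  move=> [v [Ev vz]]; have cv : itvcc z v v by split; [|apply: lirr].
  apply: wf_emb ((h v Ev vz).2 (exist _ v cv)).
  pose f (p : @tail (rev_str (sub (fun s => E s /\ ~ prec s z))) (exist _ v (conj Ev vz))) : sub (itvcc z v) :=
    exist _ (sval (sval p)) (conj (proj2_sig (sval p)).2 (proj2_sig p)).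
  apply/(@emb_subP _ (rev_str (sub (itvcc z v)))); exists f; split=> [[[s hs] h']|] //.
have [t1 [E1 z1 m1]] := nb true; have [t2 [E2 z2 m2]] := nb false.
have [t [Et [h1 h2]]] : exists t, E t /\ ~ prec t t1 /\ ~ prec t t2.
  case: (lltP t1 t2) => h; first by exists t2; do !split=> //; [apply: (lasym lS)|apply: lirr].
  by exists t1; do !split=> //; apply: lirr.
(* A largest point [t] of [E] would make [E] a bounded interval, hence piecewise. *)
have [z' [Ez' tz']] : exists z', E z' /\ prec t z'.
  apply: contrapT => n; apply: npw; apply: (piecewise_sub lS _ Et.2) => s [Es1 Es2]; split=> // ts.
  by apply: n; exists s.
exists z'; split=> //; first by apply: (lelt lS (lele lS z1 h1)).
move=> b mb.
case: b mb => mb; [apply: m1|apply: m2]; apply: (mono_on_sub lS _ mb) => s [q1 q2]; split=> //;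
  apply: (lelt lS) tz'; exact: (lele lS) q2 _.
Qed.

(** If some [y] of [E] bounded the sequence, two consecutive terms would fall into the same one of
    the finitely many pieces of [x, y], and the interval between them would be monochromatic. *)
Lemma E_seq : exists z : nat -> S, [/\ forall n, E (z n), z 0 = x, forall n, prec (z n) (z n.+1),
  forall n b, ~ mono_on col b (itvco (z n) (z n.+1)) & forall y, E y -> exists n, prec y (z n)].
Proof.
have [z Ez|z [z0 Ez hz]] := @dep_choice S E (fun z z' => prec z z' /\ forall b, ~ mono_on col b (itvco z z')) x _ Eup_self.
  by have [z' [h1 h2 h3]] := E_step Ez; exists z'.
exists z; split=> //; do ?by [move=> n; case: (hz n)].
move=> y Ey; apply: contrapT => /forallNP h.
have [m [pi [p1 p2 p3]]] := Ey.2.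
have zc n : itvcc x y (z n) by split; [case: (Ez n)|exact: h].
have [n en] : exists n, pi (z n) = pi (z n.+1).
  apply: contrapT => /forallNP ne.
  have up n : (n <= pi (z n))%N.
    elim: n => // n IH; apply: leq_ltn_trans IH _; rewrite ltn_neqAle; apply/andP; split; first exact/eqP.
    by apply: p1 => //; apply: (hz n).1.
  by have := p2 _ (zc m); rewrite ltnNge up.
have [b hb] := p3 (pi (z n)); apply: ((hz n).2 b); apply: (mono_on_sub lS _ hb) => s [h1 h2].
have cs : itvcc x y s.
  split; first by apply: (lele lS) h1; case: (Ez n).
  by apply: (lasym lS); apply: (ltle lS h2); apply: h.
split=> //; apply/eqP; rewrite eqn_leq; apply/andP; split.
  by rewrite en; apply: p1.
by case: (lle lS h1) => [zs|->//]; apply: p1.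
Qed.

(* The upper part [E] is cut into countably many monochromatic pieces, read off
   from a cofinal sequence and the finite decompositions between its terms. *)
Lemma E_pieces : exists (z : nat -> S) (pi : S -> nat) (M : nat -> nat),
  [/\ [/\ forall n, E (z n), forall n, prec (z n) (z n.+1) & forall n b, ~ mono_on col b (itvco (z n) (z n.+1))],
      forall s t, E s -> E t -> prec s t -> (pi s <= pi t)%N,
      forall k, exists b, mono_on col b (fun s => E s /\ pi s = k),
      forall n s, E s -> ~ prec s (z n) -> (n <= pi s)%N &
      forall n s, E s -> (M n <= pi s)%N -> ~ prec s (z n)].
Proof.
have [z [Ez z0 zS zm zc]] := E_seq.
have zmono i j : (i <= j)%N -> ~ prec (z j) (z i).
  exact: (@desc_le (rev_str S) z (linear_rev lS) zS).
have pz n : exists p : nat * (S -> nat),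
  [/\ forall s t, itvco (z n) (z n.+1) s -> itvco (z n) (z n.+1) t -> prec s t -> (p.2 s <= p.2 t)%N,
      forall s, itvco (z n) (z n.+1) s -> (p.2 s < p.1)%N &
      forall k, exists b, mono_on col b (fun s => itvco (z n) (z n.+1) s /\ p.2 s = k)].
  have : piecewise col (itvco (z n) (z n.+1)).
    apply: (piecewise_sub lS _ (Ez n.+1).2) => s [h1 h2]; split; last exact: (lasym lS).
    by apply: (lele lS) h1; case: (Ez n).
  by move=> [m [pi h]]; exists (m, pi).
have [p hp] := choice pz.
have nx s : exists n, E s -> itvco (z n) (z n.+1) s.
  case: (pselect (E s)) => [Es|ns]; last by exists 0%N.
  have [n [hn mn]] := nat_least (zc s Es).
  case: n hn mn => [|n] hn mn; first by case: Es => []; rewrite z0 in hn.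
  by exists n => _; split=> //; apply: mn.
have [N hN] := choice nx.
(* [M n] is the number of pieces allotted to the first n intervals, the offset at which the
   numbering of the n-th interval starts. *)
pose M n := (\sum_(i < n) (p i).1)%N.
have MS n : M n.+1 = (M n + (p n).1)%N by rewrite /M big_ord_recr.
have Mmono i j : (i <= j)%N -> (M i <= M j)%N.
  elim: j => [|j IH]; first by rewrite leqn0 => /eqP->.
  rewrite leq_eqVlt => /orP[/eqP->//|/IH h]; apply: leq_trans h _; rewrite MS; exact: leq_addr.
have pgt n : (0 < (p n).1)%N.
  have [_ h _] := hp n; apply: leq_ltn_trans (h (z n) _) => //.
  by split; [apply: lirr|apply: zS].
have Mge n : (n <= M n)%N.
  by elim: n => // n IH; rewrite MS -addn1; apply: leq_add.
pose pi s := (M (N s) + (p (N s)).2 s)%N.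
have pilt s : E s -> (pi s < M (N s).+1)%N.
  by move=> Es; rewrite MS ltn_add2l; have [_ h _] := hp (N s); apply: h; apply: hN.
have pige s : (M (N s) <= pi s)%N by apply: leq_addr.
have Nmono s t : E s -> E t -> ~ prec t s -> (N s <= N t)%N.
  move=> Es Et st; rewrite leqNgt; apply/negP => ts.
  have [_ h1] := hN t Et; have [h2 _] := hN s Es.
  by apply: (zmono _ _ ts); apply: (lelt lS h2); apply: (lelt lS st h1).
have Nz n s : E s -> ~ prec s (z n) -> (n <= N s)%N.
  move=> Es ns; rewrite leqNgt; apply/negP => h; have [_ h1] := hN s Es.
  by apply: (zmono _ _ h); apply: (lelt lS ns).
exists z, pi, M; split=> //.
- move=> s t Es Et st; have := Nmono s t Es Et (lasym lS st).
  rewrite leq_eqVlt => /orP[/eqP e|h].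
    rewrite /pi -e leq_add2l; have [h _ _] := hp (N s); apply: h => //; first exact: hN.
    by rewrite e; apply: hN.
  by apply: leq_trans (pige t); apply: leq_trans (Mmono _ _ h); apply/ltnW/pilt.
- move=> k; case: (pselect (exists s, E s /\ pi s = k)) => [[s0 [E0 e0]]|n]; last first.
    by exists true; apply: mono_on_empty => s hs; apply: n; exists s.
  have [_ _ /(_ (k - M (N s0))%N)[b hb]] := hp (N s0); exists b.
  apply: (mono_on_sub lS _ hb) => s [Es es].
  have eN : N s = N s0.
    case: (ltngtP (N s) (N s0)) => // h.
      have := leq_trans (pilt s Es) (leq_trans (Mmono _ _ h) (pige s0)).
      by rewrite es e0 ltnn.
    have := leq_trans (pilt s0 E0) (leq_trans (Mmono _ _ h) (pige s)).
    by rewrite es e0 ltnn.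
  split; first by rewrite -eN; apply: hN.
  by rewrite -es /pi eN addKn.
- by move=> n s Es ns; apply: leq_trans (pige s); apply: leq_trans (Mge _); apply: Nz.
- move=> n s Es Ms zn.
  have Nn : (N s < n)%N.
    rewrite ltnNge; apply/negP => h; have [h1 _] := hN s Es.
    by apply: h1; apply: (ltle lS zn); apply: zmono.
  by have := leq_trans (pilt s Es) (leq_trans (Mmono _ _ Nn) Ms); rewrite ltnn.
Qed.

End Insertion.

(* Each piece of an omega-sum over a well-quasi-ordered class eventually embeds
   in infinitely many later ones, so some tail embeds in all of its tails. *)
Lemma recurrent_tail (X : binstr) (Q : X -> Prop) (pi : X -> nat) : linear X ->
  (forall s t, Q s -> Q t -> prec s t -> (pi s <= pi t)%N) ->
  (forall k, piece (sub (fun s => Q s /\ pi s = k))) ->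
  exists N, forall M, emb (sub (fun s => Q s /\ (N <= pi s)%N)) (sub (fun s => Q s /\ (M <= pi s)%N)).
Proof.
move=> lX mono hp; have [N hN] := recurrent wqo_piece hp; exists N => M.
(* A pair (k, m) sends piece k into piece m. Along [R] the source advances by one while the target
   strictly increases, so the piecewise embeddings combine to an increasing map. *)
pose P (km : nat * nat) := [/\ (N <= km.1)%N, (M <= km.2)%N &
  emb (sub (fun s => Q s /\ pi s = km.1)) (sub (fun s => Q s /\ pi s = km.2))].
pose R (a b : nat * nat) := b.1 = a.1.+1 /\ (a.2 < b.2)%N.
have [m0 [Mm0 e0]] := hN N (leqnn _) M.
have [[k m] [Nk Mm e]|u [u0 Pu Ru]] := @dep_choice _ P R (N, m0) _ (And3 (leqnn _) Mm0 e0).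
  have [m' [mm' e']] := hN k.+1 (leqW Nk) (maxn M m.+1); rewrite geq_max in mm'; case/andP: mm' => h1 h2.
  by exists (k.+1, m'); do !split=> //=; apply: leqW.
have u1 i : (u i).1 = (N + i)%N by elim: i => [|i IH]; [rewrite u0 addn0|rewrite (Ru i).1 IH addnS].
have u2 := inc_seq (fun i => (Ru i).2).
have lsub := linear_sub lX (fun s => Q s /\ (N <= pi s)%N).
pose sg (s : sub (fun s => Q s /\ (N <= pi s)%N)) : omega := pi (sval s).
apply: emb_trans (iso_emb (@iso_fibers _ omega sg lsub linear_nat _)) _.
  by move=> [s [Qs Ns]] [t [Qt Nt]] /= st; rewrite /sg /= ltnNge mono.
apply: (@emb_osum_into omega _ (sub (fun s => Q s /\ (M <= pi s)%N))
  (fun k p => (N <= k)%N /\ pi (sval p) = (u (k - N)%N).2)); first exact: linear_nat.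
  move=> k; case: (leqP N k) => Nk; last first.
    have no (q : sub (fun p => sg p = k)) : False.
      case: q => -[s [Qs Ns]] /= e; have h : (N <= k)%N by rewrite -e.
      by move: h; rewrite leqNgt Nk.
    by exists (fun q => False_rect _ (no q)) => q; case: (no q).
  have [_ Mk /emb_subP[f [fQ hf]]] := Pu (k - N)%N.
  have fM a : Q (f a) /\ (M <= pi (f a))%N by case: (fQ a) => h ->.
  have gP (p : sub (fun p => sg p = k)) : Q (sval (sval p)) /\ pi (sval (sval p)) = (u (k - N)%N).1.
    split; first by case: (sval p) => s [].
    by rewrite u1 subnKC //; exact: (proj2_sig p).
  pose g (p : sub (fun p => sg p = k)) : sub (fun s => Q s /\ pi s = (u (k - N)%N).1) := exist _ _ (gP p).
  apply/emb_subP; exists (fun p => exist _ (f (g p)) (fM (g p))); split=> [p|p q h] /=.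
    by split=> //; case: (fQ (g p)).
  exact: hf.
move=> k l [s [Qs Ms]] [t [Qt Mt]] /= kl [Nk es] [Nl et].
have st : (pi s < pi t)%N by rewrite es et; apply: u2; apply: ltn_sub2r => //; apply: leq_ltn_trans kl.
case: (ltot lX s t) => [//|[e|ts]]; first by rewrite e ltnn in st.
by have := mono _ _ Qt Qs ts; rewrite leqNgt st.
Qed.

Lemma emb_one (X : binstr) (P : X -> Prop) x : P x -> emb one (sub P).
Proof. by move=> Px; apply/emb_subP; exists (fun _ => x); split=> // -[]. Qed.

(** [Y] is the sum with [J] inserted just before a tail of the part over [E] that embeds in all its
    tails. To embed [Y] back, [J] goes into the three intervals after [z N] and the tail moves
    beyond them. By CSB [Y] would inherit [has_nb]. *)
Lemma piecewise_Eup (S : binstr) (col : S -> bool) (x : S) : linear S -> CSB (Xof col) -> piecewise col (Eup col x).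
Proof.
move=> lS cX; apply: contrapT => npw.
have lX := linear_Xof col lS.
have [z [pi [M [[Ez zS zm] mono pieces hlow hM]]]] := E_pieces lS npw.
pose E := Eup col x.
pose Q (p : Xof col) := E (projT1 p).
pose sg (p : Xof col) := pi (projT1 p).
have projle (p q : Xof col) : prec p q -> ~ prec (projT1 q) (projT1 p).
  by move=> /osum_le[h|->]; [apply: (lasym lS)|apply: lirr].
have projlt (p q : Xof col) : prec (projT1 p) (projT1 q) -> prec p q.
  by case: p q => s a [t b] h; apply/osumP; left.
have monoX p q : Q p -> Q q -> prec p q -> (sg p <= sg q)%N.
  move=> Qp Qq /osum_le[h|e]; last by rewrite /sg e.
  exact: mono.
have piecesX k : piece (sub (fun p => Q p /\ sg p = k)).
  by have [b hb] := pieces k; apply: (reg_piece lS hb).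
have [N hN] := recurrent_tail lX monoX piecesX.
pose T n (p : Xof col) := Q p /\ (n <= sg p)%N.
(* The cut of the insertion: everything before the tail [T N]. The complement of [D] consists of
   [T N] and of points above all of [E] ([Eab]). *)
pose D (p : Xof col) := forall q, T N q -> prec p q.
pose pz n : Xof col := existT _ (z n) (pt (col (z n))).
have zmono i j : (i <= j)%N -> ~ prec (z j) (z i).
  exact: (@desc_le (rev_str S) z (linear_rev lS) zS).
have TnD p : T N p -> ~ D p by move=> Tp /(_ p Tp); apply: lirr.
have Eab p q : ~ D p -> ~ T N p -> Q q -> prec (projT1 q) (projT1 p).
  move=> /existsNP[r /not_implyP[[Qr Nr] /(lle lX) rp]] nT Qq.
  have rp' : ~ prec (projT1 p) (projT1 r) by case: rp => [/projle//|->]; apply: lirr.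
  have xp : ~ prec (projT1 p) x by apply: (lele lS) rp'; case: Qr.
  apply: (@E_above S col x lS) Qq => // Ep; apply: nT; split=> //.
  case: (lle lS rp') => [h|e]; last by rewrite /sg -e.
  by apply: leq_trans Nr _; apply: mono.
pose J := oadd omega (oadd one omega_star).
pose Y := oadd (sub D) (oadd J (sub (fun p => ~ D p))).
have Ddown p q : D q -> prec p q -> D p by move=> Dq pq r /Dq; apply: (ltr lX).
have XY : emb (Xof col) Y.
  apply: emb_trans (iso_emb (iso_cut lX Ddown)) _; apply: emb_oadd; first exact: emb_refl.
  exact: emb_inr.
have zE a s : ~ prec s (z a) -> prec s (z a.+3) -> E s.
  move=> h1 h2; apply: (Eup_down lS (Ez a.+3)); last exact: (lasym lS).
  by apply: (lele lS) h1; case: (Ez a).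
have YX : emb Y (Xof col).
  have JU : emb (oadd J (sub (fun p => ~ D p))) (sub (fun p => ~ D p)).
    pose P1 (p : Xof col) := itvco (z N) (z N.+3) (projT1 p).
    pose P2 (p : Xof col) := ~ D p /\ ~ prec (projT1 p) (z N.+3).
    have c1 n : (N <= n < N.+3)%N -> forall s, itvco (z n) (z n.+1) s -> itvco (z N) (z N.+3) s.
      move=> /andP[h1 h2] s [h3 h4]; split; first by apply: (lele lS) h3; apply: zmono.
      exact: (ltle lS h4 (zmono _ _ h2)).
    have ordco n m (p q : Xof col) : (n < m)%N -> itvco (z n) (z n.+1) (projT1 p) -> itvco (z m) (z m.+1) (projT1 q) ->
        prec p q.
      move=> nm [_ h1] [h2 _]; apply: projlt; apply: (ltle lS h1); apply: (lele lS) h2; exact: zmono.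
    (* Neither color is monochromatic on any of these intervals: the first supplies omega, the
       second the middle point, the third omega^*. *)
    have EJ : emb J (sub P1).
      apply: (@emb_oadd_sub _ _ _ (fun p : Xof col => itvco (z N) (z N.+1) (projT1 p))
        (fun p => itvco (z N.+1) (z N.+2) (projT1 p) \/ itvco (z N.+2) (z N.+3) (projT1 p))).
      - by apply: (not_mono_on_false lS).
      - apply: (@emb_oadd_sub _ _ _ (fun p : Xof col => itvco (z N.+1) (z N.+2) (projT1 p))
          (fun p => itvco (z N.+2) (z N.+3) (projT1 p))); do ?by auto.
        + by apply: (@emb_one _ _ (pz N.+1)); split; [apply: lirr|apply: zS].
        + by apply: (not_mono_on_true lS).
        + by move=> p q; apply: ordco.
      - by move=> p q h [|]; apply: ordco h.
      - by move=> p; apply: c1; rewrite leqnn /= ltnW.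
      - by move=> p [|]; apply: c1; rewrite ?leqnn ?leqnSn ?ltnSn ?andbT //; apply: ltnW.
    have EU : emb (sub (fun p => ~ D p)) (sub P2).
      have /emb_subP[e [eT he]] := hN (maxn N (M N.+3)).
      have eT' p : T N (e p) /\ ~ prec (projT1 (e p)) (z N.+3).
        case: (eT p) => Qe; rewrite geq_max => /andP[h1 h2]; split; first by split.
        exact: hM.
      (* [g] pushes [T N] past [z N.+3] and fixes the points above [E]. *)
      pose g (p : Xof col) : Xof col := match pselect (T N p) with left h => e (exist _ p h) | right _ => p end.
      have gT p (h : T N p) : g p = e (exist _ p h).
        by rewrite /g; case: pselect => // h'; congr (e (exist _ _ _)); apply: Prop_irrelevance.
      have gN p : ~ T N p -> g p = p by rewrite /g; case: pselect.
      apply/emb_subP; exists (fun p => g (sval p)); split.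
        move=> [p nD] /=; case: (pselect (T N p)) => h.
          by rewrite (gT _ h); split; [apply: TnD|]; case: (eT' (exist _ p h)).
        rewrite gN //; split=> //; apply: (lasym lS).
        exact: (Eab p (pz N.+3) nD h (Ez _)).
      move=> [p nDp] [q nDq] /= pq; case: (pselect (T N p)) => hp; case: (pselect (T N q)) => hq.
      - by rewrite (gT _ hp) (gT _ hq); apply: he.
      - rewrite (gT _ hp) (gN _ hq); apply: projlt; apply: (Eab q) => //.
        by case: (eT' (exist _ p hp)) => -[].
      - case: (projle _ _ pq); exact: (Eab p q nDp hp (proj1 hq)).
      - by rewrite !gN.
    apply: (emb_oadd_sub EJ EU) => [p q [_ h1] [_ h2]|p [h1 h2]|p []//].
      by apply: projlt; apply: (ltle lS h1).
    apply: TnD; split; first exact: zE h1 h2.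
    by apply: hlow => //; apply: zE h1 h2.
  apply: (emb_oadd_into (emb_refl _) JU) => p q Dp nDq.
  by case: (ltot lX p q) => [//|[e|/(Ddown _ _ Dp)//]]; rewrite e in Dp.
have lY : linear Y.
  have lJ : linear J.
    apply: linear_oadd; first exact: linear_nat.
    apply: linear_oadd; last exact: linear_omega_star.
    by split; [split=> [[]|[]]|move=> [] []; right; left].
  by apply: linear_oadd; [|apply: linear_oadd => //]; apply: linear_sub.
apply: (@has_nb_gap (sub D) (sub (fun p => ~ D p))).
apply: has_nb_iso (CSB_iso cX lY XY YX) _; exact: has_nb_Xof.
Qed.

(** * Invariance under isomorphism and reversal *)

Lemma CSB_transfer X Y : iso X Y -> CSB X -> CSB Y.
Proof.
move=> XY [lX h]; have YX := iso_sym XY; split; first exact: linear_iso YX lX.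
move=> Z lZ /biemb_equi[YZ ZY]; apply: (iso_trans YX); apply: h => //.
apply: equi_biemb => //; split; [exact: emb_trans (iso_emb XY) YZ|exact: emb_trans ZY (iso_emb YX)].
Qed.

Lemma CSB_rev X : CSB X -> CSB (rev_str X).
Proof.
move=> cX; have [lX _] := cX; split; first exact: linear_rev.
move=> Y lY /biemb_equi[XY YX].
rewrite -[Y]rev_strK; apply: iso_rev; apply: CSB_iso => //; first exact: linear_rev.
  by rewrite -[X]rev_strK; apply: emb_rev.
by rewrite -[X]rev_strK; apply: emb_rev.
Qed.

Lemma has_nb_rev X : has_nb X -> has_nb (rev_str X).
Proof.
move=> h x; case: (h x) => -[y [xy ny]]; [right|left]; exists y; split=> // z [h1 h2].
  exact: (ny z).
exact: (ny z).
Qed.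

Lemma rev_color b : rev_str (color b) = color (~~ b).
Proof. by case: b => //=; rewrite /omega_star rev_strK. Qed.

Lemma rev_Xof (S : binstr) (col : S -> bool) : linear S ->
  iso (rev_str (Xof col)) (@Xof (rev_str S) (fun s => ~~ col s)).
Proof.
move=> lS; apply: iso_trans (rev_osum _ lS) _; apply: iso_osum; first exact: linear_rev.
by move=> s; rewrite rev_color; apply: iso_refl.
Qed.

Lemma mono_on_rev (S : binstr) (col : S -> bool) b (Q : S -> Prop) :
  @mono_on (rev_str S) (fun s => ~~ col s) b Q -> mono_on col (~~ b) Q.
Proof.
move=> [cQ wQ]; split=> [s /cQ <-|]; first by rewrite negbK.
by case: b wQ {cQ} => //= w; rewrite -[sub Q]rev_strK; exact: w.
Qed.

Lemma piecewise_rev (S : binstr) (col : S -> bool) (Q : S -> Prop) : linear S ->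
  @piecewise (rev_str S) (fun s => ~~ col s) Q -> piecewise col Q.
Proof.
move=> lS [m [pi [h1 h2 h3]]]; exists m, (fun s => m - (pi s).+1)%N; split.
- by move=> s t Qs Qt st; apply: leq_sub2l; rewrite ltnS; apply: h1.
- move=> s /h2 h; rewrite ltn_subrL /=; exact: leq_ltn_trans h.
move=> k; have [b hb] := h3 (m - k.+1)%N; exists (~~ b); apply: mono_on_rev.
apply: (mono_on_sub (linear_rev lS) _ hb) => s [Qs <-]; split=> //.
by rewrite subnS subKn ?h2.
Qed.

Lemma piecewise_rev' (S : binstr) (col : S -> bool) (Q : S -> Prop) : linear S ->
  piecewise col Q -> @piecewise (rev_str S) (fun s => ~~ col s) Q.
Proof.
case: S col Q => T r col Q lS h; apply: piecewise_rev; first exact: linear_rev.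
by rewrite (_ : (fun s => _) = col) //; apply: funext => s; rewrite negbK.
Qed.

Lemma piecewise_limit (S : binstr) (col : S -> bool) : linear S -> ~ has_dense S -> CSB (Xof col) ->
  piecewise col (fun _ => True).
Proof.
move=> lS nS cX; apply: piecewise_all => // x; first exact: piecewise_Eup.
have cX' := CSB_transfer (rev_Xof col lS) (CSB_rev cX).
apply: piecewise_rev => //; apply: (piecewise_sub (linear_rev lS) _ (@piecewise_Eup (rev_str S) _ x (linear_rev lS) cX')).
move=> s [h1 h2]; split=> //; apply: (piecewise_rev' lS); apply: (piecewise_sub lS _ h2) => t [h3 h4]; by split.
Qed.

(** * Pieces *)

Definition mono_sum (b : bool) (V : binstr) : Prop := exists Q : binstr,
  [/\ linear Q, iso V (osum (fun _ : Q => color b)) & if b then lwf V else rrwf V].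

Definition any_mono_sum V := exists b, mono_sum b V.

Lemma mono_sum_linear b V : mono_sum b V -> linear V.
Proof.
move=> [Q [lQ iV _]]; apply: linear_iso iV _; apply: linear_osum => // _; exact: linear_color.
Qed.

Lemma mono_sum_end b V : mono_sum b V -> if b then nomax V else nomin V.
Proof.
move=> [Q [lQ iV _]]; case: b iV => iV; [apply: (nomax_iso (iso_sym iV))|apply: (nomin_iso (iso_sym iV))] => -[q a].
  by exists (existT _ q (a.+1 : omega)); apply/(osum_same _ _ lQ); exact: ltnSn.
by exists (existT _ q (a.+1 : omega_star)); apply/(osum_same _ _ lQ); exact: ltnSn.
Qed.

Lemma mono_sum_rev b V : mono_sum b V -> mono_sum (~~ b) (rev_str V).
Proof.
move=> [Q [lQ iV w]]; exists (rev_str Q); split; first exact: linear_rev.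
  apply: iso_trans (iso_rev iV) _; apply: iso_trans (rev_osum _ lQ) _.
  by apply: iso_osum => [|s]; [apply: linear_rev|rewrite rev_color; apply: iso_refl].
by case: b w {iV} => //= w; rewrite /rrwf rev_strK.
Qed.

Lemma lwf_oadd A B : lwf A -> wf B -> lwf (oadd A B).
Proof.
move=> wA wB [a|b]; last first.
  apply: wf_emb wB; pose f (p : @tail (oadd A B) (inr b)) : B := match sval p with inl _ => b | inr c => c end.
  by exists f => -[[x|x] h] [[y|y] h'] //=; rewrite /f /=; [case: h; exact: oadd_lr|case: h; exact: oadd_lr|move/oadd_rl|move/oadd_rr].
apply: wf_emb (wf_oadd (wA a) wB).
pose P (p : oadd A B) := ~ prec p (inl a).
have hP x : P (inl x) -> ~ prec x a by move=> h h'; apply: h; apply/oadd_ll.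
pose f (p : sub P) : oadd (tail a) B := match p with
  | exist (inl x) h => inl (exist (fun x => ~ prec x a) x (hP x h)) | exist (inr y) _ => inr y end.
exists f => -[[x|x] h] [[y|y] h'] k.
- have k' : @prec (oadd A B) (inl x) (inl y) := k.
  by apply/oaddP; exact (proj1 (@oadd_ll A B x y) k').
- exact: oadd_lr.
- by case: (oadd_rl k).
- have k' : @prec (oadd A B) (inr x) (inr y) := k.
  by apply/oaddP; exact (proj1 (@oadd_rr A B x y) k').
Qed.

Lemma iso_osum_oadd (Q Q' C : binstr) : linear Q -> linear Q' -> linear C ->
  iso (oadd (osum (fun _ : Q => C)) (osum (fun _ : Q' => C))) (osum (fun _ : oadd Q Q' => C)).
Proof.
move=> lQ lQ' lC; have lQQ := linear_oadd lQ lQ'.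
pose f (p : oadd (osum (fun _ : Q => C)) (osum (fun _ : Q' => C))) : osum (fun _ : oadd Q Q' => C) :=
  match p with inl (existT q c) => existT _ (inl q) c | inr (existT q c) => existT _ (inr q) c end.
apply: (@iso_surj _ _ f).
- by apply: linear_oadd; apply: linear_osum.
- exact: linear_osum.
- move=> [[q c]|[q c]] [[r d]|[r d]] h.
  + move/oadd_ll: h => h; case: (osum_le h) => [qr|e].
      by apply/osumP; left; apply/oadd_ll.
    change (q = r) in e; subst r; by apply/(osum_same _ _ lQQ); move/(osum_same _ _ lQ): h.
  + by apply/osumP; left; apply: oadd_lr.
  + by case: (oadd_rl h).
  + move/oadd_rr: h => h; case: (osum_le h) => [qr|e].
      by apply/osumP; left; apply/oadd_rr.
    change (q = r) in e; subst r; by apply/(osum_same _ _ lQQ); move/(osum_same _ _ lQ'): h.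
- by move=> [[q|q] c]; [exists (inl (existT _ q c))|exists (inr (existT _ q c))].
Qed.

Lemma mono_sum_merge A B : mono_sum true A -> mono_sum true B -> wf B -> mono_sum true (oadd A B).
Proof.
move=> [Q [lQ iA wA]] [Q' [lQ' iB _]] wB; exists (oadd Q Q'); split; first exact: linear_oadd.
  by apply: iso_trans (iso_oadd iA iB) _; apply: iso_osum_oadd => //; apply: linear_nat.
exact: lwf_oadd.
Qed.

Lemma mono_sum_iso b A B : iso A B -> mono_sum b A -> mono_sum b B.
Proof.
move=> AB hA; have lA := mono_sum_linear hA; have BA := iso_sym AB; have lB := linear_iso BA lA.
have [Q [lQ iA wA]] := hA; exists Q; split=> //; first exact: iso_trans BA iA.
case: b wA {hA iA} => wA; first by apply: lwf_emb wA => //; apply: iso_emb.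
by apply: lwf_emb wA; do ?[exact: linear_rev]; apply: iso_emb; apply: iso_rev.
Qed.

Lemma mono_sum_merge' A B : mono_sum false A -> mono_sum false B -> rwf A -> mono_sum false (oadd A B).
Proof.
move=> gA gB wA; rewrite -[oadd A B]rev_strK; apply: (@mono_sum_rev true).
apply: mono_sum_iso (iso_sym (rev_oadd A B)) _; apply: mono_sum_merge; [exact: (mono_sum_rev gB)|exact: (mono_sum_rev gA)|].
exact: wA.
Qed.

(** Neighbours to which neither [mono_sum_merge] nor its mirror image applies. *)
Definition adj_ok A B := ~ (mono_sum true A /\ mono_sum true B /\ wf B) /\
  ~ (mono_sum false A /\ mono_sum false B /\ rwf A).

Definition norm (l : seq binstr) := [/\ List.Forall any_mono_sum l, List.Forall (fun V : binstr => inhabited V) l &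
  forall l1 A B l2, l = l1 ++ A :: B :: l2 -> adj_ok A B].

Lemma norm_exists l : List.Forall any_mono_sum l -> exists l', norm l' /\ iso (lsum l) (lsum l').
Proof.
move: {2}(size l) (leqnn (size l)) => n; elim: n l => [|n IH] l hn hl.
  exists [::]; case: l hn hl => // _ _; split; last exact: iso_refl.
  by split=> // -[].
have sz (l1 l2 : seq binstr) A B C : (size (l1 ++ A :: B :: l2) <= n.+1)%N -> (size (l1 ++ C :: l2) <= n)%N.
  by rewrite !size_cat /= !addnS ltnS.
case: (pselect (exists l1 V l2, l = l1 ++ V :: l2 /\ ~ inhabited V)) => [[l1 [V [l2 [e nV]]]]|ne].
  subst l; have /Forall_mid[h1 hV h2] := hl.
  have [||l' [hl' il']] := IH (l1 ++ l2).
  - by move: hn; rewrite !size_cat /= addnS ltnS.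
  - by apply/List.Forall_app.
  exists l'; split=> //; apply: iso_trans il'.
  apply: iso_trans (lsum_cat _ _) _; apply: iso_trans _ (iso_sym (lsum_cat _ _)).
  apply: iso_oadd; first exact: iso_refl.
  apply: iso_trans _ (oadd0o _); apply: iso_oadd; last exact: iso_refl.
  by apply: iso_empty; [move=> x; apply: nV|case].
case: (pselect (exists l1 A B l2, l = l1 ++ A :: B :: l2 /\ ~ adj_ok A B)) => [[l1 [A [B [l2 [e nA]]]]]|na].
  subst l; have /Forall_mid[h1 hA /List.Forall_cons_iff[hB h2]] := hl.
  have gAB : any_mono_sum (oadd A B).
    case/not_andP: nA => /contrapT[gA [gB w]]; first by exists true; apply: mono_sum_merge.
    by exists false; apply: mono_sum_merge'.
  have [||l' [hl' il']] := IH (l1 ++ oadd A B :: l2); [exact: sz hn|exact/Forall_mid|].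
  exists l'; split=> //; apply: iso_trans il'; apply: lsum_merge; exact: iso_refl.
exists l; split; last exact: iso_refl.
split=> //.
  apply/List.Forall_forall => V hV; have [l1 [l2 e]] := List.in_split V l hV.
  by apply: contrapT => nV; apply: ne; exists l1, V, l2.
by move=> l1 A B l2 e; apply: contrapT => nA; apply: na; exists l1, A, B, l2.
Qed.

Lemma rev_revK (l : seq binstr) : rev (map rev_str (rev (map rev_str l))) = l.
Proof.
rewrite map_rev revK -map_comp -[RHS]map_id; apply: eq_map => V /=; exact: rev_strK.
Qed.

Lemma Forall_rev_map (P Q : binstr -> Prop) l : (forall V, P V -> Q (rev_str V)) ->
  List.Forall P l -> List.Forall Q (rev (map rev_str l)).
Proof.
move=> PQ; elim=> //= V {}l PV _ IH; rewrite rev_cons -cats1; apply/List.Forall_app; split=> //.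
by constructor=> //; apply: PQ.
Qed.

Lemma norm_rev l : norm l -> norm (rev (map rev_str l)).
Proof.
move=> [h1 h2 h3]; split.
- by apply: Forall_rev_map h1 => V [b /mono_sum_rev h]; exists (~~ b).
- exact: Forall_rev_map h2.
move=> l1 A B l2 /(congr1 (fun l => rev (map rev_str l))); rewrite rev_revK map_cat rev_cat /= !rev_cons.
rewrite -!cats1 -!catA /= => /h3[n1 n2]; split=> -[gA [gB w]].
  by apply: n2; split; [exact: (mono_sum_rev gB)|split; [exact: (mono_sum_rev gA)|rewrite /rwf rev_strK]].
by apply: n1; split; [exact: (mono_sum_rev gB)|split; [exact: (mono_sum_rev gA)|]].
Qed.

Lemma limit_type_Xof X : CSB X -> limit_type X -> exists (S : binstr) (col : S -> bool),
  [/\ linear S, ~ has_dense S & iso X (Xof col)].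
Proof.
move=> cX [_ [S [L [/scatteredE[lS nS] hL /biemb_equi[XL LX]]]]].
pose col s := `[< iso (L s) omega >].
have hc s : iso (L s) (color (col s)).
  rewrite /col; case: asboolP => //= n; by case: (hL s).
exists S, col; split=> //; have iL : iso (osum L) (Xof col) by apply: iso_osum.
apply: iso_trans iL; apply: CSB_iso => //; apply: linear_osum => // s.
by apply: linear_iso (hc s) _; apply: linear_color.
Qed.

Lemma limit_pieces X : CSB X -> limit_type X -> has_nb X /\ exists l, norm l /\ iso X (lsum l).
Proof.
move=> cX ltX; have [S [col [lS nS iX]]] := limit_type_Xof cX ltX.
have lX := linear_Xof col lS.
split; first exact: has_nb_iso (iso_sym iX) (has_nb_Xof lS).
have [m [pi [h1 h2 h3]]] := piecewise_limit lS nS (CSB_transfer iX cX).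
pose pi' (p : Xof col) := pi (projT1 p).
have mono p q : prec p q -> (pi' p <= pi' q)%N.
  by move=> /osum_le[h|e]; [apply: h1|rewrite /pi' e].
have := lsum_fibers 0 m lX mono; set l := map _ _ => il.
have gl : List.Forall any_mono_sum l.
  rewrite /l; elim: (iota 0 m) => //= k s IH; constructor=> //.
  have [b hb] := h3 k; have hb' : mono_on col b (fun s => pi s = k) by apply: (mono_on_sub lS _ hb).
  exists b, (sub (fun s => pi s = k)); split; first exact: linear_sub.
    apply: iso_trans (reg_osum col (fun s => pi s = k) lS) _.
    apply: iso_osum; first exact: linear_sub.
    by move=> [t e] /=; rewrite (hb'.1 t e); apply: iso_refl.
  by have := mono_on_piece lS hb'; case: (b) => -[].
have [l' [nl' il']] := norm_exists gl; exists l'; split=> //.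
apply: iso_trans iX _; apply: iso_trans il'; apply: iso_trans il; apply: iso_subT => p.
by rewrite add0n leq0n; apply: h2.
Qed.

(** * Indecomposable orders and their copies along omega^* *)

(** The index can only decrease along [A], so it is constant from where it attains its minimum, and
    [A] embeds in that tail. *)
Lemma AI_index (A X : binstr) (P : X -> Prop) (idx : X -> nat) : AI A -> emb A (sub P) ->
  (forall x y, P x -> P y -> prec x y -> (idx y <= idx x)%N) ->
  exists k, emb A (sub (fun x => P x /\ idx x = k)).
Proof.
move=> AA /emb_subP[f [fP hf]] mono; have [[lA _] [a0] hA] := AA.
have [k [[a ka] mk]] : exists k, (exists a, idx (f a) = k) /\ forall m, (m < k)%N -> ~ exists a, idx (f a) = m.
  by apply: nat_least; exists (idx (f a0)), a0.
exists k; apply: emb_trans (hA a) _; apply: (emb_image hf) => x /(lle lA) ax; split=> //.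
case: ax => [ax|<- //]; apply/eqP; rewrite eqn_leq; apply/andP; split.
  by rewrite -ka; apply: mono => //; apply: hf.
by rewrite leqNgt; apply/negP => h; apply: (mk _ h); exists x.
Qed.

Lemma lwf_omega_star : lwf omega_star.
Proof.
move=> v P [[x hx] Px].
have le (y : tail v) : (sval y <= v)%N by case: y => y /= h; rewrite leqNgt; apply/negP.
have [|d [[y [Py ed]] md]] := @nat_least (fun d => exists y : tail v, P y /\ d = (v - sval y)%N).
  by exists (v - x)%N, (exist _ x hx).
exists y; split=> // z Pz zy; apply: (md (v - sval z)%N); last by exists z.
by rewrite ed; apply: ltn_sub2l => //; apply: leq_trans (le z).
Qed.

Lemma lwf_copies A : wo A -> lwf (copies A).
Proof. by move=> wA; apply: lwf_osum => //; [apply: linear_omega_star|apply: lwf_omega_star]. Qed.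

Lemma AI_nomin_copies (A : binstr) : inhabited A -> nomin (copies A).
Proof. by move=> [a] [k b]; exists (existT _ k.+1 a); apply/osumP; left; exact: ltnSn. Qed.

Lemma copies_idx (A : binstr) (p q : copies A) : prec p q -> (projT1 q <= projT1 p)%N.
Proof. by move=> /osum_le[/ltnW|->]. Qed.

Lemma Rec_copies A : wo A -> Rec (copies A) A.
Proof.
move=> [lA _] [k b]; apply/(@emb_subP _ (copies A)); exists (fun a => existT _ k.+1 a); split.
  by move=> a; apply/osumP; left; exact: ltnSn.
by move=> x y xy; apply/(osum_same _ _ linear_omega_star).
Qed.

(* An order between [copies A] and itself only differs from it by an end piece
   that the larger [B] absorbs. *)
Lemma copies_absorb A B G : AI A -> AI B -> ~ emb B A -> linear G -> lwf G -> nomin G -> inhabited G ->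
  emb G (copies A) -> Rec G A -> iso (oadd G B) (oadd (copies A) B).
Proof.
move=> AA AB BA lG wG nG iG [f hf] rA.
have wA := AI_wo AA.
pose idx g := projT1 (f g) : nat.
have idxm x y : prec x y -> (idx y <= idx x)%N by move/hf/copies_idx.
(* Every level of [idx] embeds in [A]; a full level is one isomorphic to [A]. Since [A] recurs in
   [G], there are infinitely many. *)
pose full k := emb A (sub (fun g => idx g = k)).
have up : forall K, exists g, (K <= idx g)%N.
  move=> K; apply: contrapT => /forallNP h; apply: (wf_nomin _ iG nG).
  have [a0] := AI_inh AA; have [m [_ hm]] := wA.2 (fun _ => True) (ex_intro _ a0 I).
  apply: wf_emb (@lwf_copies A wA (existT _ K m)).
  apply/(@emb_subP G (copies A)); exists f; split=> // g /copies_idx.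
  by have := h g; rewrite /idx => /negP; rewrite -ltnNge => h1 h2; move: (leq_trans h1 h2); rewrite ltnn.
have wlt K : wo (sub (fun g => (idx g < K)%N)).
  have [g hg] := up K; split; first exact: linear_sub.
  apply: wf_emb (wG g); apply: emb_subS => x hx xg; have := idxm _ _ xg.
  by rewrite leqNgt (leq_trans hx hg).
have idxP C (P : G -> Prop) : AI C -> emb C (sub P) -> exists k, emb C (sub (fun x => P x /\ idx x = k)).
  by move=> aC h; apply: AI_index aC h _ => x y _ _; apply: idxm.
have level k : emb (sub (fun g => idx g = k)) A.
  pose h (p : sub (fun g => idx g = k)) : A := projT2 (f (sval p)).
  exists h => -[x ex] [y ey] /= /hf; rewrite /h /=; move: ex ey; rewrite /idx.
  case: (f x) => m a; case: (f y) => n b /= em en h'; subst m n.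
  exact: (proj1 (osum_same _ _ linear_omega_star) h').
have fullinf K : exists k, (K <= k)%N /\ full k.
  have [g hg] := up K; have [k hk] := idxP _ _ AA (rA g).
  exists k; split; last by apply: emb_trans hk _; apply: emb_subS => x [].
  have [a0] := AI_inh AA; have /emb_subP[e [he _]] := hk.
  by have [h <-] := he a0; apply: leq_trans hg (idxm _ _ h).
have least K : exists k, [/\ (K <= k)%N, full k & forall m, (K <= m)%N -> (m < k)%N -> ~ full m].
  have [k [[h1 h2] h3]] := nat_least (fullinf K); exists k; split=> // m Km mk fm; exact: (h3 m mk).
have [s0 [_ full0 hs0]] := least 0%N.
have [k _|s [es0 _ hs]] := @dep_choice nat (fun _ => True)
    (fun a b => [/\ (a < b)%N, full b & forall m, (a < m)%N -> (m < b)%N -> ~ full m]) s0 _ I.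
  by have [k' h] := least k.+1; exists k'.
have fulls n : full (s n) by case: n => [|n]; [rewrite es0|case: (hs n)].
have sinc := inc_seq (fun n => let: And3 h _ _ := hs n in h).
have nfull C (P : G -> Prop) : AI C -> ~ emb C A -> ~ emb C (sub P).
  by move=> aC CA /(idxP _ _ aC)[k h]; apply: CA; apply: emb_trans (level k); apply: emb_trans h _; apply: emb_subS => x [].
have part (P : G -> Prop) : (forall g, P g -> ~ full (idx g)) -> ~ emb A (sub P).
  move=> h e; have [k hk] := idxP _ _ AA e; have [a0] := AI_inh AA.
  have /emb_subP[e' [he _]] := hk; have [Pa ka] := he a0; apply: (h _ Pa); rewrite ka.
  by apply: emb_trans hk _; apply: emb_subS => x [].
(* Larger indices come first in [G]: the levels strictly between two consecutive full ones precede
   level [s n], which absorbs them. *)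
have group n : iso (sub (fun g => (s n <= idx g < s n.+1)%N)) A.
  have [h1 h2 h3] := hs n.
  apply: iso_trans (@iso_sub_cut G (fun g => (s n < idx g < s n.+1)%N) (fun g => idx g = s n) _ lG _ _) _.
  - move=> g; split=> [/andP[]|[/andP[/ltnW-> ->]//|->]]; last by rewrite leqnn h1.
    by rewrite leq_eqVlt => /orP[/eqP->|->]; auto.
  - move=> x y /andP[hx _] hy; case: (ltot lG x y) => [//|[e|/idxm]]; first by rewrite e hy ltnn in hx.
    by rewrite hy leqNgt hx.
  have lev : iso (sub (fun g => idx g = s n)) A.
    apply: wo_antisym => //; last exact: fulls.
    by apply: wo_emb (level _) wA.2; apply: linear_sub.
  apply: iso_trans (iso_oadd (iso_refl _) lev) _; apply: AI_absorb => //.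
    split; first exact: linear_sub.
    by apply: wf_emb (wlt (s n.+1)).2; apply: emb_subS => g /andP[].
  by apply: part => g /andP[k1 k2]; apply: h3.
have sge n : (n <= s n)%N by elim: n => // n IH; apply: leq_ltn_trans IH (sinc n n.+1 (ltnSn n)).
pose hi (g : G) := (s 0 <= idx g)%N : Prop.
(* Only the levels below [s 0] are left over. They form a well order not containing [B], so [B]
   absorbs them. *)
have lohi : iso G (oadd (sub hi) (sub (fun g => (idx g < s 0)%N))).
  apply: iso_trans (@iso_subT G (fun _ => True) (fun _ => I)) _.
  apply: iso_sub_cut => // [g|x y hx hy].
    by split=> // _; rewrite /hi; case: (leqP (s 0) (idx g)); auto.
  case: (ltot lG x y) => [//|[e|/idxm]]; first by move: hx; rewrite e /hi leqNgt hy.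
  by rewrite leqNgt (leq_trans hy hx).
have hicop : iso (sub hi) (copies A).
  have /choice[j hj] : forall p : sub hi, exists n, (s n <= idx (sval p) < s n.+1)%N.
    move=> [g hg] /=; have [n [hn mn]] := @nat_least (fun n => (idx g < s n.+1)%N) (ex_intro _ (idx g) (sge _)).
    exists n; rewrite hn andbT; case: n hn mn => // n _ /(_ n (ltnSn n)) /negP; by rewrite -leqNgt.
  have juniq p n : (s n <= idx (sval p) < s n.+1)%N -> j p = n.
    move=> /andP[h1 h2]; have /andP[h3 h4] := hj p; case: (ltngtP (j p) n) => // h.
      have : (s (j p).+1 <= s n)%N by move: h; rewrite leq_eqVlt => /orP[/eqP->//|/sinc/ltnW].
      by move=> k; have := leq_trans h4 (leq_trans k h1); rewrite ltnn.
    have : (s n.+1 <= s (j p))%N by move: h; rewrite leq_eqVlt => /orP[/eqP->//|/sinc/ltnW].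
    by move=> k; have := leq_trans h2 (leq_trans k h3); rewrite ltnn.
  have lhi : linear (sub hi) by apply: linear_sub.
  apply: iso_trans (@iso_fibers (sub hi) omega_star j lhi linear_omega_star _) _.
    move=> p q pq; have := idxm _ _ pq => h /= k.
    have /andP[h1 h2] := hj p; have /andP[h3 h4] := hj q.
    have k' : (s (j p).+1 <= s (j q))%N by move: k; rewrite leq_eqVlt => /orP[/eqP->//|/sinc/ltnW].
    by have := leq_trans h2 (leq_trans k' (leq_trans h3 h)); rewrite ltnn.
  apply: iso_osum => [|n]; first exact: linear_omega_star.
  apply: iso_trans (group n).
  have gr (p : @sub (sub hi) (fun p => j p = n)) : (s n <= idx (sval (sval p)) < s n.+1)%N.
    by have := hj (sval p); rewrite (proj2_sig p).
  pose F (p : @sub (sub hi) (fun p => j p = n)) : sub (fun g => (s n <= idx g < s n.+1)%N) :=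
    exist (fun g : G => is_true (s n <= idx g < s n.+1)%N) (sval (sval p)) (gr p).
  apply: (@iso_surj _ _ F) => //.
  - exact: (linear_sub lhi).
  - exact: (linear_sub lG).
  move=> [g hg]; have hg' : hi g.
    rewrite /hi; apply: leq_trans (proj1 (andP hg)); case: (n) => // m; exact: ltnW (sinc _ _ _).
  by exists (exist _ (exist _ g hg') (juniq (exist _ g hg') n hg)); apply: eq_exist.
apply: iso_trans (iso_oadd (iso_trans lohi (iso_oadd hicop (iso_refl _))) (iso_refl _)) _.
apply: iso_trans (iso_sym (oaddA _ _ _)) _; apply: iso_oadd; first exact: iso_refl.
apply: AI_absorb => //; exact: nfull.
Qed.

Lemma class_L_iso X Y : iso X Y -> class_L X -> class_L Y.
Proof.
move=> XY [/woE wX [x] nX]; have [f hf] := iso_emb XY; split.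
- by apply/woE; apply: wo_iso (iso_sym XY) wX.
- by split; exact: f x.
- exact: nomax_iso XY nX.
Qed.

Lemma class_LI V : wo V -> inhabited V -> nomax V -> class_L V.
Proof. by move=> wV iV nV; split; [apply/woE|exact iV|exact nV]. Qed.

Lemma Rec_iso V W A : iso V W -> Rec V A -> Rec W A.
Proof.
move=> /iso_sym[g [[f gf fg] hg]] rV w; apply: emb_trans (rV (g w)) _.
have hf : strong_hom f by move=> x y; rewrite hg !fg.
by apply: (@emb_image _ _ _ f) => [x y /hf//|x]; rewrite hg fg.
Qed.

Lemma summand_rev X : summand X -> summand (rev_str X).
Proof.
have dbl (C : binstr -> Prop) Y : (exists Z, C Z /\ iso Y (rev_str Z)) -> exists Z, C Z /\ iso (rev_str Y) Z.
  by move=> [Z [CZ YZ]]; exists Z; split=> //; rewrite -[Z]rev_strK; apply: iso_rev.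
case=> [h|[/dbl[Z [CZ h]]|[h|/dbl[Z [CZ h]]]]].
- by right; left; exists X; split=> //; apply: iso_refl.
- by left; apply: class_L_iso (iso_sym h) CZ.
- by right; right; right; exists X; split=> //; apply: iso_refl.
- right; right; left; have [t [d [h1 h2 h3 h4 h5]]] := CZ; exists t, d; split=> //.
  exact: iso_trans h h5.
Qed.

Definition fs X := exists l, List.Forall summand l /\ iso X (lsum l).

Lemma fsE X : fs X <-> finite_sum_of summand X.
Proof. by rewrite finite_sum_of_lsum. Qed.

Lemma fs_iso X Y : iso X Y -> fs Y -> fs X.
Proof. by move=> h [l [hl hY]]; exists l; split=> //; apply: iso_trans h hY. Qed.

Lemma fs_summand X : summand X -> fs X.
Proof. by move=> h; exists [:: X]; split; [constructor|apply/iso_sym/lsum1]. Qed.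

Lemma fs_oadd A B : fs A -> fs B -> fs (oadd A B).
Proof.
move=> [l [hl iA]] [l' [hl' iB]]; exists (l ++ l'); split; first exact/List.Forall_app.
by apply: iso_trans (iso_oadd iA iB) _; apply/iso_sym/lsum_cat.
Qed.

Lemma fs_lsum l : List.Forall fs l -> fs (lsum l).
Proof.
elim=> [|A {}l hA _ IH] /=; last exact: fs_oadd.
by exists [::]; split=> //; apply: iso_refl.
Qed.

Lemma fs_rev X : fs X -> fs (rev_str X).
Proof.
move=> [l [hl iX]]; exists (rev (map rev_str l)); split; first exact: Forall_rev_map summand_rev hl.
by apply: iso_trans (iso_rev iX) _; apply: rev_lsum.
Qed.

Lemma fs_rev' X : fs (rev_str X) -> fs X.
Proof. by move/fs_rev; rewrite rev_strK. Qed.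

Lemma has_nb_gap1 P V S : nomax V -> inhabited V -> nomin S ->
  ~ has_nb (oadd P (oadd (oadd V one) S)).
Proof.
move=> nV [v0] nS; set X := oadd _ _; move=> /(_ (inr (inl (inr tt)) : X)) [[y [xy ny]]|[y [xy ny]]].
- case: y xy ny => [d /oadd_rl//|[[v /oadd_rr/oadd_ll/oadd_rl//|[] /oadd_rr/oadd_ll/oadd_rr//]|s _ ny]].
  have [t ts] := nS s; apply: (ny (inr (inr t))); split; apply/oadd_rr; first exact: oadd_lr.
  exact/oadd_rr.
- case: y xy ny => [d _ ny|[[v _ ny|[] /oadd_rr/oadd_ll/oadd_rr//]|s /oadd_rr/oadd_rl//]].
    apply: (ny (inr (inl (inl v0)))); split; first exact: oadd_lr.
    by apply/oadd_rr/oadd_ll; apply: oadd_lr.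
  have [w vw] := nV v; apply: (ny (inr (inl (inl w)))); split; apply/oadd_rr/oadd_ll; last exact: oadd_lr.
  exact/oadd_ll.
Qed.

Lemma linear_one : linear one.
Proof. by split; [split=> [[]|[]]|move=> [] []; right; left]. Qed.

Lemma AI_omega : AI omega.
Proof.
split; [exact: wo_nat|by split; exact 0%N|move=> a].
apply/(@emb_subP omega omega); exists (fun n : omega => (n + a)%N : omega); split=> [n /=|n m /=].
  by move=> h; move: (leq_ltn_trans (leq_addl n a) h); rewrite ltnn.
by rewrite ltn_add2r.
Qed.

(** The next piece has no minimum: of color false it never has one, and of color true it would be
    well ordered and could be merged with [V]. *)
Lemma norm_lsum_nomin l1 V l2 : norm (l1 ++ V :: l2) -> mono_sum true V -> nomin (lsum l2).
Proof.
move=> [h1 h2 h3] gV; case: l2 h1 h2 h3 => [|B l2] h1 h2 h3; first by case.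
have [n1 _] := h3 _ _ _ _ erefl.
have [_ _ /List.Forall_cons_iff[[b gB] _]] := proj1 (Forall_mid _ _ _ _) h1.
have [_ _ /List.Forall_cons_iff[iB _]] := proj1 (Forall_mid _ _ _ _) h2.
have nB : nomin B.
  case: b gB => gB; last exact: mono_sum_end gB.
  have [Q [_ _ wB]] := gB; case: (lwf_cases (mono_sum_linear gB) wB) => [w|[//]].
  by case: n1.
have [b0] := iB; move=> [c|c].
  by have [d dc] := nB c; exists (inl d); apply/oadd_ll.
by exists (inl b0); apply: oadd_lr.
Qed.

Section Absorb.
Variables (X : binstr) (l1 l2 : seq binstr) (V : binstr).
Hypotheses (cX : CSB X) (nbX : has_nb X) (nl : norm (l1 ++ V :: l2)).
Hypotheses (iX : iso X (lsum (l1 ++ V :: l2))) (gV : mono_sum true V) (nwV : ~ wf V).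

Lemma norm_linear : List.Forall (fun V => linear V) (l1 ++ V :: l2).
Proof.
have [h _ _] := nl; apply: List.Forall_impl h => W [b]; exact: mono_sum_linear.
Qed.

(* Otherwise a point without neighbours could be inserted just after [V]. *)
Lemma not_absorbing (v : V) : ~ emb V (below v).
Proof.
move=> Vv; have lV := mono_sum_linear gV.
pose P := lsum l1; pose Y := oadd P (oadd (oadd V one) (lsum l2)).
have e : iso X (oadd P (oadd V (lsum l2))) by apply: iso_trans iX (lsum_cat _ _).
have /Forall_mid[/List.Forall_forall p1 _ /List.Forall_forall p2] := norm_linear.
have lY : linear Y.
  apply: linear_oadd; first exact: linear_lsum.
  by apply: linear_oadd; [apply: linear_oadd => //; apply: linear_one|apply: linear_lsum].
have XY : emb X Y.
  apply: emb_trans (iso_emb e) _; apply: emb_oadd; first exact: emb_refl.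
  apply: emb_oadd; [exact: emb_inl|exact: emb_refl].
have YX : emb Y X.
  apply: emb_trans (iso_emb' e); apply: emb_oadd; first exact: emb_refl.
  apply: emb_oadd; last exact: emb_refl.
  apply: (@emb_oadd_into _ _ V (fun w => prec w v) (fun w => w = v)) => //.
    exact: emb_one.
  by move=> x y h ->.
have iV : inhabited V by [].
apply: (has_nb_gap1 (mono_sum_end gV) iV (norm_lsum_nomin nl gV)).
exact: has_nb_iso (CSB_iso cX lY XY YX) nbX.
Qed.

Lemma piece_nomin : nomin V /\ inhabited V.
Proof.
have [Q [_ _ wV]] := gV; by case: (lwf_cases (mono_sum_linear gV) wV).
Qed.

Lemma piece_lwf : lwf V.
Proof. by have [Q [_ _ wV]] := gV. Qed.

(** A point below the first point of a copy of omega lies in an earlier copy, which is then entirely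
    below. *)
Lemma Rec_omega : Rec V omega.
Proof.
have [nV _] := piece_nomin; have [Q [lQ iV _]] := gV.
apply: (Rec_iso (iso_sym iV)) => -[q a].
have [[q' b] h] := nomin_iso iV nV (existT _ q (0%N : omega)).
have q'q : prec q' q.
  case: (osum_le h) => //= e; subst q'.
  by have := proj1 (osum_same _ _ lQ) h.
apply/(@emb_subP omega (osum (fun _ : Q => omega))); exists (fun n => existT _ q' n); split.
  by move=> n; apply/osumP; left.
by move=> x y xy; apply/(osum_same _ _ lQ).
Qed.

End Absorb.

(** * Strictly increasing sequences of indecomposables *)

Lemma osum_ltI (S : binstr) (L : S -> binstr) (p q : osum L) : prec (projT1 p) (projT1 q) -> prec p q.
Proof. by case: p q => s a [t b] h; apply/osumP; left. Qed.

Lemma emb_block (S : binstr) (L : S -> binstr) k : linear S ->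
  emb (@sub (osum L) (fun p => projT1 p = k)) (L k).
Proof.
move=> lS.
have h (p : @sub (osum L) (fun p => projT1 p = k)) : exists a : L k, sval p = existT _ k a.
  by case: p => -[s a] /= e; subst s; exists a.
exists (fun p => sval (cid (h p))) => p q; case: cid => a ea; case: cid => b eb pq /=.
have : prec (sval p) (sval q) by [].
by rewrite ea eb => /(proj1 (osum_same _ _ lS)).
Qed.

Section Germ.
Variables (A : nat -> binstr).
Hypotheses (hA : forall n, AI (A n)) (hlt : forall n, ~ emb (A n.+1) (A n)) (nA0 : nomax (A 0)).

Lemma A_emb i j : (i <= j)%N -> emb (A i) (A j).
Proof.
elim: j => [|j IH]; first by rewrite leqn0 => /eqP->; apply: emb_refl.
rewrite leq_eqVlt => /orP[/eqP->|/IH h]; first exact: emb_refl.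
by apply: emb_trans h _; case: (wo_total (AI_wo (hA j)) (AI_wo (hA j.+1))) => // /hlt.
Qed.

Lemma A_lt i j : emb (A i) (A j) -> (i <= j)%N.
Proof.
by move=> h; rewrite leqNgt; apply/negP => /A_emb ji; apply: (hlt (n := j)); apply: emb_trans ji h.
Qed.

(** Otherwise [A j] would embed in [A i] + [A i], hence in [A i]. *)
Lemma A_double i j : (i < j)%N -> emb (oadd (A i) (A i)) (A j).
Proof.
move=> ij; case: (wo_total (wo_oadd (AI_wo (hA i)) (AI_wo (hA i))) (AI_wo (hA j))) => // h.
by case: (AI_split (hA j) h) => /A_lt; rewrite leqNgt ij.
Qed.

(** The [A n] are cofinal among the well orders that recur in [U]. Such a coinitial end can be
    exchanged for any [Wseq e] without leaving the bi-embeddability class ([repl_equi]). *)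
Definition similar (U : binstr) : Prop := [/\ linear U, lwf U, nomin U, inhabited U &
  forall a, wo a -> (Rec U a <-> exists n, emb a (A n))].

(* Prescribes that near the coinitial end the terms [A n.*2] occur with multiplicity
   one, as they do in [Wseq double] but not in [Wseq dodd]. *)
Definition good (U : binstr) : Prop := similar U /\ forall g : U, exists N, forall n, (N <= n)%N ->
  exists y : U, emb (A n.*2) (ivl y g) /\ ~ emb (oadd (A n.*2) (A n.*2)) (ivl y g).

Section W.
Variables (e : nat -> nat).
Hypothesis (he : forall i j, (i < j)%N -> (e i < e j)%N).

Definition Wseq : binstr := @osum omega_star (fun n => A (e n)).

Lemma e_ge n : (n <= e n)%N.
Proof. by elim: n => // n IH; apply: leq_ltn_trans IH (he (ltnSn n)). Qed.

Lemma linear_Wseq : linear Wseq.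
Proof. by apply: linear_osum => [|n]; [apply: linear_omega_star|case: (hA (e n)) => -[]]. Qed.

Lemma lwf_Wseq : lwf Wseq.
Proof.
by apply: lwf_osum => [| |n]; [apply: linear_omega_star|apply: lwf_omega_star|apply: AI_wo].
Qed.

Lemma Wseq_idx (p q : Wseq) : prec p q -> (projT1 q <= projT1 p)%N.
Proof. by move=> /osum_le[/ltnW|->]. Qed.

Lemma Wseq_inh n : exists p : Wseq, (projT1 p : nat) = n.
Proof. by have [a] := AI_inh (hA (e n)); exists (existT _ n a). Qed.

Lemma nomin_Wseq : nomin Wseq.
Proof.
move=> [n a]; have [b] := AI_inh (hA (e n.+1)); exists (existT _ n.+1 b).
by apply/osumP; left; exact: ltnSn.
Qed.

Lemma Wseq_level n : emb (A (e n)) (@sub Wseq (fun p => (projT1 p : nat) = n)).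
Proof.
apply/(@emb_subP _ Wseq); exists (fun a => existT _ n a); split=> // x y xy.
exact/(osum_same _ _ linear_omega_star).
Qed.

Lemma Rec_Wseq k : Rec Wseq (A k).
Proof.
move=> v; set j := maxn (projT1 v : nat).+1 k.
apply: emb_trans (A_emb (leq_trans (leq_maxr _ k) (e_ge j))) _.
apply: emb_trans (Wseq_level j) _; apply: emb_subS => p ep; apply: osum_ltI.
by rewrite /= ep; apply: leq_maxl.
Qed.

Lemma emb_Wseq_index C (P : Wseq -> Prop) : AI C -> emb C (sub P) ->
  exists k, emb C (sub (fun p => P p /\ (projT1 p : nat) = k)) /\ emb C (A (e k)).
Proof.
move=> hC h; have [|k hk] := @AI_index C Wseq P (fun p => projT1 p) hC h; first by move=> x y _ _; apply: Wseq_idx.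
exists k; split=> //; apply: emb_trans hk _.
apply: emb_trans _ (@emb_block omega_star (fun n => A (e n)) k linear_omega_star).
by apply: emb_subS => p [].
Qed.

Lemma similar_Wseq : similar Wseq.
Proof.
have [v _] := Wseq_inh 0; split=> [| | |//|a wa].
- exact: linear_Wseq.
- exact: lwf_Wseq.
- exact: nomin_Wseq.
split=> [ra|[n an]]; last exact: Rec_down an (Rec_Wseq n).
have [w [_ aw]] := Rec_ivl v linear_Wseq nomin_Wseq wa ra.
set m := (e (projT1 w)).+1; exists m.
case: (wo_total wa (AI_wo (hA m))) => // h; exfalso.
have [k [hk Ak]] := emb_Wseq_index (hA m) (emb_trans h aw).
have kw : (k <= projT1 w)%N.
  have [a0] := AI_inh (hA m); have /emb_subP[f [fP _]] := hk.
  have [[nw _] <-] := fP a0; case: (lle linear_Wseq nw) => [/Wseq_idx//|<-//].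
have : (e k <= e (projT1 w))%N by move: kw; rewrite leq_eqVlt => /orP[/eqP->//|/he/ltnW].
by have := A_lt Ak; rewrite leqNgt /m ltnS => /negP n1 n2; apply: n1.
Qed.

End W.

Lemma similar_germ U : similar U -> exists x0 : U, forall y x, ~ prec x0 x -> Rec U (ivl y x).
Proof. by move=> [lU wU nU iU _]; apply: Rec_germ. Qed.

Lemma repl_equi e (U : binstr) (x0 : U) : (forall i j, (i < j)%N -> (e i < e j)%N) -> similar U ->
  (forall y x, ~ prec x0 x -> Rec U (ivl y x)) -> equi U (oadd (Wseq e) (tail x0)).
Proof.
move=> he [lU wU nU iU rU] h; have cut := iso_below_tail x0 lU.
have [v _] := Wseq_inh e 0.
split.
  apply: emb_trans (iso_emb cut) _; apply: emb_oadd; last exact: emb_refl.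
  have rW : Rec (Wseq e) (below x0).
    have hR y x : ~ prec x0 x -> Rec (Wseq e) (ivl y x).
      move=> nx; have [n hn] := proj1 (rU _ (lwf_ivl y x lU wU)) (h y x nx).
      exact: (Rec_down hn (@Rec_Wseq e he n)).
    exact: (Rec_below lU wU nU (linear_Wseq e) (@nomin_Wseq e) hR).
  exact: emb_trans (rW v) (emb_sub _).
apply: emb_trans (iso_emb' cut); apply: emb_oadd; last exact: emb_refl.
have rA n : Rec U (A (e n)).
  by apply/(rU _ (AI_wo (hA (e n)))); exists (e n); apply: emb_refl.
exact: (@greedy (fun n => A (e n)) U lU nU (fun n => AI_wo (hA (e n))) rA).
Qed.

(** Recurrence concerns the coinitial end only, so it passes between an order and its nonempty
    initial segments. *)
Lemma Rec_initial (U : binstr) (F : U -> Prop) B : linear U -> (forall x y, F y -> prec x y -> F x) ->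
  inhabited (sub F) -> Rec (sub F) B <-> Rec U B.
Proof.
move=> lU hF [[d0 F0]]; split=> [r u|r [d Fd]].
  have [d [Fd du]] : exists d, F d /\ ~ prec u d.
    case: (pselect (F u)) => Fu; first by exists u; split=> //; apply: lirr.
    by exists d0; split=> // h; apply: Fu; apply: hF h.
  apply: emb_trans (r (exist _ d Fd)) _; apply: (@emb_image (sub F) U _ sval) => // -[x Fx] /= xd.
  exact: (ltle lU xd du).
apply: emb_trans (r d) _; pose f (x : below d) : sub F := exist _ (sval x) (hF _ _ Fd (proj2_sig x)).
by apply/(@emb_subP _ (sub F)); exists f; split=> // -[].
Qed.

Lemma similar_initial (U : binstr) (F : U -> Prop) : (forall x y, F y -> prec x y -> F x) ->
  inhabited (sub F) -> similar U -> similar (sub F).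
Proof.
move=> hF iF [lU wU nU iU rU]; split=> //.
- exact: linear_sub.
- by apply: lwf_emb wU => //; [apply: linear_sub|apply: emb_sub].
- by move=> [x Fx]; have [y yx] := nU x; exists (exist _ y (hF _ _ Fx yx)).
- by move=> a /rU h; rewrite Rec_initial.
Qed.

Lemma similar_extend (U : binstr) (F : U -> Prop) : (forall x y, F y -> prec x y -> F x) ->
  linear U -> lwf U -> similar (sub F) -> similar U.
Proof.
move=> hF lU wU [_ _ nF iF rF]; have [[d0 F0]] := iF; split=> //.
- move=> u; case: (pselect (F u)) => Fu; first by have [[y Fy] yu] := nF (exist _ u Fu); exists y.
  exists d0; case: (ltot lU d0 u) => [//|[e|h]]; first by rewrite -e in Fu.
  by case: Fu; apply: hF h.
- by move=> a /rF; rewrite Rec_initial.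
Qed.

Lemma ivl_lt (B U : binstr) (y g : U) : linear U -> inhabited B -> emb B (ivl y g) -> prec y g.
Proof. by move=> lU [b] [f _]; case: (f b) => x [h1 h2]; apply: (lelt lU h1 h2). Qed.

Lemma good_initial (U : binstr) (F : U -> Prop) : (forall x y, F y -> prec x y -> F x) ->
  inhabited (sub F) -> good U -> good (sub F).
Proof.
move=> hF iF [sU gU]; have [lU _ _ _ _] := sU; split; first exact: similar_initial.
move=> [g Fg]; have [N hN] := gU g; exists N => n /hN[y [h1 h2]].
have yg := ivl_lt lU (AI_inh (hA n.*2)) h1.
exists (exist _ y (hF _ _ Fg yg)); split.
  apply: emb_trans h1 _.
  pose f (x : ivl y g) : sub F := exist _ (sval x) (hF _ _ Fg (proj2_sig x).2).
  by apply/(@emb_subP _ (sub F)); exists f; split=> // -[x []].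
move=> h; apply: h2; apply: emb_trans h _; apply: (@emb_image (sub F) U _ sval) => // -[x Fx] /=.
Qed.

Lemma good_iso U U' : iso U U' -> good U -> good U'.
Proof.
move=> iU; have [f [[g fg gf] hf]] := iU; have hg : strong_hom g by move=> x y; rewrite hf !gf.
move=> [[lU wU nU [u0] rU] gU]; have lU' := linear_iso (iso_sym iU) lU; split.
  split=> //.
  - by apply: lwf_emb wU => //; apply: iso_emb'.
  - exact: nomin_iso iU nU.
  - by split; exact: f u0.
  - move=> a /rU h; rewrite -h; split=> r; [exact: Rec_iso (iso_sym iU) r|exact: Rec_iso iU r].
have fw (y z : U) : emb (ivl y z) (ivl (f y) (f z)).
  apply: (@emb_image _ _ _ f) => [a b /hf//|a [h1 h2]]; split; [by move/hf|exact/hf].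
have bw (y z : U) : emb (ivl (f y) (f z)) (ivl y z).
  apply: (@emb_image _ _ _ g) => [a b /hg//|a]; rewrite -{1 2}(gf a) -!hf => -[h1 h2]; by split.
move=> z; have [N hN] := gU (g z); exists N => n /hN[y [h1 h2]]; exists (f y); rewrite -[z]gf.
split; first exact: emb_trans h1 (fw _ _).
by move=> h; apply: h2; apply: emb_trans h (bw _ _).
Qed.

Definition convex (Y : binstr) (D : Y -> Prop) := forall x y z, D x -> D z -> prec x y -> prec y z -> D y.

(** An isomorphism invariant that can be located in a single summand of a finite sum; it tells the
    even exchange from the odd one. *)
Definition has_good Y := exists D, @convex Y D /\ good (sub D).

Lemma has_good_iso Y Y' : iso Y Y' -> has_good Y -> has_good Y'.
Proof.
move=> [f [[g fg gf] hf]] [D [cD gD]]; have hg : strong_hom g by move=> x y; rewrite hf !gf.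
exists (fun y => D (g y)); split.
  by move=> x y z Dx Dz /hg xy /hg yz; apply: cD Dx Dz xy yz.
apply: good_iso gD.
have Df (p : sub D) : D (g (f (sval p))) by rewrite fg; case: p.
exists (fun p => exist (fun y => D (g y)) (f (sval p)) (Df p) : sub (fun y => D (g y))); split; last first.
  by move=> [x Dx] [y Dy]; apply: hf.
exists (fun q : sub (fun y => D (g y)) => exist D (g (sval q)) (proj2_sig q) : sub D).
  by move=> [x Dx]; apply: eq_exist => /=.
by move=> [x Dx]; apply: eq_exist => /=.
Qed.

(** If the good set meets [P], its part there is a nonempty initial segment and is still good;
    otherwise all of it lies in [S]. *)
Lemma has_good_oadd P S : has_good (oadd P S) -> has_good P \/ has_good S.
Proof.
move=> [D [cD gD]]; have lD : linear (sub D) by case: gD => -[].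
case: (pselect (exists a, D (inl a))) => [[a0 Da0]|n].
  left; exists (fun a => D (inl a)); split.
    by move=> x y z Dx Dz xy yz; apply: cD Dx Dz _ _; apply/oadd_ll.
  pose F (p : sub D) := if sval p is inl _ then True else False.
  have hF x y : F y -> prec x y -> F x.
    by case: x y => -[x|x] hx [[y|y] hy] //= _ h; case: (oadd_rl h).
  apply: good_iso (good_initial hF _ gD); last by split; exists (exist _ (inl a0) Da0).
  have lF : linear (sub F) by apply: linear_sub.
  apply: iso_sym; pose f (p : sub (fun a => D (inl a))) : sub F :=
    exist F (exist D (inl (sval p)) (proj2_sig p)) I.
  have lP : linear (sub (fun a => D (inl a))).
    split; first by split=> [[x hx] h|[x hx] [y hy] [z hz] h1 h2]; [
      apply: (@lirr _ lD (exist _ (inl x) hx)); apply/oadd_ll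
      |apply/(@oadd_ll P S); apply: (@ltr _ lD (exist _ (inl y) hy) (exist _ (inl x) hx) (exist _ (inl z) hz)); apply/oadd_ll].
    move=> [x hx] [y hy]; case: (ltot lD (exist _ (inl x) hx) (exist _ (inl y) hy)) => [/(@oadd_ll P S)|[[e]|/(@oadd_ll P S)]]; auto.
    by right; left; apply: eq_exist.
  apply: (@iso_surj _ _ f) => //.
    by move=> [x hx] [y hy] h; apply/(@oadd_ll P S).
  move=> [[[x|x] hx] Fx] //; exists (exist _ x hx); rewrite /f; apply: eq_exist; exact: eq_exist.
right; exists (fun b => D (inr b)); split.
  by move=> x y z Dx Dz xy yz; apply: cD Dx Dz _ _; apply/oadd_rr.
apply: good_iso gD.
have nl p : D p -> exists b, p = inr b by case: p => [a Da|b _]; [case: n; exists a|exists b].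
apply: iso_sym; pose f (p : sub (fun b => D (inr b))) : sub D := exist D (inr (sval p)) (proj2_sig p).
exists f; split; last by move=> [x hx] [y hy]; apply: (iff_sym (@oadd_rr P S x y)).
have sf (q : sub D) : exists p, f p = q.
  by case: q => q Dq; have [b eb] := nl q Dq; subst q; exists (exist _ b Dq); apply: eq_exist.
exists (fun q => sval (cid (sf q))) => q; last by case: cid.
case: cid => p /=; case: p q => [x hx] [y hy] /(congr1 sval) /= [e]; exact: eq_exist.
Qed.

Lemma has_good_inl P S : has_good P -> has_good (oadd P S).
Proof.
move=> [D [cD gD]]; pose D' (p : oadd P S) := match p with inl a => D a | inr _ => False end.
exists D'; split.
  move=> [x|x] [y|y] [z|z] //= Dx Dz; try by move/oadd_rl + by move=> _ /oadd_rl.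
  by move=> /oadd_ll xy /oadd_ll; apply: cD xy.
apply: good_iso gD; exists (fun p : sub D => exist D' (inl (sval p)) (proj2_sig p) : sub D'); split; last first.
  by move=> [x hx] [y hy]; apply: (iff_sym (@oadd_ll P S x y)).
exists (fun q : sub D' => match q with exist (inl a) h => exist D a h |
  exist (inr _) h => match h with end end : sub D).
  by move=> [x hx].
by move=> [[x|x] hx].
Qed.

Lemma has_good_inr P S : has_good S -> has_good (oadd P S).
Proof.
move=> [D [cD gD]]; pose D' (p : oadd P S) := match p with inr a => D a | inl _ => False end.
exists D'; split.
  move=> [x|x] [y|y] [z|z] //= Dx Dz; try by move/oadd_rl + by move=> _ /oadd_rl.
  by move=> /oadd_rr xy /oadd_rr; apply: cD xy.
apply: good_iso gD; exists (fun p : sub D => exist D' (inr (sval p)) (proj2_sig p) : sub D'); split; last first.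
  by move=> [x hx] [y hy]; apply: (iff_sym (@oadd_rr P S x y)).
exists (fun q : sub D' => match q with exist (inr a) h => exist D a h |
  exist (inl _) h => match h with end end : sub D).
  by move=> [x hx].
by move=> [[x|x] hx].
Qed.

Lemma has_good_lsum l U : List.In U l -> has_good U -> has_good (lsum l).
Proof.
by elim: l => //= B l IH [->|h] hU; [apply: has_good_inl|apply: has_good_inr; apply: IH].
Qed.

Lemma has_good_lsum_inv l : has_good (lsum l) -> exists2 U, List.In U l & has_good U.
Proof.
elim: l => [[D [_ [[_ _ _ [[[]]]]]]]|B l IH /= /has_good_oadd[h|/IH[U hU h]]]; first by exists B; [left|].
by exists U; [right|].
Qed.

Lemma has_good_wf U : wf U -> ~ has_good U.
Proof.
by move=> wU [D [_ [[_ _ nD iD _] _]]]; apply: (wf_nomin _ iD nD); apply: wf_emb wU; apply: emb_sub.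
Qed.

(** A good set contains a copy of [A 0] below one of its points, while in [U] nothing without a
    maximum lies below a point. *)
Lemma has_good_rrwf U : linear U -> rrwf U -> ~ has_good U.
Proof.
move=> lU wU [D [_ [[_ _ _ [d] rD] _]]].
have r0 : Rec (sub D) (A 0) by apply/(rD _ (AI_wo (hA 0))); exists 0%N; apply: emb_refl.
apply: (@rwf_nomax (A 0)) nA0; last exact: AI_inh.
apply: wf_emb (emb_rev (r0 d)) _; apply: wf_emb _ (wU (sval d)).
pose f (p : rev_str (below d)) : tail (sval d : rev_str U) :=
  exist (fun x => ~ @prec (rev_str U) x (sval d)) (sval (sval p)) (lasym lU (proj2_sig p)).
by exists f.
Qed.

Lemma has_good_lwf U : linear U -> lwf U -> has_good U ->
  exists F : U -> Prop, [/\ forall x y, F y -> prec x y -> F x, inhabited (sub F) & good (sub F)].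
Proof.
move=> lU wU [D [cD gD]]; have [[_ _ nD iD _] _] := gD; exists D; split=> // x y Dy xy.
apply: contrapT => nx; apply: (wf_nomin _ iD nD); apply: wf_emb _ (wU x).
apply: emb_subS => z Dz zx; apply: nx; exact: cD Dz Dy zx xy.
Qed.

(** With [y] the first point of block n, where n exceeds the block number of [g], the interval [y,
    g) consists of block n and of parts of later, smaller blocks, in which [A n.*2] does not
    embed. *)
Lemma good_even : good (Wseq double).
Proof.
have he i j : (i < j)%N -> (i.*2 < j.*2)%N by rewrite ltn_double.
split; first exact: similar_Wseq.
move=> g; exists (projT1 g).+1 => n hn; set B := A n.*2.
have [a0] := AI_inh (hA n.*2); have [m [_ hm]] := (AI_wo (hA n.*2)).2 (fun _ => True) (ex_intro _ a0 I).
pose mk a : Wseq double := existT (fun n => dom (A n.*2)) n a.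
have lW := linear_Wseq double.
exists (mk m); split.
  apply/(@emb_subP _ (Wseq double)); exists mk; split=> [a|a b ab]; last exact/(osum_same _ _ linear_omega_star).
  split; first by move/(proj1 (osum_same _ _ linear_omega_star)); apply: hm.
  by case: (g) hn => k b hn; apply/osumP; left.
move=> /(@emb_subP _ (Wseq double))[f [fP hf]].
pose R (p : Wseq double) := (~ prec p (mk m) /\ prec p g) /\ exists b, p = f (inr b).
have le_n p : ~ prec p (mk m) -> (projT1 p <= n)%N by case/(lle lW) => [/Wseq_idx|<-].
have [k [hk Bk]] : exists k, emb B (sub (fun p => R p /\ (projT1 p : nat) = k)) /\ emb B (A k.*2).
  apply: (emb_Wseq_index (hA n.*2)); apply/(@emb_subP B (Wseq double)); exists (fun b => f (inr b)); split.
    by move=> b; split; [apply: fP|exists b].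
  by move=> x y xy; apply: hf; apply/oadd_rr.
have [nk] : (n <= k)%N by have := A_lt Bk; rewrite leq_double.
have /(@emb_subP B (Wseq double))[h [hP _]] := hk; have [[[q1 q2] [b eb]] ek] := hP a0.
(* The second copy of [A n.*2] thus meets block n, at [f (inr b)]. The whole first copy precedes
   that point and so lies in block n too; [A n.*2] plus a point would embed in [A n.*2]. *)
have kn : k = n by apply/eqP; rewrite eqn_leq -{1}ek le_n.
apply: (@wo_nemb_add B one (AI_wo (hA n.*2))); first by split; exact tt.
apply: emb_trans _ (@emb_block omega_star (fun n => A n.*2) n linear_omega_star).
apply/(@emb_subP _ (Wseq double)).
exists (fun p : oadd B one => match p with inl a => f (inl a) | inr _ => f (inr b) end); split.
  move=> [a|_]; last by rewrite -eb ek.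
  apply/eqP; rewrite eqn_leq le_n /=; last by case: (fP (inl a)).
  by rewrite -{1}kn -ek eb; apply: Wseq_idx; apply: hf; apply: oadd_lr.
move=> [x|[]] [y|[]] xy.
- by apply: hf; apply/oadd_ll; move/oadd_ll: xy.
- by apply: hf; apply: oadd_lr.
- by case: (oadd_rl xy).
- by move/oadd_rr: xy.
Qed.

Definition dodd n := n.*2.+1.

(** If [A n.*2] fits between [y] and [g], then [y] lies in a block m >= n. The tail of that block
    from [y] contains [A (dodd m)], hence two copies of [A n.*2]. *)
Lemma not_has_good_odd : ~ has_good (Wseq dodd).
Proof.
have he i j : (i < j)%N -> (dodd i < dodd j)%N by rewrite /dodd ltnS ltn_double.
have lW := linear_Wseq dodd.
move=> /(has_good_lwf lW (@lwf_Wseq dodd))[F [hF [[g Fg]] [sF gF]]].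
have [N hN] := gF (exist _ g Fg).
have [[y Fy] [h1 []]] := hN (maxn N (projT1 g : nat).+1) (leq_maxl _ _).
set n := maxn _ _ in h1 *; have gn : (projT1 g < n)%N by apply: leq_maxr.
have h1' : emb (A n.*2) (ivl y g).
  by apply: emb_trans h1 _; apply: (@emb_image (sub F) _ _ sval) => // -[x Fx].
have [k [hk Ak]] := emb_Wseq_index (hA n.*2) h1'.
have nk : (n <= k)%N.
  rewrite leqNgt; apply/negP => kn; have := A_lt Ak; rewrite /dodd leqNgt => /negP; apply.
  by rewrite -[k.*2.+2]doubleS leq_double.
have ky : (k <= projT1 y)%N.
  have [a0] := AI_inh (hA n.*2); have /(@emb_subP _ (Wseq dodd))[f [fP _]] := hk.
  by have [[nw _] <-] := fP a0; case: (lle lW nw) => [/Wseq_idx//|<-//].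
case: y Fy h1 h1' hk ky => m b Fy h1 h1' hk /= km.
have nm := leq_trans nk km.
apply: emb_trans (@A_double n.*2 (dodd m) _) _; first by rewrite /dodd ltnS leq_double.
have [_ _ /(_ b)h] := hA (dodd m); apply: emb_trans h _.
have lt a : prec (existT _ m a : Wseq dodd) g.
  by apply: osum_ltI; apply: leq_trans gn nm.
pose f (p : tail b) : sub F := exist F (existT _ m (sval p)) (hF _ _ Fg (lt (sval p))).
apply/(@emb_subP _ (sub F)); exists f; split=> [[a ab]|x y xy].
  split; last exact: lt.
  by move=> h'; apply: (ab); apply: (proj1 (osum_same _ _ linear_omega_star) h').
exact (proj2 (@osum_same omega_star (fun n => A (dodd n)) m (sval x) (sval y) linear_omega_star) xy).
Qed.

Definition repl (e : nat -> nat) (U : binstr) : binstr :=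
  match pselect (similar U) with
  | left h => oadd (Wseq e) (tail (sval (cid (similar_germ h)))) | right _ => U end.

Lemma repl_equi' e U : (forall i j, (i < j)%N -> (e i < e j)%N) -> equi U (repl e U).
Proof.
move=> he; rewrite /repl; case: pselect => [h|_]; last by split; apply: emb_refl.
by apply: repl_equi => //; case: cid.
Qed.

Lemma repl_linear e U : linear U -> linear (repl e U).
Proof.
move=> lU; rewrite /repl; case: pselect => // h; apply: linear_oadd; [exact: linear_Wseq|exact: linear_sub].
Qed.

Lemma lsum_repl e l : (forall i j, (i < j)%N -> (e i < e j)%N) ->
  equi (lsum l) (lsum (map (repl e) l)).
Proof.
move=> he; elim: l => [|U l [h1 h2]] /=; first by split; apply: emb_refl.
by have [h3 h4] := repl_equi' U he; split; apply: emb_oadd.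
Qed.

(* The even and the odd modification are bi-embeddable with the same order, but
   only the former realizes the multiplicities prescribed by [good]. *)
Lemma no_similar X l V : CSB X -> iso X (lsum l) -> List.Forall (fun U => linear U /\ (lwf U \/ rrwf U)) l ->
  List.In V l -> ~ similar V.
Proof.
move=> cX iX hl hV sV.
have lin e : linear (lsum (map (repl e) l)).
  apply: linear_lsum => W /List.in_map_iff[U [<- hU]]; apply: repl_linear.
  by have /List.Forall_forall/(_ U hU)[] := hl.
have isoX e : (forall i j, (i < j)%N -> (e i < e j)%N) -> iso X (lsum (map (repl e) l)).
  move=> he; have [h1 h2] := lsum_repl l he; apply: CSB_iso => //.
    exact: emb_trans (iso_emb iX) h1.
  exact: emb_trans h2 (iso_emb' iX).
have ie : iso X (lsum (map (repl double) l)) by apply: isoX => i j; rewrite ltn_double.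
have io : iso X (lsum (map (repl dodd) l)) by apply: isoX => i j; rewrite /dodd ltnS ltn_double.
have : has_good (lsum (map (repl dodd) l)).
  apply: has_good_iso (iso_trans (iso_sym ie) io) _; apply: (@has_good_lsum _ (repl double V)); first exact: List.in_map.
  rewrite /repl; case: pselect => // h; apply: has_good_inl; exists (fun _ => True); split=> //.
  exact: good_iso (iso_subT _) good_even.
(* The good part would lie in one summand. An exchanged summand has none, and an unchanged one has
   none unless it is similar, in which case it would have been exchanged. *)
move=> /has_good_lsum_inv[W /List.in_map_iff[U [<- hU]]].
have /List.Forall_forall/(_ U hU)[lU wU] := hl.
rewrite /repl; case: pselect => [h|nU].
  case/has_good_oadd => [/not_has_good_odd//|]; apply: has_good_wf; have [_ w _ _ _] := h; exact: w.
case: wU => [wU /(has_good_lwf lU wU)[F [hF _ [sF _]]]|wU]; last exact: has_good_rrwf.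
by apply: nU; apply: similar_extend sF.
Qed.

End Germ.

(** * Each piece is a finite sum of summands *)

Lemma fs_AI l : List.Forall AI l -> List.Forall nomax l -> fs (lsum l).
Proof.
move=> h1 h2; apply: fs_lsum; apply/List.Forall_forall => C hC.
have aiC : AI C by move/List.Forall_forall: h1; apply.
apply: fs_summand; left; apply: class_LI; [exact: AI_wo|exact: AI_inh|].
by move/List.Forall_forall: h2; apply.
Qed.

Section PieceFs.
Variables (X : binstr) (l1 l2 : seq binstr) (V : binstr).
Hypotheses (cX : CSB X) (nbX : has_nb X) (nl : norm (l1 ++ V :: l2)).
Hypotheses (iX : iso X (lsum (l1 ++ V :: l2))) (gV : mono_sum true V) (nwV : ~ wf V).

Let lV : linear V := mono_sum_linear gV.
Let wV : lwf V := piece_lwf gV.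
Let nV : nomin V := (piece_nomin gV nwV).1.
Let iV : inhabited V := (piece_nomin gV nwV).2.

(** [B] is the first block of the Cantor normal form of [tail x0]. If it recurred in [V], so would
    the later, smaller blocks and all of [V], against [not_absorbing]. *)
Lemma piece_decomp (x0 : V) : (forall y x, ~ prec x0 x -> Rec V (ivl y x)) -> exists B l,
  [/\ AI B, ~ Rec V B, List.Forall AI l, List.Forall nomax l &
      iso V (oadd (oadd (below x0) B) (lsum l))].
Proof.
move=> hx; have wt : wo (tail x0) by split; [exact: linear_sub|exact: wV].
have nt : nomax (tail x0).
  move=> [a ha]; have [b ab] := mono_sum_end gV a.
  by exists (exist _ b (fun h => ha (ltr lV ab h))).
have [l [hl il srt]] := cnf wt.
have hn := cnf_nomax il hl srt nt.
have nrec : ~ List.Forall (Rec V) l.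
  move=> hr; have wl : List.Forall wo l by apply: List.Forall_impl hl => C; apply: AI_wo.
  have rt : Rec V (tail x0) by apply: Rec_down (iso_emb il) _; apply: Rec_lsum.
  have [v] := iV; have [w [wv hw]] := Rec_ivl v lV nV wt rt.
  apply: (@not_absorbing X l1 l2 V cX nbX nl iX gV v).
  apply: emb_trans (iso_emb (iso_below_tail x0 lV)) _.
  have rb : Rec V (below x0) by apply: (@Rec_below V V).
  apply: (emb_oadd_sub (rb w) hw) => [x y xw [yw _]|x xw|x []//]; first exact: (ltle lV xw yw).
  exact: (ltr lV xw wv).
case: l hl il srt hn nrec => [|B l] hl il srt hn nrec; first by case: nrec.
have /List.Forall_cons_iff[hB hl'] := hl; have /List.Forall_cons_iff[_ hn'] := hn.
exists B, l; split=> //.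
  move=> rB; apply: nrec; constructor=> //; apply/List.Forall_forall => D hD.
  by apply: Rec_down rB; apply: (srt [::]).
apply: iso_trans (iso_below_tail x0 lV) _; apply: iso_trans _ (oaddA _ _ _).
by apply: iso_oadd => //; apply: iso_refl.
Qed.

Lemma dominate A l : AI A -> Rec V A -> List.Forall AI l -> List.Forall (Rec V) l ->
  exists C, [/\ AI C, Rec V C, emb A C & forall D, List.In D l -> emb D C].
Proof.
move=> hA rA; elim: l => [|B l IH]; first by exists A; split=> //; apply: emb_refl.
move=> /List.Forall_cons_iff[hB hl] /List.Forall_cons_iff[rB rl].
have [C [hC rC aC dC]] := IH hl rl.
case: (wo_total (AI_wo hB) (AI_wo hC)) => h.
  by exists C; split=> // D [<-//|/dC].
exists B; split=> //; first exact: emb_trans aC h.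
by move=> D [<-|/dC e]; [apply: emb_refl|apply: emb_trans e h].
Qed.

(** Each new [A n] is chosen above its predecessor and above all Cantor blocks of the interval from
    [u n] to [x0]. Every recurrent well order embeds in such an interval, so the sequence is cofinal
    among them. *)
Lemma not_uniform_similar (x0 : V) : (forall y x, ~ prec x0 x -> Rec V (ivl y x)) ->
  (forall A, AI A -> Rec V A -> exists A', [/\ AI A', Rec V A' & ~ emb A' A]) ->
  exists A : nat -> binstr, [/\ forall n, AI (A n), forall n, ~ emb (A n.+1) (A n), nomax (A 0) & similar A V].
Proof.
move=> hx hA; have [u [u0 [du cu]]] := lwf_coinitial x0 lV wV nV.
pose P (s : nat * binstr) := AI s.2 /\ Rec V s.2.
pose R (s t : nat * binstr) := [/\ t.1 = s.1.+1, ~ emb t.2 s.2 & emb (ivl (u s.1) x0) t.2].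
have [[n A] [aA rA]|s [s0 Ps Rs]] := @dep_choice _ P R (0%N, omega) _ (conj AI_omega (Rec_omega gV nwV)).
  have wJ := lwf_ivl (u n) x0 lV wV; have rJ : Rec V (ivl (u n) x0) by apply: hx; apply: lirr.
  have [l [hl il]] := has_cnf_wo wJ.
  have rl : List.Forall (Rec V) l.
    apply/List.Forall_forall => D hD; apply: Rec_down rJ; apply: emb_trans (iso_emb' il).
    elim: l D hD {hl il} => //= B l IH D [->|/IH h]; first exact: emb_inl.
    exact: emb_trans h (emb_inr _ _).
  have [C [hC rC aC dC]] := dominate aA rA hl rl.
  have [A' [hA' rA' nA']] := hA C hC rC.
  exists (n.+1, A'); split=> //; split=> //=; first by move=> h; apply: nA'; apply: emb_trans h aC.
  case: (wo_total wJ (AI_wo hA')) => // h; case: nA'.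
  have [D hD AD] := AI_split_lsum hA' (emb_trans h (iso_emb il)); exact: emb_trans AD (dC D hD).
have s1 n : (s n).1 = n by elim: n => [|n IH]; [rewrite s0|case: (Rs n) => -> _ _; rewrite IH].
exists (fun n => (s n).2); split.
- by move=> n; case: (Ps n).
- by move=> n; case: (Rs n).
- by rewrite s0 => n; exists n.+1; exact: ltnSn.
split=> // a wa; split=> [ra|[n an]]; last by apply: Rec_down an _; case: (Ps n).
have [w [wx aw]] := Rec_ivl x0 lV nV wa ra.
have [n un] := cu w; exists n.+1; have [_ _] := Rs n; rewrite s1; apply: emb_trans.
apply: emb_trans aw _; apply: emb_subS => z [zw zx]; split=> // zu; apply: zw; exact: (ltr lV zu un).
Qed.

Lemma piece_fs : fs V.
Proof.
have [x0 hx] := Rec_germ lV wV iV.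
have [B [l [hB nB hl hn iD]]] := piece_decomp hx.
apply: fs_iso iD _; apply: fs_oadd; last exact: fs_AI.
case: (pselect (exists A, [/\ AI A, Rec V A & forall A', AI A' -> Rec V A' -> emb A' A])).
  move=> [A [hA rA mA]].
  have nA : nomax A.
    apply: (nomax_AI AI_omega hA); first exact: (mA _ AI_omega (Rec_omega gV nwV)).
    by move=> n; exists n.+1; exact: ltnSn.
  have BA : ~ emb B A by move=> h; apply: nB; apply: Rec_down h rA.
  have lB := linear_below x0 lV.
  have dn x y : prec y x0 -> prec x y -> prec x x0 by move=> h1 h2; apply: (ltr lV h2 h1).
  have iB : inhabited (below x0) by have [y yx] := nV x0; split; exists y.
  (* [below x0] embeds in [copies A] and [A] recurs in it, so before [B] it may be replaced by
     [copies A]. *)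
  apply: fs_summand; right; right; left; apply: (class_Z_intro hA hB nA BA).
  apply: copies_absorb => //.
  - exact: (@lwf_emb (below x0) V lB lV (emb_sub _) wV).
  - by move=> [x xx]; have [y yx] := nV x; exists (exist _ y (ltr lV yx xx)).
  - have nc : nomin (copies A) by apply: AI_nomin_copies; apply: AI_inh.
    have rB : Rec (copies A) (below x0).
      apply: (Rec_below lV wV nV (linear_copies (AI_lin hA)) nc) => y x xx.
      have [l' [hl' il']] := has_cnf_wo (lwf_ivl y x lV wV).
      apply: Rec_down (iso_emb il') _; apply: Rec_lsum => //.
      + exact: linear_copies (AI_lin hA).
      + by apply: List.Forall_impl hl' => C; apply: AI_wo.
      apply/List.Forall_forall => D hD; apply: (@Rec_down _ D A) (@Rec_copies A (AI_wo hA)).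
      apply: mA; first by move/List.Forall_forall: hl'; apply.
      apply: (@Rec_down _ D (ivl y x)); last exact: hx.
      apply: emb_trans (iso_emb' il').
      elim: l' D hD {hl' il'} => //= C l' IH D [->|/IH h]; first exact: emb_inl.
      exact: emb_trans h (emb_inr _ _).
    by have [a] := AI_inh hA; apply: emb_trans (rB (existT _ 0%N a)) (emb_sub _).
  - exact: (proj2 (@Rec_initial V (fun x => prec x x0) A lV dn iB) rA).
move=> /forallNP nu; exfalso.
have [A aA rA|A [hA hlt nA sV]] := not_uniform_similar hx.
  apply: contrapT => /forallNP h; apply: (nu A); split=> // A' aA' rA'.
  by apply: contrapT => n; apply: (h A').
apply: (no_similar hA hlt nA cX iX _ _ sV).
  have [h _ _] := nl; apply: List.Forall_impl h => W [b hb]; split; first exact: mono_sum_linear hb.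
  by have [Q [_ _ w]] := hb; case: b w {hb} => w; [left|right].
by apply/List.in_app_iff; right; left.
Qed.

End PieceFs.

Lemma mono_sum_fs X l1 V l2 : CSB X -> has_nb X -> norm (l1 ++ V :: l2) -> iso X (lsum (l1 ++ V :: l2)) ->
  mono_sum true V -> fs V.
Proof.
move=> cX nbX nl iX gV; case: (pselect (wf V)) => [w|nw]; last exact: (piece_fs cX nbX nl iX gV nw).
apply: fs_summand; left; apply: class_LI.
- by split=> //; apply: mono_sum_linear gV.
- by have [_ /Forall_mid[_ h _] _] := nl.
- exact: mono_sum_end gV.
Qed.

Theorem CSB_limit_fs X : CSB X -> limit_type X -> fs X.
Proof.
move=> cX lX; have [nbX [l [nl iX]]] := limit_pieces cX lX.
apply: (fs_iso iX); apply: fs_lsum; apply/List.Forall_forall => V hV.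
have [l1 [l2 e]] := List.in_split V l hV; subst l.
have [/Forall_mid[_ [b gV] _] _ _] := nl; case: b gV => gV; first exact: mono_sum_fs cX nbX nl iX gV.
(* Pieces of color false are handled by reversing the whole of [X], which exchanges the colors. *)
apply: fs_rev'; have nr := norm_rev nl.
have ir : iso (rev_str X) (lsum (rev (map rev_str (l1 ++ V :: l2)))).
  by apply: iso_trans (iso_rev iX) _; apply: rev_lsum.
have e : rev (map rev_str (l1 ++ V :: l2)) = rev (map rev_str l2) ++ rev_str V :: rev (map rev_str l1).
  by rewrite map_cat rev_cat /= rev_cons cat_rcons.
rewrite e in nr ir; apply: mono_sum_fs (CSB_rev cX) (has_nb_rev nbX) nr ir _.
exact: (mono_sum_rev gV).
Qed.

(** * Finite sums of indecomposable blocks *)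

(** Indecomposability for finite partitions into consecutive intervals. Index maps are used so that
    a partition can be pulled back along a self-embedding. *)
Definition ind (P : binstr) : Prop := inhabited P /\
  forall (idx : P -> nat) m, (forall x y, prec x y -> (idx x <= idx y)%N) -> (forall x, (idx x < m)%N) ->
  exists k, emb P (sub (fun x => idx x = k)).

Lemma ind_right (P : binstr) : linear P -> inhabited P -> (forall a : P, emb P (tail a)) -> ind P.
Proof.
move=> lP iP h; split=> // idx m mono bd; have [a0] := iP.
have [k [[a ka] mk]] := @nat_least (fun k => exists a, k = (m - idx a)%N) (ex_intro _ _ (ex_intro _ a0 erefl)).
exists (idx a); apply: emb_trans (h a) _; apply: emb_subS => x /(lle lP)[ax|<-//].
apply/eqP; rewrite eqn_leq (mono _ _ ax) andbT leqNgt; apply/negP => lt.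
apply: (mk (m - idx x)%N); last by exists x.
by rewrite ka; apply: ltn_sub2l lt; apply: bd.
Qed.

Lemma ind_left (P : binstr) : linear P -> inhabited P ->
  (forall a : P, emb P (sub (fun x => ~ prec a x))) -> ind P.
Proof.
move=> lP iP h; split=> // idx m mono bd; have [a0] := iP.
have [k [[a ka] mk]] := @nat_least (fun k => exists a, k = idx a) (ex_intro _ _ (ex_intro _ a0 erefl)).
exists (idx a); apply: emb_trans (h a) _; apply: emb_subS => x /(lle lP)[ax|->//].
apply/eqP; rewrite eqn_leq (mono _ _ ax) /= leqNgt; apply/negP => lt.
by apply: (mk (idx x)); [rewrite ka|exists x].
Qed.

Lemma ind_iso P Q : iso P Q -> ind P -> ind Q.
Proof.
move=> iPQ [[p0] hP]; have [f [[g fg gf] hf]] := iPQ; split; first by split; exact: f p0.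
move=> idx m mono bd.
have [|x|k hk] := hP (idx \o f) m; first by move=> x y /hf; apply: mono.
  exact: bd.
exists k; apply: emb_trans (iso_emb' iPQ) _; apply: emb_trans hk _.
by apply: (@emb_image _ _ _ f) => // x y /hf.
Qed.

(* A self-embedding moves each indecomposable block into a single block; at the
   last block moved up, two neighbours would land in one of them. *)
Lemma index_rigid (X : binstr) (idx : X -> nat) m (h : X -> X) : linear X ->
  (forall x y, prec x y -> (idx x <= idx y)%N) -> (forall x, (idx x < m)%N) -> hom h ->
  (forall i, (i < m)%N -> ind (sub (fun x => idx x = i))) ->
  (forall i, (i.+1 < m)%N ->
     ~ emb (oadd (sub (fun x => idx x = i)) (sub (fun x => idx x = i.+1))) (sub (fun x => idx x = i)) /\
     ~ emb (oadd (sub (fun x => idx x = i)) (sub (fun x => idx x = i.+1))) (sub (fun x => idx x = i.+1))) ->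
  forall i, (i < m)%N -> emb (sub (fun x => idx x = i)) (sub (fun x => idx x = i /\ idx (h x) = i)).
Proof.
move=> lX mono bd hh hind hadj.
pose F i := sub (fun x => idx x = i).
pose M i k := emb (F i) (sub (fun x => idx x = i /\ idx (h x) = k)).
have exM i : (i < m)%N -> exists k, M i k.
  move=> im; have [_ hi] := hind i im.
  have [x y xy|x|k hk] := hi (fun x => idx (h (sval x))) m; [exact: mono (hh _ _ xy)|exact: bd|].
  exists k; apply: emb_trans hk _; apply: (@emb_image (F i) X _ sval) => // -[x ex] /= e; by split.
have pick i : exists k, (i < m)%N -> M i k.
  by case: (ltnP i m) => im; [have [k hk] := exM i im; exists k|exists 0%N].
have [j hj] := choice pick.
have inhM i k : (i < m)%N -> M i k -> exists x, idx x = i /\ idx (h x) = k.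
  by move=> im /emb_subP[f [fP _]]; have [[x0] _] := hind i im; exists (f x0).
have jm i : (i < m)%N -> (j i < m)%N.
  by move=> im; have [x [_ <-]] := inhM _ _ im (hj i im); apply: bd.
have ltidx x y : (idx x < idx y)%N -> prec x y.
  move=> xy; case: (ltot lX x y) => [//|[e|/mono]]; first by rewrite e ltnn in xy.
  by rewrite leqNgt xy.
have jmono i i' : (i < i')%N -> (i' < m)%N -> (j i <= j i')%N.
  move=> ii im'; have im := ltn_trans ii im'.
  have [x [ex <-]] := inhM _ _ im (hj i im); have [y [ey <-]] := inhM _ _ im' (hj i' im').
  by apply: mono; apply: hh; apply: ltidx; rewrite ex ey.
have two i k : (i.+1 < m)%N -> M i k -> M i.+1 k -> emb (oadd (F i) (F i.+1)) (F k).
  move=> im h1 h2.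
  have img n : M n k -> emb (F n) (sub (fun y => idx y = k /\ exists2 x, idx x = n & y = h x)).
    by move/emb_trans; apply; apply: (emb_image hh) => x [e1 e2]; split=> //; exists x.
  apply: (emb_oadd_sub (img _ h1) (img _ h2)) => [_ _ [_ [x ex ->]] [_ [y ey ->]]|y []//|y []//].
  by apply: hh; apply: ltidx; rewrite ex ey.
have jle i : (i < m)%N -> (j i <= i)%N.
  move=> im; rewrite leqNgt; apply/negP => ij.
  (* Minimizing [m - i] selects the last block that moves up; it and its successor both land in
     block [i1.+1]. *)
  have [d [[i1 [di i1m i1j]] md]] := @nat_least (fun d => exists i, [/\ d = (m - i)%N, (i < m)%N & (i < j i)%N])
    (ex_intro _ _ (ex_intro _ i (And3 erefl im ij))).
  have i1S : (i1.+1 < m)%N by apply: leq_ltn_trans i1j (jm _ i1m).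
  have le : (j i1.+1 <= i1.+1)%N.
    rewrite leqNgt; apply/negP => lt; apply: (md (m - i1.+1)%N); last by exists i1.+1.
    by rewrite di; apply: ltn_sub2l.
  have e2 : j i1.+1 = i1.+1.
    by apply/eqP; rewrite eqn_leq le /=; apply: leq_trans i1j (jmono _ _ (ltnSn _) i1S).
  have e1 : j i1 = i1.+1.
    by apply/eqP; rewrite eqn_leq i1j andbT -e2; apply: jmono.
  case: (hadj i1 i1S) => _; apply; apply: two => //; first by have := hj _ i1m; rewrite e1.
  by have := hj _ i1S; rewrite e2.
have jge i : (i < m)%N -> (i <= j i)%N.
  move=> im; rewrite leqNgt; apply/negP => ij.
  (* Dually, the first block that moves down lands in its predecessor, which stays in place. *)
  have [i1 [[i1m i1j] mi]] := @nat_least (fun i => (i < m)%N /\ (j i < i)%N) (ex_intro _ i (conj im ij)).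
  case: i1 i1m i1j mi => // i1 i1m i1j mi; have i1m' := ltnW i1m.
  have e1 : j i1 = i1.
    apply/eqP; rewrite eqn_leq jle //= leqNgt; apply/negP => lt; exact: (mi i1 (ltnSn _)).
  have e2 : j i1.+1 = i1.
    apply/eqP; rewrite eqn_leq -ltnS i1j /= -{1}e1; exact: jmono.
  case: (hadj i1 i1m) => + _; apply; apply: two => //; first by have := hj _ i1m'; rewrite e1.
  by have := hj _ i1m; rewrite e2.
move=> i im; have := hj i im; rewrite (_ : j i = i) //.
by apply/eqP; rewrite eqn_leq jle // jge.
Qed.

(** * Blocks and their normal form *)

Inductive blk : Type := BW of binstr | BWr of binstr | BC of binstr | BCr of binstr.

Definition blk_ord (p : blk) : binstr := match p with
  | BW A => A | BWr A => rev_str A | BC A => copies A | BCr A => rev_str (copies A) end.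
Definition base (p : blk) : binstr := match p with BW A | BWr A | BC A | BCr A => A end.
Definition dual (p : blk) : blk := match p with
  | BW A => BWr A | BWr A => BW A | BC A => BCr A | BCr A => BC A end.
Definition okb p := AI (base p) /\ nomax (base p).

Lemma ev_dual p : blk_ord (dual p) = rev_str (blk_ord p).
Proof. by case: p => A //=; rewrite rev_strK. Qed.

(* A block [BC A] must be followed by a larger indecomposable, as in the class Z. *)
Definition adjZ (p q : option blk) : Prop := match p, q with
  | Some (BC A), Some (BW B) => ~ emb B A
  | Some (BC _), _ => False
  | Some (BWr B), Some (BCr A) => ~ emb B A
  | _, Some (BCr _) => False
  | _, _ => True end.

(** The argument [p] is the preceding block; [None] stands for either end of the list, so a [BC]
    cannot come last nor a [BCr] first. *)
Fixpoint chain (p : option blk) (l : seq blk) : Prop :=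
  match l with [::] => adjZ p None | q :: l' => adjZ p (Some q) /\ chain (Some q) l' end.

(** Neighbours of which neither absorbs the other by [AI_absorb] or its reverse. *)
Definition irr (p q : blk) : Prop := match p, q with
  | BW A, BW B => emb B A | BWr A, BWr B => emb A B | _, _ => True end.

Lemma adjZ_dual p q : adjZ (Some p) (Some q) -> adjZ (Some (dual q)) (Some (dual p)).
Proof. by case: p q => A [] B. Qed.

Lemma irr_dual p q : irr p q -> irr (dual q) (dual p).
Proof. by case: p q => A [] B. Qed.

Lemma okb_dual p : okb p -> okb (dual p).
Proof. by case: p. Qed.

Lemma copies_not_wf (A : binstr) : inhabited A -> ~ wf (copies A).
Proof.
move=> iA w; apply: (wf_nomin w _ (AI_nomin_copies iA)).
by case: iA => a; split; exact: (existT _ 0%N a).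
Qed.

Lemma emb_copies A : emb A (copies A).
Proof. by exists (fun a => existT _ 0%N a) => x y h; apply/(osum_same _ _ linear_omega_star). Qed.

Lemma nomax_not_rwf (A P : binstr) : inhabited A -> nomax A -> emb A P -> ~ rwf P.
Proof. by move=> iA nA e w; apply: (rwf_nomax _ iA nA); apply: wf_emb (emb_rev e) w. Qed.

Lemma emb_copies_AI A B : AI A -> AI B -> emb B (copies A) -> emb B A.
Proof.
move=> hA hB e.
have [|x y _ _|k hk] := @AI_index B (copies A) (fun _ => True) (fun p => projT1 p) hB.
- exact: emb_trans e (iso_emb (iso_subT _)).
- exact: copies_idx.
apply: emb_trans hk _; apply: emb_trans _ (@emb_block omega_star (fun _ => A) k linear_omega_star).
by apply: emb_subS => p [].
Qed.

Lemma linear_ev p : okb p -> linear (blk_ord p).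
Proof.
move=> [/AI_lin lA _]; case: p lA => A /= lA //; try exact: linear_rev; first exact: linear_copies.
by apply: linear_rev; apply: linear_copies.
Qed.

Lemma inh_ev p : okb p -> inhabited (blk_ord p).
Proof.
move=> [/AI_inh[a] _]; case: p a => A /= a; split; try exact a; exact: (existT _ 0%N a : copies A).
Qed.

Lemma rev_rwf A : wf A -> rwf (rev_str A).
Proof. by rewrite /rwf rev_strK. Qed.

(** In most cases the image of the second block violates a well-foundedness property of the first.
    Two reversed well orders are settled by [irr], which puts [A] + [A] into [A]; a [BC A] before a
    [BW B] is settled by [~ emb B A]. *)
Lemma adj_left p q : okb p -> okb q -> adjZ (Some p) (Some q) -> irr p q ->
  ~ emb (oadd (blk_ord p) (blk_ord q)) (blk_ord p).
Proof.
move=> okp okq; have [hA nA] := okp; have [hB nB] := okq; have iq := inh_ev okq.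
have wA := AI_wo hA; have wB := AI_wo hB; have iA := AI_inh hA; have iB := AI_inh hB.
case: p okp hA nA wA iA => A /= okp hA nA wA iA adj ir e.
- exact: (wo_nemb_add wA iq e).
- have rw := rev_rwf wA.2; case: q okq hB nB wB iB iq adj ir e => B /= okq hB nB wB iB iq adj ir e.
  + exact: (nomax_not_rwf iB nB (emb_trans (emb_inr _ _) e) rw).
  + apply: (wo_nemb_add wA iA); apply: emb_trans (emb_oadd ir (emb_refl A)) _.
    rewrite -[A in emb _ A]rev_strK; apply: emb_trans (emb_rev e).
    apply: emb_trans (iso_emb' (rev_oadd _ _)); rewrite !rev_strK; exact: emb_refl.
  + exact: (nomax_not_rwf iB nB (emb_trans (emb_copies B) (emb_trans (emb_inr _ _) e)) rw).
  + apply: (copies_not_wf iB); apply: wf_emb wA.2.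
    by have := emb_rev (emb_trans (emb_inr _ _) e); rewrite !rev_strK.
- case: q okq hB nB wB iB iq adj ir e => // B okq hB nB wB iB iq adj ir e.
  apply: adj; apply: emb_copies_AI => //; exact: emb_trans (emb_inr _ _) e.
- have [f hf] := e; have [b] := iq; apply: (copies_not_wf iA).
  have lC := linear_copies (AI_lin hA).
  apply: wf_emb (@lwf_copies A wA (f (inr b) : copies A)).
  apply/(@emb_subP (copies A) (copies A)); exists (fun x => f (inl x)); split=> [x h|x y xy].
    apply: (lasym lC h); apply: (hf (inl x) (inr b)); exact: oadd_lr.
  by apply: (hf (inl y) (inl x)); apply/oadd_ll.
Qed.

Lemma adj_right p q : okb p -> okb q -> adjZ (Some p) (Some q) -> irr p q ->
  ~ emb (oadd (blk_ord p) (blk_ord q)) (blk_ord q).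
Proof.
move=> okp okq adj ir e; apply: (adj_left (okb_dual okq) (okb_dual okp) (adjZ_dual adj) (irr_dual ir)).
by rewrite !ev_dual; apply: emb_trans (iso_emb' (rev_oadd _ _)) (emb_rev e).
Qed.

Lemma emb_copies_init (A : binstr) (a : copies A) : linear A -> emb (copies A) (sub (fun x => ~ prec a x)).
Proof.
move=> lA; have lC := linear_copies lA; apply/emb_subP.
exists (fun p : copies A =>
  existT (fun _ : omega_star => dom A) ((projT1 p : nat) + (projT1 a : nat).+1)%N (projT2 p) : copies A); split.
  by move=> p /copies_idx /=; rewrite addnS leqNgt ltnS leq_addl.
move=> [n x] [m y] h; case: (osum_le h) => [mn|e].
  by apply: osum_ltI; rewrite /= ltn_add2r.
change (n = m) in e; subst m; have h' := proj1 (osum_same _ _ linear_omega_star) h.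
exact/(osum_same _ _ linear_omega_star).
Qed.

(** Well orders and reversed copies embed in all their tails, the two dual kinds in all their
    initial segments; for copies, shift the copy number. *)
Lemma ind_ev p : okb p -> ind (blk_ord p).
Proof.
move=> okp; have lp := linear_ev okp; have ip := inh_ev okp; have [[[lA _] _ hA] _] := okp.
case: p okp lp ip lA hA => A /= okp lp ip lA hA.
- exact: ind_right.
- apply: ind_left => // a; apply: emb_trans (emb_rev (hA a)) _; exact: emb_refl.
- by apply: ind_left => // a; apply: emb_copies_init.
- apply: ind_right => // a; apply: emb_trans (emb_rev (emb_copies_init a lA)) _; exact: emb_refl.
Qed.

Lemma chain_glue p l : adjZ p None -> chain None l -> chain p l.
Proof.
case: l => [//|q l] hp [hq hl]; split=> //; move: hp hq {hl}.
by case: p => [[]|] // A; case: q => [] B.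
Qed.

Lemma chain_cat p l1 l2 : chain p l1 -> chain None l2 -> chain p (l1 ++ l2).
Proof. by elim: l1 p => [|q l1 IH] p /= => [|[h /IH h'] /h']; [apply: chain_glue|]. Qed.

Lemma chain_suffix l u v : (forall p, chain p u -> chain p v) -> forall p, chain p (l ++ u) -> chain p (l ++ v).
Proof. by move=> uv; elim: l => [|q l IH] p /= => [|[h /IH h']]; [apply: uv|split]. Qed.

Lemma chain_adj p l1 a b l2 : chain p (l1 ++ a :: b :: l2) -> adjZ (Some a) (Some b).
Proof. by elim: l1 p => [|q l1 IH] p /= => [[_ []]|[_ /IH]]. Qed.

Definition blk_sum X := exists l, [/\ List.Forall okb l, chain None l & iso X (lsum (map blk_ord l))].

Lemma chain_BW l : chain None (map BW l).
Proof.
suff h : forall p, adjZ p None -> (forall A, p <> Some (BC A)) -> chain p (map BW l) by apply: h.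
by elim: l => [|A l IH] p hp np //=; split; [case: p hp np => [[]|] //|apply: IH].
Qed.

Lemma chain_BWr l : chain None (map BWr l).
Proof.
suff h : forall p, adjZ p None -> chain p (map BWr l) by apply: h.
by elim: l => [|A l IH] p hp //=; split; [case: p hp => [[]|] //|apply: IH].
Qed.

Lemma class_L_AI X : class_L X -> exists l, [/\ List.Forall AI l, List.Forall nomax l & iso X (lsum l)].
Proof.
move=> [/woE wX _ nX]; have [l [hl il srt]] := cnf wX; exists l; split=> //.
exact: cnf_nomax il hl srt nX.
Qed.

Lemma okb_map (f : binstr -> blk) l : (forall A, base (f A) = A) -> List.Forall AI l -> List.Forall nomax l ->
  List.Forall okb (map f l).
Proof.
move=> hf h1 h2; apply/List.Forall_forall => p /List.in_map_iff[A [<- hA]].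
rewrite /okb hf; split; [by move/List.Forall_forall: h1; apply|by move/List.Forall_forall: h2; apply].
Qed.

Lemma Forall_rev (T : Type) (P : T -> Prop) l : List.Forall P l -> List.Forall P (rev l).
Proof.
elim=> // a {}l Pa _ IH; rewrite rev_cons -cats1; apply/List.Forall_app; split=> //.
by constructor.
Qed.

Lemma summand_blk X : summand X -> blk_sum X.
Proof.
case=> [/class_L_AI[l [h1 h2 iX]]|[[Y [/class_L_AI[l [h1 h2 iY]] XY]]|[/class_Z_elim[A [B [hA hB nA BA iX]]]|
  [Y [/class_Z_elim[A [B [hA hB nA BA iY]]] XY]]]]].
- exists (map BW l); split; [exact: okb_map|exact: chain_BW|].
  by rewrite -map_comp (_ : map _ _ = l) // -[RHS]map_id; apply: eq_map.
- exists (map BWr (rev l)); split; [|exact: chain_BWr|].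
    by apply: okb_map => //; apply: Forall_rev.
  apply: iso_trans XY _; apply: iso_trans (iso_rev iY) _.
  rewrite -map_comp (_ : map _ _ = rev (map rev_str l)); first exact: rev_lsum.
  by rewrite map_rev; congr rev; apply: eq_map.
- have nB : nomax B by apply: (nomax_AI hA hB) => //; case: (wo_total (AI_wo hA) (AI_wo hB)).
  exists [:: BC A; BW B]; split=> //; last by apply: iso_trans iX _; apply: iso_oadd; [apply: iso_refl|apply/iso_sym/lsum1].
  by constructor=> //; constructor.
- have nB : nomax B by apply: (nomax_AI hA hB) => //; case: (wo_total (AI_wo hA) (AI_wo hB)).
  exists [:: BWr B; BCr A]; split=> //; first by constructor=> //; constructor.
  apply: iso_trans XY _; apply: iso_trans (iso_rev iY) _; apply: iso_trans (rev_oadd _ _) _.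
  by apply: iso_oadd; [apply: iso_refl|apply/iso_sym/lsum1].
Qed.

Lemma fs_blk X : fs X -> blk_sum X.
Proof.
move=> [l [hl iX]]; suff [l' [h1 h2 h3]] : blk_sum (lsum l).
  by exists l'; split=> //; apply: iso_trans iX h3.
elim: hl {iX} => [|A {}l hA _ [l' [h1 h2 h3]]]; first by exists [::]; split=> //; apply: iso_refl.
have [k [k1 k2 k3]] := summand_blk hA; exists (k ++ l'); split.
- by apply/List.Forall_app.
- exact: chain_cat.
- rewrite map_cat; apply: iso_trans (iso_oadd k3 h3) _; apply/iso_sym/lsum_cat.
Qed.

Lemma lt_trans_AI A B D : AI A -> AI B -> ~ emb A D -> ~ emb B A -> ~ emb B D.
Proof.
move=> hA hB AD BA BD; apply: AD; apply: emb_trans BD.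
by case: (wo_total (AI_wo hA) (AI_wo hB)).
Qed.

(* Shortest representations admit no absorption between neighbours. *)
Lemma blk_normal X : blk_sum X -> exists l, [/\ List.Forall okb l, chain None l, iso X (lsum (map blk_ord l)) &
  forall l1 p q l2, l = l1 ++ p :: q :: l2 -> irr p q].
Proof.
move=> [l [hl cl iX]]; move: {2}(size l) (leqnn (size l)) => n; elim: n l hl cl iX => [|n IH] l hl cl iX hn.
  by exists [::]; case: l hl cl iX hn => // hl cl iX _; split=> // -[].
case: (pselect (forall l1 p q l2, l = l1 ++ p :: q :: l2 -> irr p q)) => [h|]; first by exists l.
move=> /existsNP[l1 /existsNP[p /existsNP[q /existsNP[l2 /not_implyP[e nir]]]]]; subst l.
have /Forall_mid[h1 okp /List.Forall_cons_iff[okq h2]] := hl.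
have sz r : (size (l1 ++ r :: l2) <= n)%N by move: hn; rewrite !size_cat /= !addnS ltnS.
have merge r : iso (oadd (blk_ord p) (blk_ord q)) (blk_ord r) -> iso X (lsum (map blk_ord (l1 ++ r :: l2))).
  move=> h; apply: iso_trans iX _; rewrite !map_cat /=; exact: lsum_merge.
have [hA _] := okp; have [hB _] := okq.
case: p q nir hA hB okp okq merge {hn hl iX} cl => A [] B //= nir hA hB okp okq merge cl.
  apply: (IH (l1 ++ BW B :: l2)) => //; [exact/Forall_mid| |].
  (* A preceding [BC D] may now be followed by [B]: [A] does not embed in [D], and [A] embeds in
     [B]. *)
  - apply: (chain_suffix (u := BW A :: BW B :: l2)) cl => p [hp [_ hl2]]; split=> //.
    by case: p hp => [[]|] // D /= hD; apply: (@lt_trans_AI A).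
  - by apply: merge; apply: AI_absorb => //; apply: AI_wo.
apply: (IH (l1 ++ BWr A :: l2)) => //; [exact/Forall_mid| |].
- apply: (chain_suffix (u := BWr A :: BWr B :: l2)) cl => p [hp [_ hl2]]; split=> //.
  case: l2 hl2 {h2 sz merge} => // -[] D l2 [hD hl2]; split=> //.
  exact: (@lt_trans_AI B).
- apply: merge; apply: iso_trans (iso_sym (rev_oadd _ _)) _; apply: iso_rev.
  by apply: AI_absorb => //; apply: AI_wo.
Qed.

(** * The Cantor-Schroeder-Bernstein property *)

Lemma wo_equi_iso Y A : linear Y -> wo A -> equi Y A -> iso Y A.
Proof.
move=> lY wA [h1 h2]; apply: wo_antisym => //; exact: wo_emb lY h1 wA.2.
Qed.

Lemma equi_rev A B : equi A B -> equi (rev_str A) (rev_str B).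
Proof. by move=> [h1 h2]; split; apply: emb_rev. Qed.

(** The images in [Y] of points from successive copies descend coinitially, so [A] recurs in [Y] and
    [copies_absorb] applies. *)
Lemma copies_equi_absorb A B Y Z : AI A -> AI B -> ~ emb B A -> linear Y -> linear Z ->
  equi Y (copies A) -> equi Z B -> iso (oadd Y Z) (oadd (copies A) B).
Proof.
move=> hA hB BA lY lZ [YA AY] eZ; have lA := AI_lin hA; have wA := AI_wo hA.
have iZ := wo_equi_iso lZ (AI_wo hB) eZ.
apply: iso_trans (iso_oadd (iso_refl Y) iZ) _.
have lC := linear_copies lA; have wY : lwf Y := @lwf_emb Y _ lY lC YA (@lwf_copies A wA).
have [a0] := AI_inh hA; have [c hc] := AY.
have [w|[nY iY]] := lwf_cases lY wY.
  by case: (copies_not_wf (AI_inh hA)); apply: wf_emb AY w.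
apply: copies_absorb => // y.
pose s n : Y := c (existT _ n a0).
have ds n : prec (s n.+1) (s n) by apply: hc; apply: osum_ltI; exact: ltnSn.
have [n hn] : exists n, prec (s n) y.
  apply: contrapT => /forallNP h.
  exact: (@desc_not_wf (tail y) (fun n => exist _ (s n) (h n))) (wY y).
apply/(@emb_subP A Y); exists (fun a => c (existT _ n.+1 a)); split=> [a|a b ab].
  by apply: (ltr lY) _ hn; apply: hc; apply: osum_ltI; exact: ltnSn.
by apply: hc; apply/(osum_same _ _ linear_omega_star).
Qed.

(** Well orders and their reverses are determined by bi-embeddability alone, a block of copies only
    together with the neighbour that [adjZ] grants it. Hence one or two blocks are consumed at a
    time. *)
Lemma rebuild l LY : List.Forall okb l -> chain None l ->
  List.Forall2 (fun Y p => linear Y /\ equi Y (blk_ord p)) LY l -> iso (lsum LY) (lsum (map blk_ord l)).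
Proof.
move: {2}(size l) (leqnn (size l)) => n; elim: n l LY => [|n IH] l LY hn hl cl hY.
  case: l hn hl cl hY => // _ _ _ h; have -> : LY = [::] by inversion h.
  exact: iso_refl.
case: hY hn hl cl => [|Y p LY' l' [lY eY] hY] hn hl cl; first exact: iso_refl.
have [okp hl'] := proj1 (List.Forall_cons_iff _ _ _) hl; have [hA nA] := okp.
case: p hn hl cl okp lY eY hA nA => A hn hl cl okp lY eY /= hA nA.
- apply: iso_oadd; first exact: wo_equi_iso (AI_wo hA) eY.
  apply: IH => //; case: cl => _; case: (l') => // q l2 [h1 h2]; split=> //.
- have single : chain None l' -> iso (oadd Y (lsum LY')) (oadd (rev_str A) (lsum (map blk_ord l'))).
    move=> cl'; apply: iso_oadd; last exact: IH.
    rewrite -[Y]rev_strK; apply: iso_rev; apply: wo_equi_iso; [exact: linear_rev|exact: AI_wo|].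
    by have := equi_rev eY; rewrite /= rev_strK.
  case: hY single hn cl hl' {hl} => [|Z q LY2 l2 [lZ eZ] hY2] single hn cl hl'; first exact: single.
  case: cl => _ [cq cl2].
  have [okq hl2] := proj1 (List.Forall_cons_iff _ _ _) hl'; have [hB nB] := okq.
  case: q eZ single hn cq cl2 okq hB nB {hl'} => B eZ single hn cq cl2 okq /= hB nB; do ?by apply: single; split.
  apply: iso_trans (oaddA _ _ _) _; apply: iso_trans _ (iso_sym (oaddA _ _ _)); apply: iso_oadd; last first.
    apply: IH => //; first exact: ltnW.
    by case: (l2) cl2 => // q l3 [h1 h2]; split.
  rewrite -[oadd Y Z]rev_strK -[oadd (rev_str A) _]rev_strK; apply: iso_rev.
  apply: iso_trans (rev_oadd _ _) _; apply: iso_trans _ (iso_sym (rev_oadd _ _)); rewrite !rev_strK.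
  apply: copies_equi_absorb => //; try exact: linear_rev.
    by have := equi_rev eZ; rewrite /= rev_strK.
  by have := equi_rev eY; rewrite /= rev_strK.
- case: hY hn cl hl' {hl} => [|Z q LY2 l2 [lZ eZ] hY2] hn cl hl'; first by case: cl => _ [].
  case: cl => _ [cq cl2].
  have [okq hl2] := proj1 (List.Forall_cons_iff _ _ _) hl'; have [hB nB] := okq.
  case: q eZ hn cq cl2 okq hB nB {hl'} => B // eZ hn cq cl2 okq /= hB nB.
  apply: iso_trans (oaddA _ _ _) _; apply: iso_trans _ (iso_sym (oaddA _ _ _)); apply: iso_oadd; last first.
    apply: IH => //; first exact: ltnW.
    by case: (l2) cl2 => // q l3 [h1 h2]; split.
  exact: copies_equi_absorb.
- by case: cl.
Qed.

Lemma iso_block (S : binstr) (L : S -> binstr) k : linear S -> (forall s, linear (L s)) ->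
  iso (@sub (osum L) (fun p => projT1 p = k)) (L k).
Proof.
move=> lS lL; apply: iso_sym.
pose f (a : L k) : @sub (osum L) (fun p => projT1 p = k) := exist (fun p : osum L => projT1 p = k) (existT _ k a) erefl.
apply: (@iso_surj _ _ f) => //.
- by apply: linear_sub; apply: linear_osum.
- by move=> x y xy; apply: (proj2 (@osum_same S L k x y lS) xy).
by move=> [[s a] e]; simpl in e; subst s; exists a; apply: eq_exist.
Qed.

Lemma Forall2_iota (T U : Type) (R : T -> U -> Prop) (F : nat -> T) u0 l j :
  (forall i, (i < size l)%N -> R (F (j + i)%N) (nth u0 l i)) -> List.Forall2 R (map F (iota j (size l))) l.
Proof.
elim: l j => [|u l IH] j h /=; first by constructor.
constructor; first by have := h 0%N isT; rewrite addn0.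
by apply: IH => i il; have := h i.+1 il; rewrite addnS.
Qed.

Theorem blk_CSB X : blk_sum X -> CSB X.
Proof.
move=> /blk_normal[l [hl cl iX hirr]].
set m := size l; pose p0 := BW emptyo.
pose V (i : ord_str m) := blk_ord (nth p0 l i).
have okn i : (i < m)%N -> okb (nth p0 l i).
  move=> im; elim: l i @m im hl {cl iX hirr V} => // a l IH [|i] m im /List.Forall_cons_iff[ha hl] //=.
  exact: IH.
have lV i : linear (V i) by apply: linear_ev; apply: okn; case: i.
have iX' : iso X (osum V).
  apply: iso_trans iX _; apply: iso_sym; apply: iso_trans (osum_ord_lsum _) _.
  rewrite (_ : map V _ = map blk_ord l); first exact: iso_refl.
  rewrite (_ : V = (fun j => blk_ord (nth p0 l j)) \o val) // map_comp val_enum_ord.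
  by rewrite (map_comp blk_ord (nth p0 l)) -[X in _ = map blk_ord X](mkseq_nth p0).
have lO : linear (osum V) by apply: linear_osum_ord.
apply: (CSB_transfer (iso_sym iX')); split=> // Y lY /biemb_equi[[g hg] [f hf]].
pose idx (p : osum V) : nat := projT1 p.
have mono p q : prec p q -> (idx p <= idx q)%N by rewrite /idx => /osum_le[/= /ltnW|->].
have bd p : (idx p < m)%N by rewrite /idx; case: (projT1 p).
have iF i (im : (i < m)%N) : iso (sub (fun p => idx p = i)) (blk_ord (nth p0 l i)).
  apply: iso_trans (@iso_block (ord_str m) V (Ordinal im) (linear_ord m) lV).
  apply: iso_sub_eq => p; rewrite /idx; split=> [e|-> //]; exact: val_inj.
(* Rigidity of [f \o g] shows that each block of [X] embeds in the part of [Y] that [f] maps into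
   the same block. *)
have rigid := @index_rigid (osum V) idx m (f \o g) lO mono bd.
have {}rigid i : (i < m)%N -> emb (sub (fun p => idx p = i)) (sub (fun p => idx p = i /\ idx (f (g p)) = i)).
  apply: rigid.
  - by move=> x y /hg /hf.
  - move=> k km; apply: ind_iso (iso_sym (iF k km)) _; apply: ind_ev; exact: okn.
  - move=> k km; have km' := ltnW km.
    have e : l = take k l ++ nth p0 l k :: nth p0 l k.+1 :: drop k.+2 l.
      by rewrite -(drop_nth p0 km) -(drop_nth p0 km') cat_take_drop.
    have adj : adjZ (Some (nth p0 l k)) (Some (nth p0 l k.+1)).
      by move: cl; rewrite {1}e; apply: chain_adj.
    have ir := hirr _ _ _ _ e.
    have h1 := adj_left (okn _ km') (okn _ km) adj ir; have h2 := adj_right (okn _ km') (okn _ km) adj ir.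
    have i1 := iF k km'; have i2 := iF k.+1 km.
    have i12 := iso_emb' (iso_oadd i1 i2).
    split=> e'; [apply: h1|apply: h2]; apply: emb_trans i12 _; apply: emb_trans e' _; exact: iso_emb.
pose YF i := sub (fun y => idx (f y) = i).
have monoY x y : prec x y -> (idx (f x) <= idx (f y))%N by move=> /hf; apply: mono.
apply: iso_trans (iso_sym iX') _; apply: iso_trans iX _; apply: iso_sym.
have iY : iso Y (lsum [seq YF i | i <- iota 0 m]).
  apply: iso_trans _ (lsum_fibers 0 m lY monoY); apply: iso_subT => y.
  by rewrite add0n leq0n; apply: bd.
apply: iso_trans iY _; apply: rebuild => //.
have eq i : (i < m)%N -> linear (YF i) /\ equi (YF i) (blk_ord (nth p0 l i)).
  move=> im; split; first exact: linear_sub.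
  split; first by apply: emb_trans _ (iso_emb (iF i im)); apply: (emb_image hf).
  apply: emb_trans (iso_emb' (iF i im)) _; apply: emb_trans (rigid i im) _.
  by apply: (emb_image hg) => p [].
exact: (@Forall2_iota _ _ _ YF p0 l 0).
Qed.

(** * Finite sums are of limit type *)

(** [S] consists of the points that are not successors; each point is a finite iterated successor of
    exactly one of them. *)
Lemma limit_osum W : wo W -> nomax W -> exists S : binstr, linear S /\ iso W (osum (fun _ : S => omega)).
Proof.
move=> [lW wW] nW.
have succ (x : W) : exists y, prec x y /\ forall z, prec x z -> ~ prec z y.
  have [y xy] := nW x; have [z [xz mz]] := wW (fun z => prec x z) (ex_intro _ y xy).
  by exists z.
have [s hs] := choice succ.
have sup x : prec x (s x) by case: (hs x).
have smin x y : prec x y -> ~ prec y (s x) by move=> xy; case: (hs x) => _; apply.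
pose S := sub (fun x => forall z, s z <> x); have lS : linear S := linear_sub lW _.
exists S; split=> //; apply: iso_sym.
pose f (p : osum (fun _ : S => omega)) : W := iter (projT2 p : nat) s (sval (projT1 p)).
have itm x n m : (n < m)%N -> prec (iter n s x) (iter m s x).
  elim: m => // m IH; rewrite ltnS leq_eqVlt => /orP[/eqP->|/IH h]; first exact: sup.
  by apply: (ltr lW h); apply: sup.
apply: (@iso_surj _ _ f) => //.
- by apply: linear_osum => // _; apply: linear_nat.
- move=> [q n] [r m] h; case: (osum_le h) => [qr|e]; last first.
    change (q = r) in e; subst r; apply: itm; exact: (proj1 (osum_same _ _ lS) h).
  change (prec q r) in qr; rewrite /f /=.
  have qn : prec (iter n s (sval q)) (sval r).
    elim: (n) => // k IH; rewrite iterS; case: (lle lW (smin _ _ IH)) => // e.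
    by case: (proj2_sig r _ e).
  by case: m {h} => // m; apply: (ltr lW qn); apply: (itm _ 0).
- elim/(well_founded_ind (wf_well_founded wW)) => y IH.
  case: (pselect (forall z, s z <> y)) => [h|/existsNP[z /contrapT e]].
    by exists (existT _ (exist _ y h) (0%N : omega)).
  have [[q n] en] := IH z (eq_ind _ _ (sup z) _ e).
  by exists (existT _ q (n.+1 : omega)); rewrite /f /= -/(f (existT _ q n)) en.
Qed.

Definition colored X := exists (S : binstr) (col : S -> bool), linear S /\ iso X (Xof col).

Lemma colored_iso X Y : iso X Y -> colored Y -> colored X.
Proof. by move=> h [S [col [lS iY]]]; exists S, col; split=> //; apply: iso_trans h iY. Qed.

Lemma colored_rev X : colored X -> colored (rev_str X).
Proof.
move=> [S [col [lS iX]]]; exists (rev_str S), (fun s => ~~ col s); split; first exact: linear_rev.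
exact: iso_trans (iso_rev iX) (rev_Xof col lS).
Qed.

Lemma colored_oadd X Y : colored X -> colored Y -> colored (oadd X Y).
Proof.
move=> [S [col [lS iX]]] [S' [col' [lS' iY]]].
pose c (p : oadd S S') := match p with inl a => col a | inr b => col' b end.
have lSS := linear_oadd lS lS'.
exists (oadd S S'), c; split=> //; apply: iso_trans (iso_oadd iX iY) _.
pose f (p : oadd (Xof col) (Xof col')) : Xof c := match p with
  | inl q => existT (fun s => dom (color (c s))) (inl (projT1 q)) (projT2 q)
  | inr q => existT (fun s => dom (color (c s))) (inr (projT1 q)) (projT2 q) end.
apply: (@iso_surj _ _ f).
- by apply: linear_oadd; apply: linear_Xof.
- exact: linear_Xof.
- move=> [[q a]|[q a]] [[r b]|[r b]] h.
  + move/oadd_ll: h => h; case: (osum_le h) => [qr|e].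
      by apply: osum_ltI; apply/oadd_ll.
    by change (q = r) in e; subst r; apply/(osum_same _ _ lSS); move/(osum_same _ _ lS): h.
  + by apply: osum_ltI; apply: oadd_lr.
  + by case: (oadd_rl h).
  + move/oadd_rr: h => h; case: (osum_le h) => [qr|e].
      by apply: osum_ltI; apply/oadd_rr.
    by change (q = r) in e; subst r; apply/(osum_same _ _ lSS); move/(osum_same _ _ lS'): h.
- by move=> [[q|q] a]; [exists (inl (existT _ q a))|exists (inr (existT _ q a))].
Qed.

Lemma colored_copies X : colored X -> colored (copies X).
Proof.
move=> [S [col [lS iX]]]; have lO := linear_omega_star; have lC := linear_copies lS.
pose c (p : copies S) := col (projT2 p).
exists (copies S), c; split=> //.
apply: (iso_trans (iso_osum lO (fun _ => iX))).
have lX := linear_Xof col lS.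
pose f (p : copies (Xof col)) : Xof c :=
  existT (fun s => dom (color (c s))) (existT (fun _ : omega_star => dom S) (projT1 p) (projT1 (projT2 p)))
    (projT2 (projT2 p)).
apply: (@iso_surj _ _ f).
- exact: linear_copies.
- exact: linear_Xof.
- move=> [n [s a]] [m [t b]] h; case: (osum_le h) => [nm|e].
    by do 2 apply: osum_ltI.
  change (n = m) in e; subst m; have h' := proj1 (osum_same _ _ lO) h.
  case: (osum_le h') => [st|e]; first by apply: osum_ltI; apply/(osum_same _ _ lO).
  change (s = t) in e; subst t; apply/(osum_same _ _ lC); exact: (proj1 (osum_same _ _ lS) h').
- by move=> [[n s] a]; exists (existT _ n (existT _ s a)).
Qed.

Lemma colored_wo W : wo W -> nomax W -> colored W.
Proof. by move=> wW nW; have [S [lS iW]] := limit_osum wW nW; exists S, (fun _ => true). Qed.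

Lemma colored_ev p : okb p -> colored (blk_ord p).
Proof.
move=> [hA nA]; have cA := colored_wo (AI_wo hA) nA.
by case: p {hA nA} cA => A /= cA //; do ?[exact: colored_rev|exact: colored_copies|exact: colored_rev (colored_copies _)].
Qed.

Lemma ev_not_dense p : okb p -> ~ has_dense (blk_ord p).
Proof.
move=> okp; have lp := linear_ev okp; have [hA _] := okp; have wA := AI_wo hA.
case: p okp lp hA wA => A /= okp lp hA wA.
- by apply: lwf_not_dense => //; apply: wf_lwf; case: wA.
- by apply: rrwf_not_dense => //; rewrite /rrwf rev_strK; apply: wf_lwf; case: wA.
- by apply: lwf_not_dense => //; apply: lwf_copies.
- by apply: rrwf_not_dense => //; rewrite /rrwf rev_strK; apply: lwf_copies.
Qed.

Lemma blk_limit_type X : blk_sum X -> limit_type X.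
Proof.
move=> bX; have [lX _] := blk_CSB bX; have [l [hl _ iX]] := bX.
have nX : ~ has_dense X.
  have nl : ~ has_dense (lsum (map blk_ord l)).
    apply: lsum_not_dense; apply/List.Forall_forall => V /List.in_map_iff[p [<- hp]].
    by apply: ev_not_dense; move/List.Forall_forall: hl; apply.
  by move=> h; apply: nl; apply: dense_emb h => //; [apply: linear_iso (iso_sym iX) lX|apply: iso_emb].
have sX : scattered X by apply/scatteredE.
split=> //; have [S [col [lS iS]]] : colored X.
  apply: colored_iso iX _; elim: hl => [|p {}l okp _ IH] /=; last exact: colored_oadd (colored_ev okp) IH.
  exists emptyo, (fun _ => true); split; first exact: linear_emptyo.
  by apply: iso_empty; [case|case; case].
exists S, (fun s => color (col s)); split.
- apply: scattered_emb lS _ sX; apply: emb_trans (iso_emb' iS).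
  apply: emb_trans (iso_emb (@iso_subT S (fun _ => True) (fun _ => I))) _.
  exact: emb_trans (emb_reg col _) (emb_sub _).
- by move=> s; case: (col s); [left|right]; apply: iso_refl.
- by apply: equi_biemb => //; [apply: linear_Xof|split; [apply: iso_emb|apply: iso_emb']].
Qed.

(** * Disjoint unions *)

Lemma infinite_inj (T : Type) (A : set T) : infinite_set A ->
  exists j : nat -> T, injective j /\ forall n, A (j n).
Proof.
move=> /infiniteP/card_leP[f].
exists (fun n => val (f (SigSub (in_setT n)))); split=> [n m /val_inj e|n].
  by have /(congr1 val) := inj (in_setT _) (in_setT _) e.
by apply/set_mem; exact: valP.
Qed.

Lemma inj_infinite (T : Type) (A : set T) (j : nat -> T) : injective j -> (forall n, A (j n)) -> infinite_set A.
Proof.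
move=> ij hA fA; apply: infinite_nat.
rewrite (_ : [set: nat] = j @^-1` A)%classic; first by apply: finite_preimage fA => x y _ _; apply: ij.
by apply/seteqP; split=> n // _; apply: hA.
Qed.

Section Dunion.
Variables (I : Type) (X : I -> binstr).
Let D := dunion X.

Lemma dunion_same i (x y : X i) : @prec D (existT _ i x) (existT _ i y) <-> prec x y.
Proof.
split=> [|h]; last by right.
move E1 : (existT _ i x) => p; move E2 : (existT _ i y) => q h.
case: h E1 E2 => // s a b h E1 E2.
have /= e1 := projT1_eq E1; subst i.
by rewrite (existT_inj E1) (existT_inj E2).
Qed.

Lemma dunion_proj (p q : D) : prec p q -> projT1 p = projT1 q.
Proof. by case. Qed.

Lemma dunion_poset : (forall i, linear (X i)) -> poset D.
Proof.
move=> lX; split=> [[i x] /dunion_same /(lirr (lX i))//|[i x] [k y] [l z] h1 h2].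
have /= e1 := dunion_proj h1; have /= e2 := dunion_proj h2; subst k l.
by apply/dunion_same; apply: (ltr (lX i)) (proj1 (dunion_same _ _) h1) (proj1 (dunion_same _ _) h2).
Qed.
End Dunion.

(* Satisfied by sums of copies of omega and its reverse: split each summand into
   even and odd numbers. *)
Definition splits (X : binstr) := exists (P : X -> Prop) (f g : X -> X),
  [/\ hom f, hom g, forall y, P y <-> exists x, f x = y & forall y, ~ P y <-> exists x, g x = y].

Lemma splits_iso X Y : iso X Y -> splits X -> splits Y.
Proof.
move=> [phi [[psi k1 k2] hphi]] [P [f [g [hf hg Pf Pg]]]].
have hpsi : hom psi by move=> x y; rewrite -{1}(k2 x) -{1}(k2 y) => /hphi.
exists (fun y => P (psi y)), (phi \o f \o psi), (phi \o g \o psi); split.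
- by move=> x y /hpsi/hf/hphi.
- by move=> x y /hpsi/hg/hphi.
- move=> y; rewrite Pf; split=> [[x e]|[x <-]].
    by exists (phi x); rewrite /= k1 e k2.
  by exists (psi x); rewrite /= k1.
- move=> y; rewrite Pg; split=> [[x e]|[x <-]].
    by exists (phi x); rewrite /= k1 e k2.
  by exists (psi x); rewrite /= k1.
Qed.

Definition to_nat b : color b -> nat := match b with true => id | false => id end.
Definition of_nat b : nat -> color b := match b with true => id | false => id end.

Lemma to_natK b : cancel (@to_nat b) (@of_nat b). Proof. by case: b. Qed.
Lemma of_natK b : cancel (@of_nat b) (@to_nat b). Proof. by case: b. Qed.

Lemma hom_color b (s : nat -> nat) : (forall m n, (m < n)%N -> (s m < s n)%N) ->
  hom (fun x : color b => of_nat b (s (to_nat x))).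
Proof. by case: b => hs x y /= h; apply: hs. Qed.

Lemma splits_Xof (S : binstr) (col : S -> bool) : linear S -> splits (Xof col).
Proof.
move=> lS; pose P (p : Xof col) := ~~ odd (to_nat (projT2 p)).
pose F (s : nat -> nat) (p : Xof col) : Xof col := existT _ (projT1 p) (of_nat _ (s (to_nat (projT2 p)))).
have homF s : (forall m n, (m < n)%N -> (s m < s n)%N) -> hom (F s).
  move=> hs [q a] [r b] h; case: (osum_le h) => [qr|e]; first exact: osum_ltI.
  change (q = r) in e; subst r; apply/(osum_same _ _ lS).
  exact: hom_color hs _ _ (proj1 (osum_same _ _ lS) h).
exists P, (F double), (F (fun n => n.*2.+1)); split.
- by apply: homF => m n; rewrite ltn_double.
- by apply: homF => m n; rewrite ltnS ltn_double.
- move=> [q a]; rewrite /P /=; split=> [h|[[r b] e]].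
    exists (existT _ q (of_nat _ (to_nat a)./2)); rewrite /F /= of_natK.
    by rewrite even_halfK // to_natK.
  have /= eq := projT1_eq e; subst r; rewrite -(existT_inj e) /= of_natK odd_double //.
- move=> [q a]; rewrite /P /=; split=> [/negP|[[r b] e]].
    rewrite negbK => h.
    exists (existT _ q (of_nat _ (to_nat a)./2)); rewrite /F /= of_natK.
    rewrite (_ : (to_nat a)./2.*2.+1 = to_nat a) ?to_natK //.
    by rewrite -[RHS]odd_double_half h.
  have /= eq := projT1_eq e; subst r; rewrite -(existT_inj e) /= of_natK /= odd_double //.
Qed.

Lemma splits_limit X : CSB X -> limit_type X -> splits X.
Proof.
move=> cX lX; have [S [col [lS _ iX]]] := limit_type_Xof cX lX.
exact: splits_iso (iso_sym iX) (splits_Xof col lS).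
Qed.

Lemma inj_surj_bij (T U : Type) (f : T -> U) : injective f -> (forall y, exists x, f x = y) -> bijective f.
Proof.
move=> jf sf; exists (fun y => sval (cid (sf y))) => x; last by case: cid.
by apply: jf; case: cid.
Qed.

(* Split [X (j 0)] into the images of [X (j 0)] and [X (j 1)], and move [X (j n.+2)]
   onto [X (j n.+1)]. *)
Lemma not_reversible (I : Type) (X : I -> binstr) (j : nat -> I) :
  (forall i, linear (X i)) -> (forall i, inhabited (X i)) -> injective j ->
  (forall n m, iso (X (j n)) (X (j m))) -> splits (X (j 0%N)) -> ~ reversible (dunion X).
Proof.
move=> lX iX ij isoX [Ev [f0 [f1 [hf0 hf1 Pf0 Pf1]]]] rev.
pose D := dunion X.
pose EvD (p : D) := exists y, p = existT _ (j 0%N) y /\ Ev y.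
pose OdD (p : D) := exists y, p = existT _ (j 0%N) y /\ ~ Ev y.
(* [R i p] says that [p] belongs to the prescribed image of component [i]. These images partition
   the union ([disj], [cover]), which makes [F] bijective. *)
pose R i (p : D) := [\/ ~ (exists n, j n = i) /\ projT1 p = i, i = j 0%N /\ EvD p, i = j 1%N /\ OdD p |
  exists n, i = j n.+2 /\ projT1 p = j n.+1].
have exPhi i : exists Phi : X i -> D, hom Phi /\ forall p, R i p <-> exists x, Phi x = p.
  case: (pselect (exists n, j n = i)) => [[n e]|nr]; last first.
    exists (fun x => existT _ i x); split=> [x y h|p]; first exact/dunion_same.
    split=> [[[_ e]|[e _]|[e _]|[n [e _]]]|[x <-]]; try by case: nr; rewrite e; eexists.
      by case: p e => k x /= e; subst k; exists x.
    by apply: Or41.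
  subst i; case: n => [|[|n]].
  - exists (fun x => existT _ (j 0%N) (f0 x)); split=> [x y h|p]; first exact/dunion_same/hf0.
    split=> [[[[]]|[_ [y [-> /Pf0[x <-]]]]|[/ij//]|[n [/ij//]]]|[x <-]]; [by exists 0%N|by exists x|].
    by apply: Or42; split=> //; exists (f0 x); split=> //; apply/Pf0; exists x.
  - have [psi [[psi' k1 k2] hpsi]] := isoX 1%N 0%N.
    exists (fun x => existT _ (j 0%N) (f1 (psi x))); split=> [x y h|p]; first exact/dunion_same/hf1/hpsi.
    split=> [[[[]]|[/ij//]|[_ [y [-> /Pf1[x <-]]]]|[n [/ij//]]]|[x <-]]; first by exists 1%N.
      by exists (psi' x); rewrite k2.
    by apply: Or43; split=> //; exists (f1 (psi x)); split=> //; apply/Pf1; exists (psi x).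
  - have [psi [[psi' k1 k2] hpsi]] := isoX n.+2 n.+1.
    exists (fun x => existT _ (j n.+1) (psi x)); split=> [x y h|p]; first exact/dunion_same/hpsi.
    split=> [[[[]]|[/ij//]|[/ij//]|[m [/ij[enm] e]]]|[x <-]]; [by exists n.+2| |by apply: Or44; exists n].
    by rewrite -enm in e; case: p e => k y /= e; subst k; exists (psi' y); rewrite k2.
pose Phi i := sval (cid (exPhi i)).
have hPhi i : hom (Phi i) by rewrite /Phi; case: cid => ? [].
have RPhi i p : R i p <-> exists x, Phi i x = p by rewrite /Phi; case: cid => ? [].
have pD := dunion_poset lX; have irrD (p : D) : ~ prec p p by case: pD => h _; apply: h.
have R0 p : EvD p \/ OdD p -> projT1 p = j 0%N by case=> -[y [-> _]].
have disj i i' p : R i p -> R i' p -> i = i'.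
  move=> [[n1 e1]|[-> e1]|[-> e1]|[n [-> e1]]] [[n2 e2]|[-> e2]|[-> e2]|[m [-> e2]]] //.
  - by rewrite -e1 -e2.
  - by case: n1; exists 0%N; rewrite -e1 (R0 p) //; left.
  - by case: n1; exists 0%N; rewrite -e1 (R0 p) //; right.
  - by case: n1; exists m.+1; rewrite -e1 e2.
  - by case: n2; exists 0%N; rewrite -e2 (R0 p) //; left.
  - case: e1 e2 => y [ey Ey] [z [ez nEz]]; rewrite ey in ez.
    by case: nEz; rewrite -(existT_inj ez).
  - by have := R0 p (or_introl e1); rewrite e2 => /ij.
  - by case: n2; exists 0%N; rewrite -e2 (R0 p) //; right.
  - case: e2 e1 => y [ey Ey] [z [ez nEz]]; rewrite ey in ez.
    by case: nEz; rewrite -(existT_inj ez).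
  - by have := R0 p (or_intror e1); rewrite e2 => /ij.
  - by case: n2; exists n.+1; rewrite -e2 e1.
  - by have := R0 p (or_introl e2); rewrite e1 => /ij.
  - by have := R0 p (or_intror e2); rewrite e1 => /ij.
  - by move: e1; rewrite e2 => /ij[->].
have cover p : exists i, R i p.
  case: (pselect (exists n, j n = projT1 p)) => [[[|n] e]|nr].
  - case: p e => k y /= e; subst k; case: (pselect (Ev y)) => Ey.
      by exists (j 0%N); apply: Or42; split=> //; exists y.
    by exists (j 1%N); apply: Or43; split=> //; exists y.
  - by exists (j n.+2); apply: Or44; exists n.
  - by exists (projT1 p); apply: Or41.
pose F (p : D) : D := Phi (projT1 p) (projT2 p).
have hF : hom F.
  move=> [i x] [k y] h; have /= e := dunion_proj h; subst k.
  by exact: (hPhi _ _ _ (proj1 (dunion_same _ _) h)).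
have jF : injective F.
  move=> [i x] [k y] e.
  have e' : i = k by apply: (disj _ _ (F (existT _ i x))); apply/RPhi; [exists x|rewrite e; exists y].
  subst k; case: (ltot (lX i) x y) => [|[->//|]] /hPhi; rewrite /F /= in e; rewrite e => /irrD//.
have sF p : exists q, F q = p.
  by have [i /RPhi[x <-]] := cover p; exists (existT _ i x).
have sh := rev F (inj_surj_bij jF sF) hF.
have [x0] := iX (j 0%N); have [x1] := iX (j 1%N).
pose p0 : D := existT _ (j 0%N) x0; pose p1 : D := existT _ (j 1%N) x1.
have ne : j 0%N <> j 1%N by move/ij.
have e0 : projT1 (F p0) = j 0%N.
  apply: R0; left; have : R (j 0%N) (F p0) by apply/RPhi; exists x0.
  by case=> [[[]]|[]//|[/ij]//|[n [/ij]]//]; exists 0%N.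
have e1 : projT1 (F p1) = j 0%N.
  apply: R0; right; have : R (j 1%N) (F p1) by apply/RPhi; exists x1.
  by case=> [[[]]|[/ij]//|[]//|[n [/ij]]//]; exists 1%N.
(* [p0] and [p1] lie in different components and are incomparable, while their images lie in the
   linear component [X (j 0)]. *)
have : prec (F p0) (F p1) \/ F p0 = F p1 \/ prec (F p1) (F p0).
  case: (F p0) e0 => k y /= ek; case: (F p1) e1 => l z /= el; subst k l.
  by case: (ltot (lX _) y z) => [h|[->|h]]; [left|right; left|right; right] => //; apply/dunion_same.
case=> [/(proj2 (sh _ _))/dunion_proj//|[/jF/projT1_eq//|/(proj2 (sh _ _))/dunion_proj/esym//]].
Qed.

(** * Descending chains of finite sums *)

Lemma piece_emb A B : linear A -> emb A B -> piece B -> piece A.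
Proof.
move=> lA e [lB [w|w]]; split=> //; [left|right]; first exact: lwf_emb lA lB e w.
exact: (@lwf_emb _ _ (linear_rev lA) (linear_rev lB) (emb_rev e) w).
Qed.

Lemma ev_piece p : okb p -> piece (blk_ord p).
Proof.
move=> okp; split; first exact: linear_ev.
have [/AI_wo wA _] := okp; case: p {okp} wA => A /= wA.
- by left; apply: wf_lwf; case: wA.
- by right; rewrite /rrwf rev_strK; apply: wf_lwf; case: wA.
- by left; apply: lwf_copies.
- by right; rewrite /rrwf rev_strK; apply: lwf_copies.
Qed.

Lemma blk_index X : linear X -> blk_sum X -> exists (idx : X -> nat) m,
  [/\ forall x y, prec x y -> (idx x <= idx y)%N, forall x, (idx x < m)%N &
      forall k, piece (sub (fun x => idx x = k))].
Proof.
move=> lX [l [hl _ iX]].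
have hp : List.Forall piece (map blk_ord l).
  by apply/List.Forall_forall => V /List.in_map_iff[p [<- hp]]; apply: ev_piece; move/List.Forall_forall: hl; apply.
have [n [L [hL [f [bf hf]]]]] := proj2 (finite_sum_of_lsum piece X) (ex_intro _ _ (conj hp iX)).
exists (fun x => projT1 (f x) : nat), n; split.
- by move=> x y /hf /osum_le[/ltnW//|->].
- by move=> x; case: (projT1 (f x)).
move=> k; case: (ltnP k n) => kn; last first.
  have no (x : sub (fun x => (projT1 (f x) : nat) = k)) : False.
    by case: x => x; case: (projT1 (f x)) => i /= ik e; move: kn; rewrite -e leqNgt ik.
  split; first exact: linear_sub.
  by left; apply: wf_lwf => P [x]; case: (no x).
apply: piece_emb (hL (Ordinal kn)); first exact: linear_sub.
apply: emb_trans _ (@emb_block (ord_str n) L (Ordinal kn) (linear_ord n)).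
apply: (@emb_image _ _ _ f) => [x y /hf//|x e]; exact: val_inj.
Qed.

(* Cut [U n] along the blocks of [U 0] and stabilize each fiber by [wqo_piece]. *)
Lemma blk_dcc (U : nat -> binstr) : (forall n, linear (U n)) -> blk_sum (U 0%N) ->
  (forall n, emb (U n.+1) (U n)) -> exists N, forall n, (N <= n)%N -> emb (U N) (U n).
Proof.
move=> lU bU dU; have [idx [m [mono bd pc]]] := blk_index (lU 0%N) bU.
pose e n := sval (cid (dU n)); have he n : hom (e n) by rewrite /e; case: cid.
pose F := fix F n : U n -> U 0%N := match n with 0 => id | n'.+1 => fun x => F n' (e n' x) end.
have hF n : hom (F n) by elim: n => //= n IH x y /he /IH.
pose Y n k := sub (fun x : U n => idx (F n x) = k).
have dY k n : emb (Y n.+1 k) (Y n k) by apply: (emb_image (he n)).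
have pY k n : piece (Y n k).
  apply: piece_emb (pc k); first exact: linear_sub.
  exact: (emb_image (hF n)).
have mY k : exists N, forall n n', (N <= n)%N -> (n <= n')%N -> emb (Y n k) (Y n' k).
  have [N hN] := dcc wqo_piece (pY k) (dY k); exists N => n n' Nn nn'.
  apply: emb_trans (hN n' (leq_trans Nn nn')).
  elim: n Nn {nn'} => [|n IH]; first by rewrite leqn0 => /eqP->; apply: emb_refl.
  rewrite leq_eqVlt => /orP[/eqP->|h]; [exact: emb_refl|exact: emb_trans (dY k n) (IH h)].
have [N hN] : exists N, forall k, (k < m)%N -> forall n, (N <= n)%N -> emb (Y N k) (Y n k).
  have [N hN] := choice mY; exists (\max_(k < m) N k) => k km n hn.
  apply: hN => //; exact: (leq_bigmax (Ordinal km)).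
exists N => n Nn.
have split i : iso (U i) (lsum [seq Y i k | k <- iota 0 m]).
  have mi x y : prec x y -> (idx (F i x) <= idx (F i y))%N by move=> /hF; apply: mono.
  by apply: iso_trans _ (lsum_fibers 0 m (lU i) mi); apply: iso_subT => x; rewrite add0n leq0n; apply: bd.
apply: emb_trans (iso_emb (split N)) _; apply: emb_trans (iso_emb' (split n)).
have : {subset iota 0 m <= [pred k | (k < m)%N]} by move=> k; rewrite mem_iota.
elim: (iota 0 m) => [|k s IH] h /=; first exact: emb_refl.
apply: emb_oadd; first by apply: hN => //; apply: (h k); rewrite inE eqxx.
by apply: IH => k' hk'; apply: h; rewrite inE hk' orbT.
Qed.

(* One of [i], [i'] is not periodic, so its backward orbit is infinite. *)
Lemma backward_infinite (I : Type) (phi : I -> I) (i i' : I) : i <> i' -> phi i = phi i' ->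
  (forall k, exists l, phi l = k) -> exists u : nat -> I, injective u /\ forall n, phi (u n.+1) = u n.
Proof.
move=> ne e sphi.
have [a na] : exists a, forall n, iter n.+1 phi a <> a.
  apply: contrapT => /forallNP h.
  have [n /contrapT hn] : exists n, ~ (iter n.+1 phi i <> i) by apply/existsNP/h.
  have [m /contrapT hm] : exists n, ~ (iter n.+1 phi i' <> i') by apply/existsNP/h.
  (* If both points were periodic, a common multiple of the periods would fix both, although their
     orbits coincide after one step. *)
  have per b p k : iter p phi b = b -> iter (k * p) phi b = b.
    by move=> hb; elim: k => // k IH; rewrite mulSn iterD IH.
  apply: ne; rewrite -(per i _ m.+1 hn) -(per i' _ n.+1 hm) [(n.+1 * _)%N]mulnC.
  by rewrite mulSn addSn !iterSr e.
have [l _|u [u0 _ hu]] := @dep_choice I (fun _ => True) (fun x y => phi y = x) a _ Logic.I.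
  by have [k hk] := sphi l; exists k.
exists u; split=> //.
have back n d : iter d phi (u (d + n)%N) = u n by elim: d => // d IH; rewrite iterSr addSn hu IH.
have back0 n : iter n phi (u n) = a by have := back 0%N n; rewrite addn0 u0.
have main n m : (n < m)%N -> u n <> u m.
  move=> nm eu; apply: (na (m - n).-1).
  by rewrite prednK ?subn_gt0 // -{1}(back0 n) -iterD subnK ?(ltnW nm) // eu back0.
move=> n m eu; case: (ltngtP n m) => // h; [case: (main _ _ h)|case: (main _ _ h)] => //; exact: esym.
Qed.

Lemma union_reversible (I : Type) (X : I -> binstr) :
  (forall i, linear (X i)) -> (forall i, CSB (X i)) -> (forall i, blk_sum (X i)) ->
  (forall i, inhabited (X i)) ->
  ~ (exists J : set I, infinite_set J /\ forall i j, J i -> J j -> iso (X i) (X j)) ->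
  reversible (dunion X).
Proof.
move=> lX cX bX iX nJ f bf hf.
pose D := dunion X.
have exp i : exists x : X i, True by have [x] := iX i; exists x.
pose pt i : X i := sval (cid (exp i)).
pose phi i := projT1 (f (existT _ i (pt i))).
have fphi i (x : X i) : projT1 (f (existT _ i x)) = phi i.
  case: (ltot (lX i) x (pt i)) => [h|[->//|h]].
    by apply: (@dunion_proj _ X); apply: hf; apply/dunion_same.
  by apply/esym; apply: (@dunion_proj _ X); apply: hf; apply/dunion_same.
(* Points with comparable images have images in one component, so for injective [phi] they lie in
   one component themselves; there the order is linear and [f] reflects it. *)
case: (pselect (injective phi)) => [jphi|nj].
  move=> p q; split; first exact: hf.
  case: p q => i x [k y] h; have := dunion_proj h; rewrite !fphi => /jphi e; subst k.
  have irrD (r : D) : ~ prec r r by case: (dunion_poset lX) => ir _; apply: ir.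
  have trD (r s t : D) : prec r s -> prec s t -> prec r t by case: (dunion_poset lX) => _ tr; apply: tr.
  apply/dunion_same; case: (ltot (lX i) x y) => [//|[e|yx]].
    by subst y; case: (irrD _ h).
  by case: (irrD (f (existT _ i x))); apply: trD h _; apply: hf; apply/dunion_same.
exfalso; apply: nJ.
have [i [i' [ne e]]] : exists i i', i <> i' /\ phi i = phi i'.
  apply: contrapT => h; apply: nj => i i' e; apply: contrapT => ne; apply: h; by exists i, i'.
have [g fg gf] := bf.
have sphi k : exists l, phi l = k.
  exists (projT1 (g (existT _ k (pt k)))).
  by rewrite -(fphi _ (projT2 (g (existT _ k (pt k))))); case E: (g _) => [l x] /=; rewrite -E gf.
have [u [ju hu]] := backward_infinite ne e sphi.
have eX k : emb (X k) (X (phi k)).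
  have h (x : X k) : exists y : X (phi k), f (existT _ k x) = existT _ (phi k) y.
    by have := fphi k x; case: (f _) => l y /= el; subst l; exists y.
  exists (fun x => sval (cid (h x))) => x y xy; case: cid => a ea; case: cid => b eb /=.
  have /hf : @prec D (existT _ k x) (existT _ k y) by apply/dunion_same.
  by rewrite ea eb => /dunion_same.
have dX n : emb (X (u n.+1)) (X (u n)) by have := eX (u n.+1); rewrite hu.
have [N hN] := @blk_dcc (X \o u) (fun n => lX _) (bX _) dX.
have down n m : (n <= m)%N -> emb (X (u m)) (X (u n)).
  elim: m => [|m IH]; first by rewrite leqn0 => /eqP->; apply: emb_refl.
  rewrite leq_eqVlt => /orP[/eqP->|h]; first exact: emb_refl.
  exact: emb_trans (dX m) (IH h).
have isoN n : (N <= n)%N -> iso (X (u N)) (X (u n)).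
  by move=> Nn; apply: CSB_iso => //; [apply: hN|apply: down].
exists [set k | exists2 n, (N <= n)%N & k = u n]%classic; split.
  apply: (@inj_infinite _ _ (fun n => u (N + n)%N)) => [a b /ju/addnI//|n].
  by exists (N + n)%N => //; apply: leq_addr.
by move=> _ _ [n Nn ->] [m Nm ->]; apply: iso_trans (iso_sym (isoN n Nn)) (isoN m Nm).
Qed.

Theorem theorem5p4 :
  (forall X : binstr, linear X ->
     (CSB X /\ limit_type X <-> finite_sum_of summand X)) /\
  (forall (I : Type) (X : I -> binstr),
     (forall i, linear (X i) /\ CSB (X i) /\ limit_type (X i)) ->
     (forall i, inhabited (X i)) ->
     (poset (dunion X) /\ reversible (dunion X) <->
      ~ exists J : set I,
          infinite_set J /\ forall i j, J i -> J j -> iso (X i) (X j))).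
Proof.
split=> [X lX|I X hX iX].
  split=> [[cX ltX]|/fsE/fs_blk bX]; first by apply/fsE; apply: CSB_limit_fs.
  by split; [apply: blk_CSB|apply: blk_limit_type].
have lX i : linear (X i) by case: (hX i).
have cX i : CSB (X i) by case: (hX i) => _ [].
have ltX i : limit_type (X i) by case: (hX i) => _ [].
split=> [[_ rev] [J [infJ isoJ]]|nJ].
  have [j [ij hj]] := infinite_inj infJ.
  apply: (not_reversible lX iX ij _ (splits_limit (cX _) (ltX _)) rev) => n m.
  exact: isoJ.
split; first exact: dunion_poset.
by apply: union_reversible => // i; apply: fs_blk; apply: CSB_limit_fs.
Qed.
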